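(* For loops $g:S^1\to SU(2)$ of class $W^{1/2,L^2}$ having a triangular factorization $g=l\,m\,a\,u$, with root subgroup factorization $g=k_1(\eta)^*\,\mathrm{diag}(e^{\chi},e^{-\chi})\,k_2(\zeta)$, let $\psi_n$ ($n\ge0$) and $\xi_n$ ($n\ge1$) be the Taylor coefficients at $z=0$ defined by $$\frac{l_{21}^*(z)}{l_{11}^*(z)}=\sum_{n=0}^\infty\psi_nz^n,\qquad \frac{u_{21}(z)}{u_{22}(z)}=\sum_{n=1}^\infty\xi_nz^n .$$ (a) For each $i\ge0$, $\eta_i$ is a rational function (independent of $g$) of finitely many of the coefficients $\psi_{i'}$ and their complex conjugates, and in turn each coefficient $\psi_n$ is a polynomial (independent of $g$) in the complex conjugates of the coefficients of the expansions of $l_{21}$ and $l_{11}$ in powers of $z^{-1}$. (b) For each $k\ge1$, $\zeta_k$ is a rational function (independent of $g$) of finitely many of the coefficients $\xi_{k'}$ and their complex conjugates, and in turn each coefficient $\xi_n$ is a polynomial (independent of $g$) in the coefficients of the power series of $u_{21}$ and $u_{22}$ at $z=0$.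
   Context: $\Delta=\{|z|<1\}$ and $\Delta^*=\{|z|>1\}\cup\{\infty\}$; $H^0(U,G)$ denotes holomorphic maps from $U$ into $G=SL(2,\mathbb C)$. For a scalar function $f$, $f^*(z)=\overline{f(1/\bar z)}$; for a matrix-valued function, $f^*(z)$ is the Hermitian adjoint of $f(1/\bar z)$ (on $S^1$, the ordinary conjugate and adjoint). Triangular factorization of $g$: $g(z)=l(z)\,m\,a\,u(z)$ on $S^1$, where $l=(l_{ij})\in H^0(\Delta^*,G)$ with $l(\infty)=\begin{pmatrix}1&0\\ l_{21}(\infty)&1\end{pmatrix}$, $m=\mathrm{diag}(m_0,m_0^{-1})$ with $|m_0|=1$, $a=\mathrm{diag}(a_0,a_0^{-1})$ with $a_0>0$, $u=(u_{ij})\in H^0(\Delta,G)$ with $u(0)=\begin{pmatrix}1&u_{12}(0)\\0&1\end{pmatrix}$, and $l,u$ have appropriate ($L^2$) boundary values on $S^1$. Root subgroup factorization of $g$: $g=k_1(\eta)^*\,\mathrm{diag}(e^{\chi},e^{-\chi})\,k_2(\zeta)$ on $S^1$, where, with $\mathbf a(t)=(1+|t|^2)^{-1/2}$, $$k_1(\eta)(z)=\lim_{n\to\infty}\mathbf a(\eta_n)\begin{pmatrix}1&-\overline{\eta}_nz^n\\ \eta_nz^{-n}&1\end{pmatrix}\cdots\mathbf a(\eta_0)\begin{pmatrix}1&-\overline{\eta}_0\\ \eta_0&1\end{pmatrix},$$ $$k_2(\zeta)(z)=\lim_{n\to\infty}\mathbf a(\zeta_n)\begin{pmatrix}1&\zeta_nz^{-n}\\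 -\overline{\zeta}_nz^{n}&1\end{pmatrix}\cdots\mathbf a(\zeta_1)\begin{pmatrix}1&\zeta_1z^{-1}\\ -\overline{\zeta}_1z&1\end{pmatrix},$$ $\eta=(\eta_n)_{n\ge0}$, $\zeta=(\zeta_n)_{n\ge1}$ are complex sequences with decay corresponding to the smoothness of $g$ ($\sum_n n|\eta_n|^2<\infty$ and $\sum_n n|\zeta_n|^2<\infty$ for $g\in W^{1/2,L^2}$; rapidly decreasing if $g$ is $C^\infty$), $\chi(z)=\sum_j\chi_jz^j$ is an $i\mathbb R$-valued Fourier series (modulo $2\pi i\mathbb Z$), and limits are taken entrywise in $L^2(S^1)$. It is a known fact (which may be assumed) that a loop $g:S^1\to SU(2)$ having a triangular factorization has a unique root subgroup factorization, and conversely. It is also known (and may be assumed) that $k_1=k_1(\eta)$ and $k_2=k_2(\zeta)$ have triangular factorizations of the forms $$k_1=\begin{pmatrix}1&0\\ y^*&1\end{pmatrix}\begin{pmatrix}a_1&0\\0&a_1^{-1}\end{pmatrix}\begin{pmatrix}\alpha_1&\beta_1\\ \gamma_1&\delta_1\end{pmatrix},\qquad k_2=\begin{pmatrix}1&x^*\\0&1\end{pmatrix}\begin{pmatrix}a_2&0\\0&a_2^{-1}\end{pmatrix}\begin{pmatrix}\alpha_2&\beta_2\\ \gamma_2&\delta_2\end{pmatrix},$$ with $a_1,a_2>0$, $y=\sum_{n\ge0}y_nz^n$ and $x=\sum_{n\ge1}x_nz^n$ holomorphic in $\Delta$, and the last factors in $H^0(\Delta,G)$ and upper triangular unipotent at $z=0$.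 ''Rational function of the coefficients and their conjugates'' means a quotient of polynomials in these quantities whose denominator does not vanish at the values in question. *)

(* Defs.v *)
From mathcomp Require Import all_boot all_order all_algebra.
From mathcomp Require Export spectral complex.
From mathcomp Require Import all_classical all_reals all_analysis.
From mathcomp Require mpoly.

Set Implicit Arguments.
Unset Strict Implicit.
Unset Printing Implicit Defensive.

Import Order.TTheory GRing.Theory Num.Theory.
Import numFieldNormedType.Exports.

Local Open Scope classical_set_scope.
Local Open Scope ring_scope.
Local Open Scope complex_scope.
Local Open Scope sesquilinear_scope.

Section Defs.
Variable R : realType.
Local Notation C := R[i].
Local Notation mu := (@lebesgue_measure R).

Definition absc (z : C) : R := complex.Re `|z|.

Definition mx2 (a b c d : C) : 'M[C]_2 :=
  \matrix_(i, j) if i == 0 then (if j == 0 then a else b)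
                 else (if j == 0 then c else d).

(* A function on S^1 is represented by a function on C (or on the Riemann
   sphere) of which only the values at cis t are used; it is integrated
   against dt on [0, 2 pi]. *)
Definition cis (t : R) : C := cos t +i* sin t.

Definition cexp (z : C) : C := (expR (complex.Re z))%:C * cis (complex.Im z).

Definition ae_circle (P : C -> Prop) : Prop := {ae mu, forall t, P (cis t)}.

Definition circle_measurable (f : C -> C) : Prop :=
  measurable_fun [set: R] (fun t : R => complex.Re (f (cis t))) /\
  measurable_fun [set: R] (fun t : R => complex.Im (f (cis t))).

Definition period : set R := `[0, 2 * pi]%classic.

Definition sqL2 (f : C -> C) : \bar R :=
  (\int[mu]_(t in period) (absc (f (cis t)) ^+ 2)%:E)%E.

Definition inL2 (f : C -> C) : Prop :=
  circle_measurable f /\ (sqL2 f < +oo)%E.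

Definition circle_integral (f : C -> C) : C :=
  (\int[mu]_(t in period) complex.Re (f (cis t))) +i*
  (\int[mu]_(t in period) complex.Im (f (cis t))).

Definition fourier (f : C -> C) (n : int) : C :=
  ((2 * pi)^-1)%:C * circle_integral (fun z => f z * z ^ (- n)).

Definition W12 (f : C -> C) : Prop :=
  inL2 f /\
  (\esum_(n in [set: int]) ((absz n)%:R * absc (fourier f n) ^+ 2)%:E < +oo)%E.

Definition W12_SU2_loop (g : C -> 'M[C]_2) : Prop :=
  (forall i j, W12 (fun z => g z i j)) /\
  ae_circle (fun z => g z \is unitarymx /\ \det (g z) = 1).

Definition sphere : Type := one_point_compactification C.

(* z |-> 1/z, from C to the sphere; it maps the unit disk bijectively and
   biholomorphically onto {|z| > 1} together with infinity, so it serves as a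
   global chart of the latter. *)
Definition sphere_inv (z : C) : sphere := if z == 0 then None else Some z^-1.

Definition star (f : sphere -> C) (z : C) : C := (f (sphere_inv z^*))^*.

Definition holomorphic_disk (f : C -> C) : Prop :=
  forall z : C, `|z| < 1 -> derivable (f : C^o -> C^o) z 1.

Definition H0_disk_SL2 (u : C -> 'M[C]_2) : Prop :=
  (forall i j, holomorphic_disk (fun z => u z i j)) /\
  (forall z, `|z| < 1 -> \det (u z) = 1).

Definition H0_codisk_SL2 (l : sphere -> 'M[C]_2) : Prop :=
  H0_disk_SL2 (l \o sphere_inv).

(* The values of l and u on the unit circle are, by definition, their radial
   boundary values in the L^2 sense. *)
Definition L2_boundary_disk (f : C -> C) : Prop :=
  inL2 f /\ (sqL2 (fun z => f (r%:C * z) - f z) @[r --> 1^'-] --> 0%E).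

Definition L2_boundary_codisk (f : sphere -> C) : Prop :=
  inL2 (f \o Some) /\
  (sqL2 (fun z => f (Some (r%:C * z)) - f (Some z)) @[r --> 1^'+] --> 0%E).

Record triangular_factorization (g : C -> 'M[C]_2) (l : sphere -> 'M[C]_2)
    (m0 : C) (a0 : R) (u : C -> 'M[C]_2) : Prop := TriangularFactorization {
  tri_l_holo : H0_codisk_SL2 l;
  tri_l_infty : l None = mx2 1 0 (l None 1 0) 1;
  tri_l_bdry : forall i j, L2_boundary_codisk (fun z => l z i j);
  tri_m0 : `|m0| = 1;
  tri_a0 : 0 < a0;
  tri_u_holo : H0_disk_SL2 u;
  tri_u_0 : u 0 = mx2 1 (u 0 0 1) 0 1;
  tri_u_bdry : forall i j, L2_boundary_disk (fun z => u z i j);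
  tri_eq : ae_circle (fun z =>
    g z = l (Some z) *m mx2 m0 0 0 m0^-1 *m mx2 a0%:C 0 0 (a0%:C)^-1 *m u z)
}.

Definition ba (t : C) : C := ((Num.sqrt (1 + absc t ^+ 2))^-1)%:C.

Definition k1_factor (eta : nat -> C) (n : nat) (z : C) : 'M[C]_2 :=
  ba (eta n) *: mx2 1 (- (eta n)^* * z ^+ n) (eta n * z ^- n) 1.

Fixpoint k1_partial (eta : nat -> C) (n : nat) (z : C) : 'M[C]_2 :=
  if n is n'.+1 then k1_factor eta n'.+1 z *m k1_partial eta n' z
  else k1_factor eta 0 z.

Definition k2_factor (zeta : nat -> C) (n : nat) (z : C) : 'M[C]_2 :=
  ba (zeta n) *: mx2 1 (zeta n * z ^- n) (- (zeta n)^* * z ^+ n) 1.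

(* zeta 0 is never used: the sequence is indexed by n >= 1. *)
Fixpoint k2_partial (zeta : nat -> C) (n : nat) (z : C) : 'M[C]_2 :=
  if n is n'.+1 then k2_factor zeta n'.+1 z *m k2_partial zeta n' z
  else 1%:M.

Definition L2_limit (K : nat -> C -> 'M[C]_2) (k : C -> 'M[C]_2) : Prop :=
  forall i j, inL2 (fun z => k z i j) /\
    (sqL2 (fun z => K n z i j - k z i j) @[n --> \oo] --> 0%E).

(* For zeta, whose index starts at 1, the term n = 0 is harmless: its weight is 0. *)
Definition W12_decay (c : nat -> C) : Prop :=
  (\sum_(0 <= n <oo) (n%:R * absc (c n) ^+ 2)%:E < +oo)%E.

(* W12 chi is the regularity of chi corresponding to that of g; for chi merely
   in L^2, exp chi could have nonzero winding number. *)
Definition root_subgroup_factorization (g : C -> 'M[C]_2)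
    (eta : nat -> C) (chi : C -> C) (zeta : nat -> C) : Prop :=
  [/\ W12_decay eta, W12_decay zeta,
      W12 chi, ae_circle (fun z => complex.Re (chi z) = 0) &
      exists k1 k2 : C -> 'M[C]_2,
        [/\ L2_limit (k1_partial eta) k1, L2_limit (k2_partial zeta) k2 &
            ae_circle (fun z =>
              g z = (k1 z)^t* *m mx2 (cexp (chi z)) 0 0 (cexp (- chi z))
                    *m k2 z)]].

Definition taylor_at0 (c : nat -> C) (f : C -> C) : Prop :=
  exists2 r : R, 0 < r & forall z : C, absc z < r ->
    (\sum_(0 <= k < n) c k * z ^+ k : C^o) @[n --> \oo] --> (f z : C^o).

(* Expansion of a function near infinity in powers of 1/z. *)
Definition taylor_at_infty (c : nat -> C) (f : sphere -> C) : Prop :=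
  taylor_at0 c (f \o sphere_inv).

Definition conj_seq (c : nat -> C) (n : nat) : C := (c n)^*.

(* The polynomial p evaluated at (x_0, ..., x_(N-1), y_0, ..., y_(N-1)). *)
Definition eval2 (N : nat) (p : mpoly.mpoly (N + N) C) (x y : nat -> C) : C :=
  mpoly.meval (fun k : 'I_(N + N) => match fintype.split k with
                                     | inl j => x j
                                     | inr j => y j
                                     end) p.

End Defs.

(* Main.v *)
(** Let [(A, B)] be the first row of [k1]. Comparing the two factorizations of
[g] gives, on the circle, [exp chi * conj Phi = Theta], where
[Phi = l11^* B - l21^* A] and [Theta] is a multiple of [u21 k2_22 - u22 k2_21];
both have square integrable boundary values and no negative Fourier
coefficients, and [Theta] has mean zero. Writing [chi = c0 + p - conj p], this
reads [conj (Phi exp (-p)) * exp c0 = Theta exp (-p)], whose two sides have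
disjoint spectra, so that [Phi = Theta = 0]. As [p] need not be bounded, it is
replaced by its partial sums; the inequality of Lebedev and Milin bounds the
L2 norms of the functions [exp (-p)].

Hence [B / A = l21^* / l11^* = sum_n psi_n z^n] as power series, and [psi] is the
limit of the quotients of the first rows of the partial products of [k1].
Removing the innermost factor of such a product is a step of the Schur
algorithm: [eta_0 = - conj psi_0], and the shifted sequence [eta] belongs to the
series [z^-1 (psi - psi_0) / (1 + conj psi_0 psi)]. Conjugating by [diag (1, z)]
and swapping rows and columns reduces [k2] to [k1]. *)

Require Import Defs.
From mathcomp Require Import all_boot all_order all_algebra.
From mathcomp Require Import all_classical all_reals all_analysis.
From mathcomp Require Import measurable_realfun ring lra zify.
From mathcomp Require mpoly.
Set Implicit Arguments.
Unset Strict Implicit.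
Unset Printing Implicit Defensive.
Import Order.TTheory GRing.Theory Num.Theory.
Import numFieldNormedType.Exports.
Local Open Scope classical_set_scope.
Local Open Scope ring_scope.
Local Open Scope complex_scope.

(** Disjoint spectra alone do not force [Phi = Theta = 0]: for [exp chi = z] the relation has the
    solution [Phi = 1], [Theta = z]. What excludes it is the finite energy [sum_j j |chi_j|^2],
    which enters twice. It makes the partial sums of [chi] along the powers of 4 converge almost
    everywhere, so that [Phi (exp chi - exp S_N)] tends to 0 in L2 by dominated convergence; and it
    bounds [exp (- p_N)] in L2 uniformly in [N]. Their product tends to 0 in L1, hence so does each
    of its Fourier coefficients.

    The factors [l] and [u] have only square integrable boundary values. Their products with the
    entries of [k1] and [k2] stay square integrable because these entries are bounded by 1, and the
    product formula for coefficients holds because the entries used are L2 limits of polynomials.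

    Every Schur step divides by a series with constant term [1 + |psi_0|^2 > 0], so the rational
    functions have no pole at any sequence. Division by the series of [l11^*] or [u22], whose
    constant term is 1, yields polynomials. *)

(** * Modulus, conjugation and exponential of complex numbers *)

Section ComplexBasics.
Variable R : realType.
Local Notation C := R[i].
Implicit Types (z w : C) (x y t : R).

Lemma abscE z : `|z| = (absc z)%:C.
Proof. by rewrite /absc normc_def. Qed.

Lemma absc_sqrt z : absc z = Num.sqrt (complex.Re z ^+ 2 + complex.Im z ^+ 2).
Proof. by rewrite /absc normc_def. Qed.

Lemma absc_sqr z : absc z ^+ 2 = complex.Re z ^+ 2 + complex.Im z ^+ 2.
Proof. by rewrite absc_sqrt sqr_sqrtr // addr_ge0 // sqr_ge0. Qed.

Lemma absc_ge0 z : 0 <= absc z.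
Proof. by rewrite absc_sqrt sqrtr_ge0. Qed.

Lemma abscM z w : absc (z * w) = absc z * absc w.
Proof. by apply: complexI; rewrite -abscE normrM !abscE rmorphM. Qed.

Lemma abscD z w : absc (z + w) <= absc z + absc w.
Proof. by rewrite -lecR -abscE rmorphD /= -!abscE ler_normD. Qed.

Lemma abscN z : absc (- z) = absc z.
Proof. by apply: complexI; rewrite -!abscE normrN. Qed.

Lemma abscB z w : absc (z - w) <= absc z + absc w.
Proof. by rewrite (le_trans (abscD _ _)) // abscN. Qed.

Lemma absc_dist z w : absc (z - w) = absc (w - z).
Proof. by rewrite -abscN opprB. Qed.

Lemma absc0 : absc (0 : C) = 0.
Proof. by apply: complexI; rewrite -abscE normr0. Qed.

Lemma absc1 : absc (1 : C) = 1.
Proof. by apply: complexI; rewrite -abscE normr1. Qed.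

Lemma absc_real x : absc x%:C = `|x|.
Proof. by rewrite absc_sqrt /= expr0n addr0 sqrtr_sqr. Qed.

Lemma abscX z n : absc (z ^+ n) = absc z ^+ n.
Proof. by apply: complexI; rewrite -abscE normrX abscE rmorphXn. Qed.

Lemma absc_conj z : absc (conjc z) = absc z.
Proof. by rewrite !absc_sqrt; case: z => a b /=; rewrite sqrrN. Qed.

Lemma absc_eq0 z : (absc z == 0) = (z == 0).
Proof.
rewrite -[RHS]normr_eq0 abscE; apply/eqP/eqP => [->//|H].
by apply: complexI.
Qed.

Lemma absc_gt0 z : (0 < absc z) = (z != 0).
Proof. by rewrite lt0r absc_ge0 andbT absc_eq0. Qed.

Lemma absc_sum (I : Type) (r : seq I) (P : pred I) (F : I -> C) :
  absc (\sum_(i <- r | P i) F i) <= \sum_(i <- r | P i) absc (F i).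
Proof.
elim/big_ind2: _ => [|u a v b ua vb|//]; first by rewrite absc0.
by rewrite (le_trans (abscD _ _)) // lerD.
Qed.

Lemma Re_le_absc z : `|complex.Re z| <= absc z.
Proof.
by rewrite -(ler_pXn2r (n := 2)) ?nnegrE ?absc_ge0 // real_normK ?num_real //
  absc_sqr lerDl sqr_ge0.
Qed.

Lemma Im_le_absc z : `|complex.Im z| <= absc z.
Proof.
by rewrite -(ler_pXn2r (n := 2)) ?nnegrE ?absc_ge0 // real_normK ?num_real //
  absc_sqr lerDr sqr_ge0.
Qed.

Lemma absc_le_ReIm z : absc z <= `|complex.Re z| + `|complex.Im z|.
Proof.
rewrite -(ler_pXn2r (n := 2)) ?nnegrE ?absc_ge0 ?addr_ge0 // absc_sqr sqrrD.
by rewrite !real_normK ?num_real // -addrA lerD2l lerDr mulrn_wge0 // mulr_ge0.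
Qed.

Lemma mul_conj z : z * (conjc z) = (absc z ^+ 2)%:C.
Proof.
rewrite absc_sqr; case: z => a b; apply/eqP; rewrite eq_complex /=.
by rewrite mulrN opprK -!expr2 eqxx /= mulrN mulrC addrC subrr.
Qed.

Lemma ReD z w : complex.Re (z + w) = complex.Re z + complex.Re w.
Proof. by case: z; case: w. Qed.
Lemma ImD z w : complex.Im (z + w) = complex.Im z + complex.Im w.
Proof. by case: z; case: w. Qed.
Lemma ReN z : complex.Re (- z) = - complex.Re z.
Proof. by case: z. Qed.
Lemma ImN z : complex.Im (- z) = - complex.Im z.
Proof. by case: z. Qed.
Lemma ReM z w : complex.Re (z * w) =
  complex.Re z * complex.Re w - complex.Im z * complex.Im w.
Proof. by case: z; case: w. Qed.
Lemma ImM z w : complex.Im (z * w) =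
  complex.Re z * complex.Im w + complex.Im z * complex.Re w.
Proof. by case: z; case: w. Qed.
Lemma Re_conj z : complex.Re (conjc z) = complex.Re z.
Proof. by case: z. Qed.
Lemma Im_conj z : complex.Im (conjc z) = - complex.Im z.
Proof. by case: z. Qed.
Lemma complex_eqP z w :
  complex.Re z = complex.Re w -> complex.Im z = complex.Im w -> z = w.
Proof. by case: z; case: w => ? ? ? ? /= -> ->. Qed.

Definition ReIm := (ReD, ImD, ReN, ImN, ReM, ImM, Re_conj, Im_conj).

Lemma conjCE z : Num.conj z = conjc z.
Proof. by []. Qed.

Lemma conj_real x : (conjc (x%:C)) = x%:C :> C.
Proof. by apply: complex_eqP; rewrite //= oppr0. Qed.

Lemma conjcM z w : (conjc (z * w)) = (conjc z) * (conjc w).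
Proof. exact: rmorphM. Qed.

Lemma conjcD z w : (conjc (z + w)) = (conjc z) + (conjc w).
Proof. exact: rmorphD. Qed.

Lemma conjcN z : (conjc (- z)) = - (conjc z).
Proof. exact: rmorphN. Qed.

Lemma conjcB z w : (conjc (z - w)) = (conjc z) - (conjc w).
Proof. exact: rmorphB. Qed.

Lemma conjcX z n : (conjc (z ^+ n)) = (conjc z) ^+ n.
Proof. exact: rmorphXn. Qed.

Lemma conjc_sum (I : Type) (r : seq I) (P : pred I) (F : I -> C) :
  (conjc (\sum_(i <- r | P i) F i)) = \sum_(i <- r | P i) (conjc (F i)).
Proof. exact: rmorph_sum. Qed.

Lemma cisD x y : cis (x + y) = cis x * cis y.
Proof. by apply: complex_eqP; rewrite !ReIm /= ?cosD ?sinD // addrC. Qed.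

Lemma cis0 : cis (0 : R) = 1.
Proof. by rewrite /cis cos0 sin0. Qed.

Lemma absc_cis t : absc (cis t) = 1.
Proof. by rewrite absc_sqrt /= cos2Dsin2 sqrtr1. Qed.

Lemma cis_neq0 t : cis t != 0.
Proof. by rewrite -absc_gt0 absc_cis. Qed.

Lemma cisN t : cis (- t) = (conjc (cis t)).
Proof. by rewrite /cis cosN sinN. Qed.

Lemma cisNV t : cis (- t) = (cis t)^-1.
Proof.
by apply: (mulfI (cis_neq0 t)); rewrite -cisD subrr cis0 divff // cis_neq0.
Qed.

Lemma conj_cis t : (conjc (cis t)) = (cis t)^-1.
Proof. by rewrite -cisN cisNV. Qed.

Lemma cis_exp t (n : nat) : cis t ^+ n = cis (n%:R * t).
Proof.
elim: n => [|n IH]; first by rewrite mul0r cis0.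
by rewrite exprS IH -cisD -natr1 mulrDl mul1r addrC.
Qed.

Lemma cis_expz t (n : int) : cis t ^ n = cis (n%:~R * t).
Proof.
case: n => n; first exact: cis_exp.
rewrite -[cis t ^ _]/((cis t ^+ n.+1)^-1) cis_exp -cisNV.
by rewrite NegzE mulrNz mulNr.
Qed.

Lemma cis2pi : cis (2 * pi : R) = 1.
Proof.
have cispi : cis (pi : R) = -1.
  by apply: complex_eqP; rewrite /= ?cospi ?sinpi ?oppr0.
by rewrite mulr2n mulrDl mul1r cisD cispi mulrNN mulr1.
Qed.

Lemma cexpD z w : cexp (z + w) = cexp z * cexp w.
Proof. by rewrite /cexp !ReIm expRD cisD rmorphM mulrACA. Qed.

Lemma cexp0 : cexp (0 : C) = 1.
Proof. by rewrite /cexp expR0 cis0 mul1r. Qed.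

Lemma absc_cexp z : absc (cexp z) = expR (complex.Re z).
Proof. by rewrite /cexp abscM absc_cis mulr1 absc_real ger0_norm // expR_ge0. Qed.

Lemma cexp_neq0 z : cexp z != 0.
Proof. by rewrite -absc_gt0 absc_cexp expR_gt0. Qed.

Lemma cexpN z : cexp (- z) = (cexp z)^-1.
Proof.
by apply: (mulfI (cexp_neq0 z)); rewrite -cexpD subrr cexp0 divff // cexp_neq0.
Qed.

Lemma cexp_conj z : cexp (conjc z) = (conjc (cexp z)).
Proof.
by rewrite /cexp Re_conj Im_conj cisN conjcM conj_real.
Qed.

Lemma cexpM_nat z n : cexp (n%:R * z) = cexp z ^+ n.
Proof.
elim: n => [|n IH]; first by rewrite mul0r cexp0.
by rewrite exprS -IH -cexpD -natr1 mulrDl mul1r addrC.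
Qed.

End ComplexBasics.

(** * Integrals of real functions over one period *)

Section CircleIntegrals.
Variable R : realType.
Local Notation C := R[i].
Local Notation mu := (@lebesgue_measure R).
Local Notation period := (@period R).
Implicit Types (F G : R -> C) (f g h : R -> R).

(* The Borel sigma-algebra, on which lebesgue_measure lives, is carried by the
   alias measurableTypeR of R. *)
Definition rmeas f := measurable_fun (period : set (measurableTypeR R)) f.
Definition rintegrable f := mu.-integrable period (EFin \o f).
Definition rint f : R := (\int[mu]_(t in period) f t)%R.

Lemma aeS (P Q : R -> Prop) : (forall t, P t -> Q t) ->
  {ae mu, forall t, P t} -> {ae mu, forall t, Q t}.
Proof.
move=> PQ [N [mN N0 sN]]; exists N; split => // t /= nQ.
by apply: sN => /= Pt; apply: nQ; exact: PQ.
Qed.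

Lemma aeI (P Q : R -> Prop) : {ae mu, forall t, P t} ->
  {ae mu, forall t, Q t} -> {ae mu, forall t, P t /\ Q t}.
Proof.
move=> [N [mN N0 sN]] [M [mM M0 sM]]; exists (N `|` M); split.
- exact: measurableU.
- by rewrite null_set_setU.
- move=> t /= nPQ; have [Pt|/sN] := pselect (P t); last by left.
  by right; apply: sM => /= Qt; apply: nPQ.
Qed.

Lemma measurable_period : measurable (period : set (measurableTypeR R)).
Proof. exact: measurable_itv. Qed.
Hint Resolve measurable_period : core.

Lemma mu_period : mu period = (2 * pi)%:E.
Proof.
rewrite /Defs.period lebesgue_measure_itv /= lte_fin mulr_gt0 ?pi_gt0 //.
by rewrite sube0.
Qed.

Lemma twopi_gt0 : 0 < 2 * pi :> R.
Proof. by rewrite mulr_gt0 ?pi_gt0. Qed.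

Lemma rmeas_default f :
  measurable_fun [set: R] f -> rmeas f.
Proof. by move=> mf; apply: measurable_funS (mf : measurable_fun [set: measurableTypeR R] f). Qed.

Lemma rintegrable_meas f : rintegrable f -> rmeas f.
Proof. by move=> /integrableP[/measurable_EFinP]. Qed.

Lemma rintegrable_cst (c : R) : rintegrable (fun=> c).
Proof.
apply/integrableP; split; first exact/measurable_EFinP.
by rewrite integral_cst //= mu_period -EFinM ltry.
Qed.

Lemma rintegrable_le f g : rmeas f ->
  (forall t, period t -> `|f t| <= g t) -> rintegrable g -> rintegrable f.
Proof.
move=> mf fg; apply: le_integrable => //; first exact/measurable_EFinP.
move=> t Dt /=; rewrite lee_fin (le_trans (fg t Dt)) //.
exact: ler_norm.
Qed.

(** Domination almost everywhere becomes pointwise once both functions are set to 0 on the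
    exceptional null set, and the integral of [|f|] does not see this change. *)
Lemma rintegrable_le_ae f g : rmeas f ->
  {ae mu, forall t, period t -> `|f t| <= g t} -> rintegrable g -> rintegrable f.
Proof.
move=> mf fg ig.
have [N [mN N0 sN]] := fg.
have ig' : rintegrable (g \_ (~` N)).
  have ian : rintegrable (fun t => `|g t|) by exact: (integrable_norm ig).
  apply: (rintegrable_le _ _ ian).
    apply/measurable_restrict => //; first exact: measurableC.
    by apply: measurable_funS (rintegrable_meas ig) => //.
  by move=> t _; rewrite /patch; case: ifPn; rewrite ?normr0.
have if' : rintegrable (f \_ (~` N)).
  apply: (rintegrable_le _ _ ig').
    apply/measurable_restrict => //; first exact: measurableC.
    by apply: measurable_funS mf => //.
  move=> t Dt; rewrite /patch; case: ifPn => [|_]; last by rewrite normr0.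
  rewrite inE => nN; apply: contrapT => H; apply: nN; apply: sN => /= /(_ Dt) //.
apply/integrableP; split; first exact/measurable_EFinP.
case/integrableP: if' => _; apply: le_lt_trans.
rewrite le_eqVlt; apply/orP; left; apply/eqP.
apply: ae_eq_integral => //.
- by apply: measurableT_comp => //; exact/measurable_EFinP.
- apply: measurableT_comp => //; apply/measurable_EFinP.
  apply/measurable_restrict => //; first exact: measurableC.
  by apply: measurable_funS mf => //.
- exists N; split => // t /= H; apply: contrapT => nN; apply: H => _.
  by rewrite /patch mem_set.
Qed.

Lemma rintegrableD f g : rintegrable f -> rintegrable g ->
  rintegrable (fun t => f t + g t).
Proof.
move=> If Ig; have := integrableD measurable_period If Ig.
by apply: eq_integrable.
Qed.

Lemma rintegrableZ (c : R) f : rintegrable f -> rintegrable (fun t => c * f t).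
Proof.
move=> If; have := integrableZl measurable_period c If.
by apply: eq_integrable.
Qed.

Lemma rintD f g : rintegrable f -> rintegrable g ->
  rint (fun t => f t + g t) = rint f + rint g.
Proof. exact: RintegralD. Qed.

Lemma rintB f g : rintegrable f -> rintegrable g ->
  rint (fun t => f t - g t) = rint f - rint g.
Proof. exact: RintegralB. Qed.

Lemma rintZ (c : R) f : rintegrable f -> rint (fun t => c * f t) = c * rint f.
Proof. exact: RintegralZl. Qed.

Lemma rint_cst (c : R) : rint (fun=> c) = c * (2 * pi).
Proof. by rewrite /rint Rintegral_cst //= mu_period. Qed.

Lemma rint_ge0 f : (forall t, period t -> 0 <= f t) -> 0 <= rint f.
Proof. by move=> f0; rewrite /rint; apply: Rintegral_ge0. Qed.

Lemma rint_le f g : rintegrable f -> rintegrable g ->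
  (forall t, period t -> f t <= g t) -> rint f <= rint g.
Proof. exact: le_Rintegral. Qed.

Lemma rint_eq_ae f g : rmeas f -> rmeas g ->
  {ae mu, forall t, period t -> f t = g t} -> rint f = rint g.
Proof.
move=> mf mg fg; congr fine; apply: ae_eq_integral => //; try exact/measurable_EFinP.
by apply: aeS fg => t /= H Dt; rewrite H.
Qed.

(** The function [g] is replaced by [max f g], which equals [g] almost everywhere and dominates [f]
    at every point. *)
Lemma rint_le_ae f g : rintegrable f -> rintegrable g ->
  {ae mu, forall t, period t -> f t <= g t} -> rint f <= rint g.
Proof.
move=> If Ig fg.
have mf := rintegrable_meas If; have mg := rintegrable_meas Ig.
have mm : rmeas (fun t => Num.max (f t) (g t)).
  exact: measurable_maxr.
rewrite (@rint_eq_ae g (fun t => Num.max (f t) (g t))) //.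
  apply: rint_le => //; last by move=> t _; rewrite le_max lexx.
  apply: (rintegrable_le_ae (g := fun t => `|g t|)) => //.
    by apply: aeS fg => t /= H Dt; rewrite max_r // H.
  exact: (integrable_norm Ig).
by apply: aeS fg => t /= H Dt; rewrite max_r // H.
Qed.

Lemma rint_dct (h : nat -> R -> R) g :
  (forall n, rmeas (h n)) ->
  {ae mu, forall t, period t -> h ^~ t n @[n --> \oo] --> (0 : R)} ->
  rintegrable g ->
  (forall n t, period t -> `|h n t| <= g t) ->
  rint (h n) @[n --> \oo] --> (0 : R).
Proof.
move=> mh hc ig hg.
have [] := @dominated_convergence _ _ _ mu period measurable_period
  (fun n t => (h n t)%:E) (fun=> 0%E) (EFin \o g).
- by move=> n; apply/measurable_EFinP; exact: mh.
- exact: measurable_cst.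
- apply: aeS hc => t H Dt; apply: cvg_EFin; first exact: nearW.
  exact: H.
- exact: ig.
- by apply: aeW => t n Dt; rewrite lee_fin hg.
move=> _ _; rewrite integral0 => /fine_cvg /=; exact.
Qed.

End CircleIntegrals.
#[export] Hint Resolve measurable_period : core.

(** * Integrals of complex functions over one period *)

Section ComplexIntegrals.
Variable R : realType.
Local Notation C := R[i].
Local Notation mu := (@lebesgue_measure R).
Local Notation period := (@period R).
Implicit Types (F G : R -> C) (f g h : R -> R).

Lemma rmeas_cst (c : R) : rmeas (fun=> c).
Proof. exact: measurable_cst. Qed.

Lemma rmeas_id : rmeas (fun t : R => t).
Proof. exact: rmeas_default (@measurable_id _ _ _). Qed.

Lemma rmeasD f g : rmeas f -> rmeas g -> rmeas (fun t => f t + g t).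
Proof. exact: measurable_funD. Qed.

Lemma rmeasM f g : rmeas f -> rmeas g -> rmeas (fun t => f t * g t).
Proof. exact: measurable_funM. Qed.

Lemma rmeasN f : rmeas f -> rmeas (fun t => - f t).
Proof. by move=> mf; apply: measurableT_comp. Qed.

Lemma rmeasB f g : rmeas f -> rmeas g -> rmeas (fun t => f t - g t).
Proof. by move=> mf mg; apply: rmeasD => //; apply: rmeasN. Qed.

Lemma rmeas_comp f g : rmeas f -> continuous g -> rmeas (g \o f).
Proof.
move=> mf cg; rewrite /rmeas.
have X := continuous_measurable_fun cg.
exact: (measurableT_comp (T1 := measurableTypeR R) X mf).
Qed.

Lemma rmeas_continuous f : continuous f -> rmeas f.
Proof. by move=> cf; exact: (rmeas_default (continuous_measurable_fun cf)). Qed.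

Definition cmeas F :=
  rmeas (fun t => complex.Re (F t)) /\ rmeas (fun t => complex.Im (F t)).

Lemma cmeasD F G : cmeas F -> cmeas G -> cmeas (fun t => F t + G t).
Proof.
move=> [F1 F2] [G1 G2]; split.
  by under eq_fun do rewrite ReD; exact: rmeasD.
by under eq_fun do rewrite ImD; exact: rmeasD.
Qed.

Lemma cmeasN F : cmeas F -> cmeas (fun t => - F t).
Proof.
move=> [F1 F2]; split.
  by under eq_fun do rewrite ReN; exact: rmeasN.
by under eq_fun do rewrite ImN; exact: rmeasN.
Qed.

Lemma cmeasB F G : cmeas F -> cmeas G -> cmeas (fun t => F t - G t).
Proof. by move=> mF mG; apply: cmeasD => //; apply: cmeasN. Qed.

Lemma cmeasM F G : cmeas F -> cmeas G -> cmeas (fun t => F t * G t).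
Proof.
move=> [F1 F2] [G1 G2]; split.
  under eq_fun do rewrite ReM.
  by apply: rmeasB; exact: rmeasM.
under eq_fun do rewrite ImM.
by apply: rmeasD; exact: rmeasM.
Qed.

Lemma cmeas_conj F : cmeas F -> cmeas (fun t => conjc (F t)).
Proof.
move=> [F1 F2]; split.
  by under eq_fun do rewrite Re_conj.
by under eq_fun do rewrite Im_conj; exact: rmeasN.
Qed.

Lemma cmeas_cst (c : C) : cmeas (fun=> c).
Proof. by split; exact: rmeas_cst. Qed.

Lemma cmeas_cis : cmeas (@cis R).
Proof.
by split; apply: rmeas_continuous; [exact: continuous_cos | exact: continuous_sin].
Qed.

Lemma cmeas_cisz (n : int) : cmeas (fun t => cis t ^ n).
Proof.
split; under eq_fun do rewrite cis_expz /=.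
  apply: (rmeas_comp (f := fun t : R => n%:~R * t) (g := cos)).
    exact: (rmeasM (rmeas_cst _) rmeas_id).
  exact: continuous_cos.
apply: (rmeas_comp (f := fun t : R => n%:~R * t) (g := sin)).
  exact: (rmeasM (rmeas_cst _) rmeas_id).
exact: continuous_sin.
Qed.

Lemma cmeas_sum (I : Type) (r : seq I) (P : pred I) (F : I -> R -> C) :
  (forall i, cmeas (F i)) -> cmeas (fun t => \sum_(i <- r | P i) F i t).
Proof.
move=> mF; elim: r => [|i r IH].
  by under eq_fun do rewrite big_nil; exact: cmeas_cst.
under eq_fun do rewrite big_cons.
by case: (P i) => //; apply: cmeasD.
Qed.

Lemma cmeasX F n : cmeas F -> cmeas (fun t => F t ^+ n).
Proof.
move=> mF; elim: n => [|n IH].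
  by under eq_fun do rewrite expr0; exact: cmeas_cst.
by under eq_fun do rewrite exprS; exact: cmeasM.
Qed.

Lemma rmeas_sqr_absc F : cmeas F -> rmeas (fun t => absc (F t) ^+ 2).
Proof.
move=> [F1 F2]; under eq_fun do rewrite absc_sqr !expr2.
by apply: rmeasD; exact: rmeasM.
Qed.

Lemma rmeas_absc F : cmeas F -> rmeas (fun t => absc (F t)).
Proof.
move=> /rmeas_sqr_absc mF.
have -> : (fun t => absc (F t)) = Num.sqrt \o (fun t => absc (F t) ^+ 2).
  by apply/funext => t /=; rewrite sqrtr_sqr ger0_norm // absc_ge0.
by apply: rmeas_comp => //; exact: sqrt_continuous.
Qed.

Definition cintegrable F := cmeas F /\ rintegrable (fun t => absc (F t)).

Lemma cintegrable_le F g : cmeas F -> (forall t, period t -> absc (F t) <= g t) ->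
  rintegrable g -> cintegrable F.
Proof.
move=> mF Fg ig; split => //; apply: rintegrable_le ig; first exact: rmeas_absc.
by move=> t Dt; rewrite ger0_norm ?absc_ge0 // Fg.
Qed.

Lemma cintegrable_le_ae F g : cmeas F ->
  {ae mu, forall t, period t -> absc (F t) <= g t} ->
  rintegrable g -> cintegrable F.
Proof.
move=> mF Fg ig; split => //; apply: rintegrable_le_ae ig.
  exact: rmeas_absc.
by apply: aeS Fg => t + Dt => /(_ Dt); rewrite ger0_norm ?absc_ge0.
Qed.

Lemma cintegrable_bounded F (K : R) : cmeas F ->
  (forall t, period t -> absc (F t) <= K) -> cintegrable F.
Proof.
by move=> mF FK; apply: (cintegrable_le mF FK); exact: rintegrable_cst.
Qed.

Lemma cintegrable_Re F : cintegrable F -> rintegrable (fun t => complex.Re (F t)).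
Proof.
move=> [[m1 m2] iF]; apply: rintegrable_le iF => // t _; exact: Re_le_absc.
Qed.

Lemma cintegrable_Im F : cintegrable F -> rintegrable (fun t => complex.Im (F t)).
Proof.
move=> [[m1 m2] iF]; apply: rintegrable_le iF => // t _; exact: Im_le_absc.
Qed.

Lemma cintegrableD F G : cintegrable F -> cintegrable G ->
  cintegrable (fun t => F t + G t).
Proof.
move=> [mF iF] [mG iG]; apply: cintegrable_le (rintegrableD iF iG).
  exact: cmeasD.
by move=> t _; exact: abscD.
Qed.

Lemma cintegrableMb F G (K : R) : cintegrable F -> cmeas G ->
  (forall t, period t -> absc (G t) <= K) -> cintegrable (fun t => F t * G t).
Proof.
move=> [mF iF] mG GK; apply: cintegrable_le (rintegrableZ K iF).
  exact: cmeasM.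
by move=> t Dt; rewrite abscM mulrC ler_wpM2r ?absc_ge0 // GK.
Qed.

Lemma cintegrableZ (c : C) F : cintegrable F -> cintegrable (fun t => c * F t).
Proof.
move=> iF; under eq_fun do rewrite mulrC.
by apply: (@cintegrableMb _ _ (absc c)) => //; exact: cmeas_cst.
Qed.

Lemma cintegrableN F : cintegrable F -> cintegrable (fun t => - F t).
Proof.
move=> [mF iF]; split; first exact: cmeasN.
by under eq_fun do rewrite abscN.
Qed.

Lemma cintegrableB F G : cintegrable F -> cintegrable G ->
  cintegrable (fun t => F t - G t).
Proof. by move=> iF iG; apply: cintegrableD => //; apply: cintegrableN. Qed.

Lemma cintegrable_conj F : cintegrable F -> cintegrable (fun t => conjc (F t)).
Proof.
move=> [mF iF]; split; first exact: cmeas_conj.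
by under eq_fun do rewrite absc_conj.
Qed.

Definition cintg F : C :=
  rint (fun t => complex.Re (F t)) +i* rint (fun t => complex.Im (F t)).

Lemma cintgD F G : cintegrable F -> cintegrable G ->
  cintg (fun t => F t + G t) = cintg F + cintg G.
Proof.
move=> iF iG; apply: complex_eqP; rewrite /cintg !ReIm /=.
  under [X in rint X]eq_fun do rewrite ReD.
  by rewrite rintD //; exact: cintegrable_Re.
under [X in rint X]eq_fun do rewrite ImD.
by rewrite rintD //; exact: cintegrable_Im.
Qed.

Lemma cintgZ (c : C) F : cintegrable F -> cintg (fun t => c * F t) = c * cintg F.
Proof.
move=> iF; have iR := cintegrable_Re iF; have iI := cintegrable_Im iF.
apply: complex_eqP; rewrite /cintg !ReIm /=.
  under [X in rint X]eq_fun do rewrite ReM.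
  by rewrite rintB ?rintZ //; exact: rintegrableZ.
under [X in rint X]eq_fun do rewrite ImM.
by rewrite rintD ?rintZ //; exact: rintegrableZ.
Qed.

Lemma cintgN F : cintegrable F -> cintg (fun t => - F t) = - cintg F.
Proof.
by move=> iF; rewrite -mulN1r -cintgZ //; congr cintg; apply/funext => t;
  rewrite mulN1r.
Qed.

Lemma cintgB F G : cintegrable F -> cintegrable G ->
  cintg (fun t => F t - G t) = cintg F - cintg G.
Proof. by move=> iF iG; rewrite cintgD ?cintgN //; exact: cintegrableN. Qed.

Lemma cintg_conj F : cintegrable F -> cintg (fun t => conjc (F t)) = conjc (cintg F).
Proof.
move=> iF; apply: complex_eqP; rewrite /cintg !ReIm /=.
  by under [X in rint X]eq_fun do rewrite Re_conj.
under [X in rint X]eq_fun do rewrite Im_conj.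
rewrite -mulN1r -rintZ; last exact: cintegrable_Im.
by congr rint; apply/funext => t; rewrite mulN1r.
Qed.

Lemma cintegrable_sum (I : Type) (r : seq I) (P : pred I) (F : I -> R -> C) :
  (forall i, cintegrable (F i)) ->
  cintegrable (fun t => \sum_(i <- r | P i) F i t).
Proof.
move=> mF; elim: r => [|i r IH].
  under eq_fun do rewrite big_nil.
  by apply: (@cintegrable_bounded _ (absc 0)) => //; exact: cmeas_cst.
under eq_fun do rewrite big_cons.
by case: (P i) => //; apply: cintegrableD.
Qed.

Lemma cintegrable_cst (c : C) : cintegrable (fun=> c).
Proof. by apply: (@cintegrable_bounded _ (absc c)) => //; exact: cmeas_cst. Qed.

Lemma cintg_cst (c : C) : cintg (fun=> c) = c * (2 * pi)%:C.
Proof.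
by apply: complex_eqP; rewrite /cintg !ReIm /= !rint_cst mulr0 ?subr0 ?add0r.
Qed.

Lemma cintg_sum (I : Type) (r : seq I) (P : pred I) (F : I -> R -> C) :
  (forall i, cintegrable (F i)) ->
  cintg (fun t => \sum_(i <- r | P i) F i t) = \sum_(i <- r | P i) cintg (F i).
Proof.
move=> mF; elim: r => [|i r IH].
  under [X in cintg X]eq_fun do rewrite big_nil.
  by rewrite big_nil cintg_cst mul0r.
rewrite big_cons -IH; under [X in cintg X]eq_fun do rewrite big_cons.
by case: (P i) => //; rewrite cintgD //; exact: cintegrable_sum.
Qed.

(** Rotation argument: [|I|^2 = Re (conj I * I)] is the integral of [Re (conj I * F)], which is at
    most [|I| |F|] pointwise. *)
Lemma absc_cintg F : cintegrable F -> absc (cintg F) <= rint (fun t => absc (F t)).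
Proof.
move=> iF; set I := cintg F; have HI : I = cintg F by [].
clearbody I.
have [->|I0] := eqVneq I 0.
  by rewrite absc0; apply: rint_ge0 => t _; exact: absc_ge0.
have aI : 0 < absc I by rewrite absc_gt0.
rewrite -(ler_pM2l aI) -expr2.
have -> : absc I ^+ 2 = complex.Re (conjc I * I) by rewrite mulrC mul_conj.
rewrite {2}HI -cintgZ // /cintg /= -rintZ; last exact: iF.2.
apply: rint_le.
- by apply: cintegrable_Re; exact: cintegrableZ.
- by apply: rintegrableZ; exact: iF.2.
- move=> t _; apply: le_trans (ler_norm _) _.
  by rewrite (le_trans (Re_le_absc _)) // abscM absc_conj.
Qed.

Lemma cintg_eq_ae F G : cmeas F -> cmeas G ->
  {ae mu, forall t, period t -> F t = G t} -> cintg F = cintg G.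
Proof.
move=> [F1 F2] [G1 G2] FG; congr Complex; apply: rint_eq_ae => //;
  by apply: aeS FG => t H Dt; rewrite H.
Qed.

(** Stands in for the Cauchy-Schwarz inequality without square roots: the choice of [lam] is left to
    each use. Pointwise it comes from [0 <= lam^-1 (lam a - b)^2]. *)
Lemma rint_young F G (lam : R) : 0 < lam -> cmeas F -> cmeas G ->
  rintegrable (fun t => absc (F t) ^+ 2) ->
  rintegrable (fun t => absc (G t) ^+ 2) ->
  cintegrable (fun t => F t * G t) /\
  rint (fun t => absc (F t * G t)) <=
    lam * rint (fun t => absc (F t) ^+ 2) + lam^-1 * rint (fun t => absc (G t) ^+ 2).
Proof.
move=> l0 mF mG iF iG.
have iS := rintegrableD (rintegrableZ lam iF) (rintegrableZ lam^-1 iG).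
have le t : absc (F t * G t) <= lam * absc (F t) ^+ 2 + lam^-1 * absc (G t) ^+ 2.
  rewrite abscM; set a := absc _; set b := absc _.
  have a0 : 0 <= a := absc_ge0 _; have b0 : 0 <= b := absc_ge0 _.
  have : 0 <= lam^-1 * (lam * a - b) ^+ 2.
    by rewrite mulr_ge0 ?sqr_ge0 // invr_ge0 ltW.
  have -> : lam^-1 * (lam * a - b) ^+ 2 =
      lam * a ^+ 2 - 2 * (a * b) + lam^-1 * b ^+ 2 by field; rewrite gt_eqF.
  have : 0 <= a * b by rewrite mulr_ge0.
  lra.
have iFG : cintegrable (fun t => F t * G t).
  by apply: cintegrable_le iS => //; exact: cmeasM.
split=> //; rewrite -!rintZ // -rintD; [|exact: rintegrableZ..].
by apply: rint_le => //; exact: iFG.2.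
Qed.

End ComplexIntegrals.

(** * Fourier coefficients and orthogonality of the characters *)

Section FourierCoefficients.
Variable R : realType.
Local Notation C := R[i].
Local Notation mu := (@lebesgue_measure R).
Local Notation period := (@period R).
Implicit Types (F G : R -> C).

(** Takes a function of the angle instead of a function on the circle; for [F t = f (cis t)] it is
    convertible with [fourier f n]. *)
Definition fc F (n : int) : C := ((2 * pi)^-1)%:C * cintg (fun t => F t * cis t ^ (- n)).

Lemma absc_cisz t (n : int) : absc (cis t ^ n : C) = 1.
Proof. by rewrite cis_expz absc_cis. Qed.

Lemma cintegrable_cisz F (n : int) : cintegrable F ->
  cintegrable (fun t => F t * cis t ^ n).
Proof.
move=> iF; apply: (cintegrableMb (K := 1)) => //; first exact: cmeas_cisz.
by move=> t _; rewrite absc_cisz.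
Qed.

Lemma fcD F G n : cintegrable F -> cintegrable G ->
  fc (fun t => F t + G t) n = fc F n + fc G n.
Proof.
move=> iF iG; rewrite /fc -mulrDr -cintgD; [|exact: cintegrable_cisz..].
by congr (_ * cintg _); apply/funext => t; rewrite mulrDl.
Qed.

Lemma fcZ (c : C) F n : cintegrable F -> fc (fun t => c * F t) n = c * fc F n.
Proof.
move=> iF; rewrite /fc mulrCA -(cintgZ c); last exact: cintegrable_cisz.
by congr (_ * cintg _); apply/funext => t; rewrite mulrA.
Qed.

Lemma fcB F G n : cintegrable F -> cintegrable G ->
  fc (fun t => F t - G t) n = fc F n - fc G n.
Proof.
move=> iF iG; rewrite /fc -mulrBr -cintgB; [|exact: cintegrable_cisz..].
by congr (_ * cintg _); apply/funext => t; rewrite mulrBl.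
Qed.

Lemma fc_sum (I : Type) (r : seq I) (P : pred I) (F : I -> R -> C) n :
  (forall i, cintegrable (F i)) ->
  fc (fun t => \sum_(i <- r | P i) F i t) n = \sum_(i <- r | P i) fc (F i) n.
Proof.
move=> iF; rewrite /fc -mulr_sumr -cintg_sum.
  by congr (_ * cintg _); apply/funext => t; rewrite mulr_suml.
by move=> i; exact: cintegrable_cisz.
Qed.

Lemma fc_shift F (k n : int) : fc (fun t => F t * cis t ^ k) n = fc F (n - k).
Proof.
rewrite /fc; congr (_ * cintg _); apply/funext => t.
by rewrite -mulrA -expfzDr ?cis_neq0 // opprB.
Qed.

Lemma fc_conj F n : cintegrable F -> fc (fun t => conjc (F t)) n = conjc (fc F (- n)).
Proof.
move=> iF; rewrite /fc conjcM conj_real -cintg_conj; last exact: cintegrable_cisz.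
congr (_ * cintg _); apply/funext => t; rewrite conjcM opprK; congr (_ * _).
by rewrite !cis_expz -cisN mulrNz mulNr.
Qed.

Lemma fc_eq_ae F G n : cmeas F -> cmeas G ->
  {ae mu, forall t, period t -> F t = G t} -> fc F n = fc G n.
Proof.
move=> mF mG FG; rewrite /fc; congr (_ * _); apply: cintg_eq_ae.
- by apply: cmeasM => //; exact: cmeas_cisz.
- by apply: cmeasM => //; exact: cmeas_cisz.
- by apply: aeS FG => t H Dt; rewrite H.
Qed.

Lemma absc_fc F n : cintegrable F ->
  absc (fc F n) <= (2 * pi)^-1 * rint (fun t => absc (F t)).
Proof.
move=> iF; have p0 : 0 <= (2 * pi)^-1 :> R by rewrite invr_ge0 ltW // twopi_gt0.
rewrite abscM absc_real ger0_norm //.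
rewrite ler_pM2l ?invr_gt0 ?twopi_gt0 //.
apply: le_trans (absc_cintg (cintegrable_cisz (- n) iF)) _.
rewrite le_eqVlt; apply/orP; left; apply/eqP; congr rint.
by apply/funext => t; rewrite abscM absc_cisz mulr1.
Qed.

Lemma rint_deriv (f F : R -> R) : continuous f ->
  (forall x : R, is_derive x 1 F (f x)) -> rint f = F (2 * pi) - F 0.
Proof.
move=> cf dF; rewrite /rint /Rintegral (@continuous_FTC2 _ f F) //.
- exact: twopi_gt0.
- exact: continuous_subspaceT.
- split.
  + by move=> x _; exact: ex_derive.
  + apply: cvg_at_right_filter; apply: differentiable_continuous.
    by apply/derivable1_diffP; exact: ex_derive.
  + apply: cvg_at_left_filter; apply: differentiable_continuous.
    by apply/derivable1_diffP; exact: ex_derive.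
- by move=> x _; rewrite derive1E; exact: derive_val.
Qed.

Lemma cintg_cisz (n : int) : n != 0 -> cintg (fun t => cis t ^ n : C) = 0.
Proof.
move=> n0; have n0' : n%:~R != 0 :> R by rewrite intr_eq0.
have cisn : cis (n%:~R * (2 * pi)) = 1 :> C by rewrite -cis_expz cis2pi exp1rz.
have [cn sn] : cos (n%:~R * (2 * pi)) = 1 :> R /\ sin (n%:~R * (2 * pi)) = 0 :> R.
  by case: cisn.
have dl (x : R) : is_derive x 1 (fun y : R => n%:~R * y) n%:~R.
  have := is_deriveZ (n%:~R : R) (is_derive_id x 1).
  by move=> /is_derive_eq; apply; rewrite /GRing.scale /= mulr1.
have ml : continuous (fun y : R => n%:~R * y).
  move=> x; apply: differentiable_continuous; apply/derivable1_diffP.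
  by case: (dl x).
have dF (x : R) : is_derive x 1 (fun y : R => n%:~R^-1 * sin (n%:~R * y)) (cos (n%:~R * x)).
  have := is_deriveZ (n%:~R^-1 : R) (is_derive1_comp (is_derive_sin _) (dl x)).
  move=> /is_derive_eq; apply.
  by rewrite /GRing.scale /= mulrCA mulVf // mulr1.
have dG (x : R) : is_derive x 1 (fun y : R => - n%:~R^-1 * cos (n%:~R * y)) (sin (n%:~R * x)).
  have := is_deriveZ (- n%:~R^-1 : R) (is_derive1_comp (is_derive_cos _) (dl x)).
  move=> /is_derive_eq; apply.
  by rewrite /GRing.scale /= mulrCA [X in _ * X]mulNr mulVf // mulrN1 opprK.
have cc : continuous (fun y : R => cos (n%:~R * y)).
  by move=> x; apply: continuous_comp; [exact: ml | exact: continuous_cos].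
have cs : continuous (fun y : R => sin (n%:~R * y)).
  by move=> x; apply: continuous_comp; [exact: ml | exact: continuous_sin].
rewrite /cintg; apply: complex_eqP => /=.
  under [X in rint X]eq_fun do rewrite cis_expz /=.
  by rewrite (rint_deriv cc dF) sn mulr0 mulr0 sin0 mulr0 subrr.
under [X in rint X]eq_fun do rewrite cis_expz /=.
by rewrite (rint_deriv cs dG) cn mulr0 cos0 subrr.
Qed.

Lemma fc_cisz (k n : int) : fc (fun t => cis t ^ k) n = (k == n)%:R.
Proof.
have -> : (fun t => cis t ^ k : C) = (fun t => 1 * cis t ^ k).
  by apply/funext => t; rewrite mul1r.
rewrite fc_shift /fc opprB; have [->|kn] := eqVneq k n.
  have -> : (fun t : R => 1 * cis t ^ (n - n)) = (fun=> 1).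
    by apply/funext => t; rewrite subrr mulr1.
  by rewrite cintg_cst mul1r -rmorphM mulVf ?gt_eqF ?twopi_gt0.
under [X in cintg X]eq_fun do rewrite mul1r.
by rewrite cintg_cisz ?mulr0 // subr_eq0.
Qed.

End FourierCoefficients.

(** * Cauchy products of formal power series *)

Section Convolution.
Variable K : fieldType.
Implicit Types f g h : nat -> K.

Definition cauchy f g (n : nat) : K := \sum_(k < n.+1) f k * g (n - k)%N.

(** Coefficient [n] of a Cauchy product sees only degrees up to [n], so commutativity and
    associativity can be read off from truncations in [{poly K}]. *)
Let tr (N : nat) f : {poly K} := \poly_(i < N.+1) f i.

Let coef_tr N f i : (i <= N)%N -> (tr N f)`_i = f i.
Proof. by move=> iN; rewrite coef_poly ltnS iN. Qed.

Let coef_trM N f g n : (n <= N)%N -> (tr N f * tr N g)`_n = cauchy f g n.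
Proof.
move=> nN; rewrite coefM; apply: eq_bigr => k _.
have kn : (k <= n)%N by rewrite -ltnS ltn_ord.
by rewrite !coef_tr // ?(leq_trans kn) // (leq_trans (leq_subr _ _)).
Qed.

Lemma cauchyC f g n : cauchy f g n = cauchy g f n.
Proof. by rewrite -(@coef_trM n) // mulrC coef_trM. Qed.

Lemma cauchyA f g h n : cauchy (cauchy f g) h n = cauchy f (cauchy g h) n.
Proof.
have <- : (tr n f * tr n g * tr n h)`_n = cauchy (cauchy f g) h n.
  rewrite coefM; apply: eq_bigr => k _.
  have kn : (k <= n)%N by rewrite -ltnS ltn_ord.
  by rewrite coef_trM // coef_tr // leq_subr.
rewrite -mulrA coefM; apply: eq_bigr => k _.
have kn : (k <= n)%N by rewrite -ltnS ltn_ord.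
by rewrite coef_tr // coef_trM // leq_subr.
Qed.

Lemma eq_cauchy f f' g g' n : (forall k, (k <= n)%N -> f k = f' k) ->
  (forall k, (k <= n)%N -> g k = g' k) -> cauchy f g n = cauchy f' g' n.
Proof.
move=> ff gg; apply: eq_bigr => k _.
by rewrite ff ?gg ?leq_subr // -ltnS ltn_ord.
Qed.

Lemma cauchy_inj f g h : h 0%N != 0 -> (forall n, cauchy f h n = cauchy g h n) ->
  forall n, f n = g n.
Proof.
move=> h0 E; elim/ltn_ind => n IH.
have := E n; rewrite /cauchy !big_ord_recr /= subnn => /eqP.
rewrite (eq_bigr (fun k : 'I_n => g k * h (n - k)%N)); last by move=> k _; rewrite IH.
by rewrite (inj_eq (addrI _)) => /eqP/(mulIf h0).
Qed.

(** As series, [b h = a l = psi a h], and [h] can be cancelled. The conclusion is a product rather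
    than a quotient, so that nothing is asked of [a]. *)
Lemma cauchy_quotient (a b psi h l : nat -> K) : h 0%N != 0 ->
  (forall n, cauchy b h n = cauchy a l n) -> (forall n, l n = cauchy psi h n) ->
  forall n, b n = cauchy psi a n.
Proof.
move=> h0 bh lh; apply: (@cauchy_inj _ _ h) => // n; rewrite bh.
have -> : cauchy a l n = cauchy a (cauchy psi h) n by apply: eq_cauchy => // k _.
rewrite -cauchyA; apply: eq_cauchy => // k _; exact: cauchyC.
Qed.

End Convolution.

(** * Square integrable functions and L2 limits of polynomials *)

Section SquareIntegrable.
Variable R : realType.
Local Notation C := R[i].
Local Notation mu := (@lebesgue_measure R).
Local Notation period := (@period R).
Implicit Types (F G : R -> C) (p q : {poly C}).

(** Only an upper bound is required. On nonnegative sequences this is convergence to 0; comparison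
    then needs no lower bound, and a constant sequence satisfies it only if the constant is at most
    0. *)
Definition tends0 (u : nat -> R) : Prop :=
  forall e : R, 0 < e -> exists M, forall m, (M <= m)%N -> u m <= e.

Lemma cvg_tends0 (u : nat -> R) : u @ \oo --> (0 : R) -> tends0 u.
Proof.
move=> /cvgrPdist_le u0 e e0; have [M _ HM] := u0 e e0; exists M => m Mm.
by have := HM m Mm; rewrite /= sub0r normrN; apply: le_trans; exact: ler_norm.
Qed.

Lemma tends0_cvg (u : nat -> R) : (forall m, 0 <= u m) -> tends0 u ->
  u @ \oo --> (0 : R).
Proof.
move=> u0 tu; apply/cvgrPdist_le => e e0; have [M HM] := tu e e0.
by exists M => // m /= Mm; rewrite sub0r normrN ger0_norm // HM.
Qed.

Lemma tends0_le (u v : nat -> R) : (forall m, u m <= v m) -> tends0 v -> tends0 u.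
Proof.
move=> uv tv e e0; have [M HM] := tv e e0; exists M => m Mm.
exact: le_trans (uv m) (HM m Mm).
Qed.

Lemma tends0D (u v : nat -> R) : tends0 u -> tends0 v -> tends0 (fun m => u m + v m).
Proof.
move=> tu tv e e0; have e2 : 0 < e / 2 by rewrite divr_gt0.
have [M HM] := tu _ e2; have [N HN] := tv _ e2; exists (maxn M N) => m.
by rewrite geq_max => /andP[Mm Nm]; rewrite [e]splitr lerD ?HM ?HN.
Qed.

Lemma tends0Z (c : R) (u : nat -> R) : 0 <= c -> tends0 u -> tends0 (fun m => c * u m).
Proof.
move=> c0 tu e e0; have c1 : 0 < c + 1 by rewrite ltr_wpDl.
have [M HM] := tu _ (divr_gt0 e0 c1); exists M => m Mm.
have um := HM m Mm; have [um0|um0] := leP 0 (u m).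
  rewrite (@le_trans _ _ ((c + 1) * u m)) ?ler_wpM2r ?lerDl //.
  by rewrite mulrC -ler_pdivlMr.
by rewrite (le_trans _ (ltW e0)) // mulr_ge0_le0 // ltW.
Qed.

Lemma tends0_sum (I : Type) (r : seq I) (F : I -> nat -> R) :
  (forall i, tends0 (F i)) -> tends0 (fun m => \sum_(i <- r) F i m).
Proof.
move=> tF; elim: r => [|i r IH].
  by move=> e e0; exists 0%N => m _; rewrite big_nil ltW.
by under eq_fun do rewrite big_cons; exact: tends0D.
Qed.

Lemma tends0_ge0 (c : R) : tends0 (fun=> c) -> c <= 0.
Proof.
move=> tc; rewrite leNgt; apply/negP => c0.
have [M /(_ M (leqnn M))] := tc (c / 2) (divr_gt0 c0 (ltr0n R 2)).
by apply/negP; rewrite -ltNge ltr_pdivrMr // ltr_pMr // ltr1n.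
Qed.

Lemma tends0_shift (u : nat -> R) k : tends0 u -> tends0 (fun m => u (m + k)%N).
Proof.
move=> tu e e0; have [M HM] := tu e e0; exists M => m Mm.
by apply: HM; apply: leq_trans Mm (leq_addr _ _).
Qed.

Lemma absc_lim_unique (c d : C) (u : nat -> C) :
  tends0 (fun m => absc (u m - c)) -> tends0 (fun m => absc (u m - d)) -> c = d.
Proof.
move=> uc ud; apply/eqP; rewrite -subr_eq0 -absc_eq0 eq_le absc_ge0 andbT.
apply: tends0_ge0; apply: tends0_le (tends0D uc ud) => m.
have -> : c - d = (u m - d) - (u m - c) by ring.
by rewrite [leRHS]addrC; exact: abscB.
Qed.

Definition L2 F := cmeas F /\ rintegrable (fun t => absc (F t) ^+ 2).
Definition N2 F : R := rint (fun t => absc (F t) ^+ 2).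

Lemma N2_ge0 F : 0 <= N2 F.
Proof. by apply: rint_ge0 => t _; exact: sqr_ge0. Qed.

Lemma L2_cst (c : C) : L2 (fun=> c).
Proof. by split; [exact: cmeas_cst | exact: rintegrable_cst]. Qed.

Lemma L2_le F G (K : R) : cmeas F -> L2 G ->
  {ae mu, forall t, period t -> absc (F t) <= K * absc (G t)} -> L2 F.
Proof.
move=> mF [mG iG] FG; split => //.
apply: rintegrable_le_ae (rintegrableZ (K ^+ 2) iG); first exact: rmeas_sqr_absc.
apply: aeS FG => t H Dt; rewrite ger0_norm ?sqr_ge0 // -exprMn.
by rewrite lerXn2r ?nnegrE ?absc_ge0 ?H // (le_trans (absc_ge0 (F t))) ?H.
Qed.

Lemma L2_bounded F (K : R) : cmeas F ->
  {ae mu, forall t, period t -> absc (F t) <= K} -> L2 F.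
Proof.
move=> mF FK; apply: (@L2_le F (fun=> 1) K) => //; first exact: L2_cst.
by apply: aeS FK => t H Dt; rewrite absc1 mulr1 H.
Qed.

Lemma L2Mb F G (K : R) : L2 F -> cmeas G ->
  {ae mu, forall t, period t -> absc (G t) <= K} -> L2 (fun t => F t * G t).
Proof.
move=> LF mG GK; apply: (@L2_le _ F K) => //; first by apply: cmeasM => //; case: LF.
by apply: aeS GK => t H Dt; rewrite abscM mulrC ler_wpM2r ?absc_ge0 // H.
Qed.

Lemma L2D F G : L2 F -> L2 G -> L2 (fun t => F t + G t).
Proof.
move=> [mF iF] [mG iG]; split; first exact: cmeasD.
apply: rintegrable_le (rintegrableD (rintegrableZ 2 iF) (rintegrableZ 2 iG)).
  by apply: rmeas_sqr_absc; exact: cmeasD.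
move=> t _; rewrite ger0_norm ?sqr_ge0 //.
have := abscD (F t) (G t); set a := absc _; set b := absc (F t); set c := absc (G t).
move=> abc; have a0 : 0 <= a := absc_ge0 _.
have : a ^+ 2 <= (b + c) ^+ 2 by rewrite lerXn2r // nnegrE ?(le_trans a0).
by have := sqr_ge0 (b - c); nra.
Qed.

Lemma L2N F : L2 F -> L2 (fun t => - F t).
Proof.
by move=> [mF iF]; split; [exact: cmeasN | under eq_fun do rewrite abscN].
Qed.

Lemma L2B F G : L2 F -> L2 G -> L2 (fun t => F t - G t).
Proof. by move=> LF LG; apply: L2D => //; apply: L2N. Qed.

Lemma L2_conj F : L2 F -> L2 (fun t => conjc (F t)).
Proof.
by move=> [mF iF]; split; [exact: cmeas_conj | under eq_fun do rewrite absc_conj].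
Qed.

Lemma L2_young F G (lam : R) : 0 < lam -> L2 F -> L2 G ->
  cintegrable (fun t => F t * G t) /\
  rint (fun t => absc (F t * G t)) <= lam * N2 F + lam^-1 * N2 G.
Proof. by move=> l0 [mF iF] [mG iG]; exact: rint_young. Qed.

Lemma L2M_cintegrable F G : L2 F -> L2 G -> cintegrable (fun t => F t * G t).
Proof. by move=> LF LG; case: (L2_young (@ltr01 R) LF LG). Qed.

Lemma L2_cintegrable F : L2 F -> cintegrable F.
Proof.
move=> LF; have := L2M_cintegrable LF (L2_cst 1).
by under eq_fun do rewrite mulr1.
Qed.

(** The use made of Young's inequality: a bounded factor times a vanishing one vanishes. First [lam]
    is fixed so that [lam * a <= e / 2], then [m] is taken so large that [v m <= lam * e / 2]. *)
Lemma young_tends0 (a : R) (u v : nat -> R) : 0 <= a -> (forall m, 0 <= v m) ->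
  (forall lam m, 0 < lam -> u m <= lam * a + lam^-1 * v m) -> tends0 v -> tends0 u.
Proof.
move=> a0 v0 uv tv e e0; have a1 : 0 < a + 1 by rewrite ltr_wpDl.
pose lam := e / (2 * (a + 1)); have l0 : 0 < lam by rewrite divr_gt0 ?mulr_gt0.
have [M HM] := tv (lam * e / 2) (divr_gt0 (mulr_gt0 l0 e0) (ltr0n R 2)).
exists M => m Mm; apply: le_trans (uv lam m l0) _; rewrite [leRHS]splitr lerD //.
  rewrite /lam mulrAC ler_pdivrMr ?mulr_gt0 //; nra.
by rewrite mulrC ler_pdivrMr // mulrC mulrA HM.
Qed.

Lemma N1_lim F (G : nat -> R -> C) : L2 F -> (forall m, L2 (G m)) ->
  tends0 (fun m => N2 (G m)) -> tends0 (fun m => rint (fun t => absc (F t * G m t))).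
Proof.
move=> LF LG; apply: young_tends0; [exact: N2_ge0 | by move=> m; exact: N2_ge0|].
by move=> lam m l0; have [_] := L2_young l0 LF (LG m).
Qed.

Lemma fc_lim F (G : nat -> R -> C) G0 n : L2 F -> (forall m, L2 (G m)) -> L2 G0 ->
  tends0 (fun m => N2 (fun t => G m t - G0 t)) ->
  tends0 (fun m => absc (fc (fun t => F t * G m t) n - fc (fun t => F t * G0 t) n)).
Proof.
move=> LF LG LG0 tG; have LD m : L2 (fun t => G m t - G0 t) by exact: L2B.
have p0 : 0 <= (2 * pi)^-1 :> R by rewrite invr_ge0 ltW // twopi_gt0.
apply: tends0_le (tends0Z p0 (N1_lim LF LD tG)) => m.
rewrite -fcB; [|exact: L2M_cintegrable..].
under [X in fc X]eq_fun do rewrite -mulrBr.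
by apply: absc_fc; exact: L2M_cintegrable.
Qed.

Lemma absc_horner p z (r : R) : absc z <= r -> absc p.[z] <= \sum_(i < size p) absc p`_i * r ^+ i.
Proof.
move=> zr; rewrite horner_coef (le_trans (absc_sum _ _ _)) //.
apply: ler_sum => i _; rewrite abscM abscX ler_wpM2l ?absc_ge0 //.
by rewrite lerXn2r ?nnegrE ?absc_ge0 // (le_trans (absc_ge0 z)).
Qed.

Lemma cmeas_poly p : cmeas (fun t => p.[cis t]).
Proof.
under eq_fun do rewrite horner_coef.
apply: cmeas_sum => i; apply: cmeasM; first exact: cmeas_cst.
by apply: cmeasX; exact: cmeas_cis.
Qed.

Lemma poly_bounded p : exists K : R, forall t, absc p.[cis t] <= K.
Proof.
exists (\sum_(i < size p) absc p`_i * 1 ^+ i) => t.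
by apply: absc_horner; rewrite absc_cis.
Qed.

Lemma L2_poly p : L2 (fun t => p.[cis t]).
Proof.
have [K HK] := poly_bounded p.
by apply: (@L2_bounded _ K); [exact: cmeas_poly | apply: aeW => t _].
Qed.

Lemma fc_mul_poly F p n : cintegrable F ->
  fc (fun t => F t * p.[cis t]) n = \sum_(k < size p) p`_k * fc F (n - k%:Z).
Proof.
move=> iF; under [X in fc X]eq_fun do rewrite horner_coef mulr_sumr.
have iZ (k : 'I_(size p)) : cintegrable (fun t => F t * (p`_k * cis t ^+ k)).
  have := cintegrableZ p`_k (cintegrable_cisz k iF).
  by under eq_fun do rewrite mulrCA.
rewrite fc_sum //; apply: eq_bigr => k _.
rewrite -(fc_shift F) -fcZ; last exact: cintegrable_cisz.
by apply: (congr1 (fun G => fc G n)); apply/funext => t; exact: mulrCA.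
Qed.

Lemma fc_poly p (n : int) : fc (fun t => p.[cis t]) n = if n is Posz k then p`_k else 0.
Proof.
have -> : (fun t => p.[cis t]) = (fun t => 1 * p.[cis t]).
  by apply/funext => t; rewrite mul1r.
rewrite fc_mul_poly; last exact: cintegrable_cst.
have fc1 m : fc (fun=> 1 : C) m = (m == 0)%:R.
  have := @fc_cisz R 0 m; rewrite eq_sym => <-.
  by congr fc; apply/funext => t; rewrite expr0z.
case: n => [n|n]; last first.
  by rewrite big1 // => k _; rewrite fc1 (_ : _ == 0 = false) ?mulr0 //; lia.
have [nk|nk] := ltnP n (size p); last first.
  rewrite nth_default // big1 // => k _.
  by rewrite fc1 (_ : _ == 0 = false) ?mulr0 //; have := ltn_ord k; lia.
rewrite (bigD1 (Ordinal nk)) //= fc1 subrr eqxx mulr1 big1 ?addr0 // => k kn.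
rewrite fc1 subr_eq0 (_ : _ == _ = false) ?mulr0 //.
by apply: contraNF kn => /eqP[nk']; apply/eqP/val_inj.
Qed.

(** Parseval's identity, read off from the coefficient of index 0 of [conj p * p]. *)
Lemma N2_poly p : N2 (fun t => p.[cis t]) = 2 * pi * \sum_(k < size p) absc p`_k ^+ 2.
Proof.
have LP := L2_poly p; have LPc := L2_conj LP.
have iP := L2M_cintegrable LPc LP.
have -> : N2 (fun t => p.[cis t]) =
    complex.Re (cintg (fun t => conjc p.[cis t] * p.[cis t])).
  by congr rint; apply/funext => t; rewrite mulrC mul_conj.
have E : fc (fun t => conjc p.[cis t] * p.[cis t]) 0 =
    (\sum_(k < size p) absc p`_k ^+ 2)%:C.
  rewrite fc_mul_poly; last exact: L2_cintegrable.
  rewrite rmorph_sum; apply: eq_bigr => k _.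
  rewrite fc_conj; last exact: L2_cintegrable.
  by rewrite opprB subr0 fc_poly mul_conj.
have -> : cintg (fun t => conjc p.[cis t] * p.[cis t]) =
   (2 * pi)%:C * fc (fun t => conjc p.[cis t] * p.[cis t]) 0.
  rewrite /fc mulrA -rmorphM divff ?gt_eqF ?twopi_gt0 // mul1r.
  by congr cintg; apply/funext => t; rewrite oppr0 expr0z mulr1.
by rewrite E -rmorphM.
Qed.

(** [Negz n] is [-(n + 1)], so exactly the negative frequencies are meant; for square integrable
    functions this is membership in the Hardy space of the circle. *)
Definition causal F := forall n : nat, fc F (Negz n) = 0.

Lemma fc_mul_poly_causal F p (n : nat) : cintegrable F -> causal F ->
  fc (fun t => F t * p.[cis t]) n = cauchy (fun k => p`_k) (fun k : nat => fc F k) n.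
Proof.
move=> iF cF; rewrite fc_mul_poly // /cauchy.
(* Both sums are extended to a common range. The extra terms vanish: for [k > n] by causality of
   [F], for [k >= size p] because the coefficient of [p] is 0. *)
rewrite (big_ord_widen (maxn n.+1 (size p)) (fun k : nat => p`_k * fc F (n%:Z - k%:Z))) ?leq_maxr //.
rewrite [RHS](big_ord_widen (maxn n.+1 (size p)) (fun k : nat => p`_k * fc F ((n - k)%N%:Z))) ?leq_maxl //.
rewrite [LHS]big_mkcond [RHS]big_mkcond /=; apply: eq_bigr => k _.
case: ltnP => kp; case: ltnP => kn //.
- by rewrite subzn.
- have -> : n%:Z - k%:Z = Negz (k - n.+1) by lia.
  by rewrite cF mulr0.
- by rewrite nth_default // mul0r.
Qed.

Lemma causal_mul_poly F p : cintegrable F -> causal F -> causal (fun t => F t * p.[cis t]).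
Proof.
move=> iF cF n; rewrite fc_mul_poly // big1 // => k _.
have -> : Negz n - k%:Z = Negz (n + k) by lia.
by rewrite cF mulr0.
Qed.

Definition poly_limit G (p : nat -> {poly C}) :=
  L2 G /\ tends0 (fun m => N2 (fun t => (p m).[cis t] - G t)).

Lemma poly_limit_fc G (p : nat -> {poly C}) n : poly_limit G p ->
  tends0 (fun m => absc (fc (fun t => (p m).[cis t]) n - fc G n)).
Proof.
move=> [LG tG]; have := fc_lim n (L2_cst 1) (fun m => L2_poly (p m)) LG tG.
apply: tends0_le => m; under [X in _ <= absc (fc X n - _)]eq_fun do rewrite mul1r.
by under [X in _ <= absc (_ - fc X n)]eq_fun do rewrite mul1r.
Qed.

Lemma poly_limit_coef G (p : nat -> {poly C}) (n : nat) : poly_limit G p ->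
  tends0 (fun m => absc ((p m)`_n - fc G n)).
Proof.
by move=> /(@poly_limit_fc _ _ n); apply: tends0_le => m; rewrite fc_poly.
Qed.

(** For fixed [F] each Fourier coefficient of [F G] depends continuously on [G] in L2, so the
    product formula passes from polynomials to their limits. *)
Lemma poly_limit_mul F G (p : nat -> {poly C}) : L2 F -> causal F -> poly_limit G p ->
  causal (fun t => F t * G t) /\
  forall n : nat, fc (fun t => F t * G t) n =
    cauchy (fun k : nat => fc G k) (fun k : nat => fc F k) n.
Proof.
move=> LF cF lG; have iF := L2_cintegrable LF.
have H n := fc_lim n LF (fun m => L2_poly (p m)) lG.1 lG.2.
split=> n.
  apply: (@absc_lim_unique _ _ (fun=> 0)).
    by apply: tends0_le (H (Negz n)) => m; rewrite causal_mul_poly.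
  by move=> e e0; exists 0%N => m _; rewrite subrr absc0 ltW.
apply: (absc_lim_unique (u := fun m => fc (fun t => F t * (p m).[cis t]) n)).
  exact: H.
have T (k : 'I_n.+1) := tends0Z (absc_ge0 (fc F (n - k)%N)) (poly_limit_coef k lG).
have : tends0 (fun m => \sum_(k < n.+1) absc (fc F (n - k)%N) * absc ((p m)`_k - fc G k)).
  by apply: tends0_sum => k; exact: T.
apply: tends0_le => m; rewrite fc_mul_poly_causal // /cauchy -sumrB.
rewrite (le_trans (absc_sum _ _ _)) //; apply: ler_sum => k _.
by rewrite -mulrBl abscM mulrC.
Qed.

End SquareIntegrable.

(** * Vanishing Fourier coefficients force vanishing integrals over arcs *)

Section Uniqueness.
Variable R : realType.
Local Notation C := R[i].
Local Notation mu := (@lebesgue_measure R).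
Local Notation period := (@period R).
Implicit Types (F G : R -> C).

Lemma ae_neq (a : R) : {ae mu, forall t, t != a}.
Proof.
exists [set a]; split; first exact: measurable_set1.
  exact: lebesgue_measure_set1.
by move=> t /= /negP; rewrite negbK => /eqP.
Qed.

Lemma bernoulli_ge (y : R) m : 0 <= y <= 1 -> 1 - m%:R * y <= (1 - y) ^+ m.
Proof.
move=> /andP[y0 y1]; elim: m => [|m IH]; first by rewrite mul0r subr0 expr0.
rewrite exprS; apply: (@le_trans _ _ ((1 - y) * (1 - m%:R * y))); last first.
  by rewrite ler_wpM2l // subr_ge0.
rewrite -natr1; have : 0 <= m%:R * y ^+ 2 :> R by rewrite mulr_ge0 // sqr_ge0.
by set k := m%:R; nra.
Qed.

Lemma bernoulli_le (y : R) m : 0 <= y <= 1 -> (1 - y) ^+ m * (1 + m%:R * y) <= 1.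
Proof.
move=> /andP[y0 y1]; elim: m => [|m IH]; first by rewrite mul0r addr0 expr0 mulr1.
apply: le_trans IH; rewrite exprSr -mulrA ler_wpM2l ?exprn_ge0 ?subr_ge0 //.
rewrite -natr1; have : 0 <= (m%:R + 1) * y ^+ 2 :> R by rewrite mulr_ge0 ?sqr_ge0 // addr_ge0.
by set k := m%:R; nra.
Qed.

(** The functions of the elementary proof of the Stone-Weierstrass theorem. By the two Bernoulli
    inequalities the limit is 1 or 0 according to whether [(2 x)^n] tends to 0 or to infinity,
    whence the jump at [1/2]. *)
Definition step (x : R) n : R := (1 - x ^+ n) ^+ (2 ^ n).

Lemma step01 (x : R) n : 0 <= x <= 1 -> 0 <= step x n <= 1.
Proof.
move=> /andP[x0 x1]; have a0 : 0 <= 1 - x ^+ n by rewrite subr_ge0; apply: exprn_ile1.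
have a1 : 1 - x ^+ n <= 1 by rewrite lerBlDr lerDl exprn_ge0.
by apply/andP; split; [exact: exprn_ge0 | exact: exprn_ile1].
Qed.

Lemma step_lt (x : R) : 0 <= x -> x < 2^-1 -> tends0 (fun n => 1 - step x n).
Proof.
move=> x0 x1; have xle1 : x <= 1 by lra.
apply: (@tends0_le _ _ (fun n => (2 * x) ^+ n)).
  move=> n; rewrite lerBlDr -lerBlDl exprMn.
  have : 0 <= x ^+ n <= 1 by apply/andP; split; [exact: exprn_ge0 | exact: exprn_ile1].
  by move=> /(bernoulli_ge (2 ^ n)); rewrite natrX.
by apply: cvg_tends0; apply: cvg_expr; rewrite ger0_norm; lra.
Qed.

Lemma step_gt (x : R) : 2^-1 < x -> x <= 1 -> tends0 (step x).
Proof.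
move=> x0 x1; have xgt0 : 0 < x by lra.
apply: (@tends0_le _ _ (fun n => (2 * x)^-1 ^+ n)); last first.
  apply: cvg_tends0; apply: cvg_expr.
  rewrite ger0_norm; first by rewrite invf_lt1; lra.
  by rewrite invr_ge0; lra.
move=> n; have y01 : 0 <= x ^+ n <= 1 by apply/andP; split; [apply: exprn_ge0 | apply: exprn_ile1] => //; exact: ltW.
have p2 : 0 < (2 * x) ^+ n by rewrite exprn_gt0 // mulr_gt0.
have /andP[s0 _] : 0 <= step x n <= 1 by apply: step01; rewrite ltW.
rewrite exprVn -[leRHS]mul1r ler_pdivlMr //.
apply: le_trans (bernoulli_le (2 ^ n) y01); rewrite -/(step x n) ler_wpM2l //.
by rewrite natrX -exprMn lerDr.
Qed.

(* [arc h t < 1/2] exactly when [t] lies on the arc [0 < t < 2 h]; hence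
   [step (arc h t)] tends to the indicator function of that arc through
   trigonometric polynomials. *)
Definition arc (h t : R) : R := 2^-1 + (cos h - cos (t - h)) / 4.

Lemma arc01 h t : 0 <= arc h t <= 1.
Proof.
have := cos_le1 h; have := cos_geN1 h; have := cos_le1 (t - h).
by have := cos_geN1 (t - h); rewrite /arc; lra.
Qed.

Lemma arc_lt h t : 0 < h <= pi -> 0 < t -> t < 2 * h -> arc h t < 2^-1.
Proof.
move=> /andP[h0 hp] t0 th; suff : cos h < cos (t - h) by rewrite /arc; lra.
wlog: t t0 th / 0 <= t - h => [H|tn].
  have [/H->//|tn] := leP 0 (t - h).
  have := H (2 * h - t); rewrite -(cosN (2 * h - t - h)).
  have -> : - (2 * h - t - h) = t - h by ring.
  by apply; lra.
by rewrite ltr_cos ?in_itv /=; lra.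
Qed.

Lemma arc_gt h t : 0 < h <= pi -> 2 * h < t -> t < 2 * pi -> 2^-1 < arc h t.
Proof.
move=> /andP[h0 hp] th t2; suff : cos (t - h) < cos h by rewrite /arc; lra.
have [tp|tp] := leP (t - h) pi.
  by rewrite ltr_cos ?in_itv /=; lra.
have -> : cos (t - h) = cos (2 * pi - (t - h)).
  rewrite -(cosN (t - h)); have := @cosDpi R (- (t - h)).
  move=> E; have -> : 2 * pi - (t - h) = - (t - h) + pi + pi by ring.
  by rewrite cosDpi E opprK.
by rewrite ltr_cos ?in_itv /=; lra.
Qed.

Lemma cintg_laurent0 F : cintegrable F -> (forall n, fc F n = 0) ->
  forall (p : {poly C}) (m : int), cintg (fun t => F t * (p.[cis t] * cis t ^ m)) = 0.
Proof.
move=> iF F0 p m; have p0 : ((2 * pi)^-1)%:C != 0 :> C.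
  by apply/eqP => /complexI /eqP; rewrite invr_eq0 gt_eqF // twopi_gt0.
apply: (mulfI p0); rewrite mulr0.
have <- : fc (fun t => F t * p.[cis t]) (- m) = 0.
  by rewrite fc_mul_poly // big1 // => k _; rewrite F0 mulr0.
by rewrite /fc opprK; congr (_ * cintg _); apply/funext => t; rewrite mulrA.
Qed.

Lemma arc_laurent h : exists q : {poly C},
  forall t, (arc h t)%:C = q.[cis t] * cis t ^ (-1).
Proof.
pose w : C := cis h.
(* With [z = cis t], [cos (t - h) = (z / w + w / z) / 2]. Its weight [1/4] in [arc] gives the [1/8],
   and multiplication by [z] clears the pole. *)
exists ((2^-1 + cos h / 4)%:C *: 'X - (8^-1)%:C *: (w^-1 *: 'X^2 + w%:P)) => t.
rewrite !hornerE /=.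
have zE : cis t ^ (-1) = conjc (cis t) :> C by rewrite conj_cis.
have zz : cis t * conjc (cis t) = 1 :> C by rewrite conj_cis divff // cis_neq0.
have E : (cos (t - h))%:C = 2^-1%:C * (cis t * conjc w + conjc (cis t) * w) :> C.
  rewrite cosB; apply: complex_eqP; rewrite !ReIm /=; by field.
have -> : w^-1 = conjc w by rewrite conj_cis.
rewrite zE /arc.
have -> : (2^-1 + (cos h - cos (t - h)) / 4)%:C =
  (2^-1 + cos h / 4)%:C - 4^-1%:C * (cos (t - h))%:C :> C.
  rewrite -rmorphM -rmorphB; congr (_%:C); ring.
have e8 : 4^-1%:C * 2^-1%:C = 8^-1%:C :> C.
  by rewrite -rmorphM; congr (_%:C); field.
rewrite E mulrA e8 -[X in X - _]mulr1 -zz.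
move: ((2^-1 + cos h / 4)%:C) (8^-1%:C) => A B.
transitivity (A * (cis t * conjc (cis t)) -
   B * (cis t * conjc (cis t) * cis t * conjc w + conjc (cis t) * w)).
  by rewrite zz mul1r.
by ring.
Qed.

Lemma step_laurent h n : exists (p : {poly C}) (m : int),
  forall t, (step (arc h t) n)%:C = p.[cis t] * cis t ^ m.
Proof.
have [q Hq] := arc_laurent h.
exists (('X^n - q ^+ n) ^+ (2 ^ n)), (- (n * 2 ^ n)%:Z) => t.
rewrite /step rmorphXn rmorphB rmorphXn rmorph1 /= Hq.
rewrite horner_exp hornerD hornerN !horner_exp hornerX. rewrite [(_ * _) ^+ n]exprMn.
have z0 := @cis_neq0 R t.
have -> : (cis t ^ (-1)) ^+ n = (cis t ^+ n)^-1 :> C by rewrite -exprVn.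
have -> : cis t ^ (- (n * 2 ^ n)%:Z) = ((cis t ^+ n)^-1) ^+ (2 ^ n) :> C.
  by rewrite exprVn -exprM -exprnN.
rewrite -exprMn; congr (_ ^+ _); rewrite mulrBl divff //.
by rewrite expf_neq0.
Qed.

Lemma rint_arc0 F b : cintegrable F -> (forall n, fc F n = 0) -> 0 < b <= 2 * pi ->
  rint (fun t => complex.Re (F t) * \1_(`[0, b]) t) = 0 /\
  rint (fun t => complex.Im (F t) * \1_(`[0, b]) t) = 0.
Proof.
move=> iF F0 /andP[b0 b2]; pose h := b / 2.
have hb : 0 < h <= pi by rewrite /h; apply/andP; split; lra.
have hE : b = 2 * h by rewrite /h; field.
pose phi n t := step (arc h t) n.
have phi01 n t : 0 <= phi n t <= 1 by apply: step01; exact: arc01.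
have marc : rmeas (arc h).
  apply: rmeas_continuous => t; apply: cvgD; first exact: cvg_cst.
  apply: cvgMl; apply: cvgB; first exact: cvg_cst.
  apply: continuous_comp; last exact: continuous_cos.
  by apply: cvgB; [exact: cvg_id | exact: cvg_cst].
have mphi n : rmeas (phi n).
  rewrite /phi /step; have mX k f : rmeas f -> rmeas (fun t : R => f t ^+ k).
    move=> mf; elim: k => [|k IH].
      by under eq_fun do rewrite expr0; exact: rmeas_cst.
    by under eq_fun do rewrite exprS; exact: rmeasM.
  by apply: (mX); apply: rmeasB; [exact: rmeas_cst | exact: mX].
pose ind : R -> R := \1_(`[0, b]).
have mind : rmeas ind.
  exact: measurable_indic (measurable_itv _).
have ind01 t : 0 <= ind t <= 1.
  by rewrite /ind indicE; case: (_ \in _) => /=; rewrite ?lexx ?ler01.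
have main (f : R -> R) : rintegrable f -> (forall n, rint (fun t => f t * phi n t) = 0) ->
    rint (fun t => f t * ind t) = 0.
  move=> If Hf; have mf := rintegrable_meas If.
  have bd n t : `|f t * (phi n t - ind t)| <= `|f t|.
    rewrite normrM ler_piMr // ler_norml.
    by have := phi01 n t; have := ind01 t; lra.
  have I1 n : rintegrable (fun t => f t * phi n t).
    apply: rintegrable_le (integrable_norm If); first exact: rmeasM.
    move=> t _; rewrite normrM ler_piMr // ler_norml.
    by have := phi01 n t; lra.
  have I2 : rintegrable (fun t => f t * ind t).
    apply: rintegrable_le (integrable_norm If); first exact: rmeasM.
    move=> t _; rewrite normrM ler_piMr // ler_norml.
    by have := ind01 t; lra.
  have := @rint_dct _ (fun n t => f t * (phi n t - ind t)) (fun t => `|f t|).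
  have -> : (fun n => rint (fun t => f t * (phi n t - ind t))) =
     (fun=> - rint (fun t => f t * ind t)).
    apply/funext => n; under [X in rint X]eq_fun do rewrite mulrBr.
    by rewrite rintB // Hf sub0r.
  move=> D; have {}D : (fun=> - rint (fun t => f t * ind t)) @ \oo --> (0 : R).
    apply: D => //; last exact: (integrable_norm If).
      by move=> n; apply: rmeasM => //; exact: rmeasB.
    (* At [0], [b] and [2 pi] the value of [arc h] is [1/2], where [step] tends to neither 0 nor
       1. *)
    have := aeI (ae_neq b) (aeI (ae_neq 0) (ae_neq (2 * pi))).
    apply: aeS => t [tb [t0 t2]] Dt.
    rewrite /Defs.period /= in_itv /= in Dt; case/andP: Dt => Dt0 Dt2.
    have tgt0 : 0 < t by rewrite lt0r t0.
    case/andP: (arc01 h t) => A0 A1.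
    have tlt2 : t < 2 * pi by rewrite lt_neqAle t2.
    have T : tends0 (fun n => `|f t| * `|phi n t - ind t|).
      apply: tends0Z => //; have [tlb|tgb|tE] := ltgtP t b; last by rewrite tE eqxx in tb.
        have -> : ind t = 1.
          by rewrite /ind indicE mem_set // /= in_itv /= Dt0 ltW.
        have th : t < 2 * h by rewrite -hE.
        apply: tends0_le (step_lt A0 (arc_lt hb tgt0 th)) => n.
        by rewrite ler0_norm ?opprB //; have := phi01 n t; rewrite /phi; lra.
      have -> : ind t = 0.
        by rewrite /ind indicE memNset //= in_itv /= Dt0 /= leNgt tgb.
      have th : 2 * h < t by rewrite -hE.
      apply: tends0_le (step_gt (arc_gt hb th tlt2) A1) => n.
      by rewrite subr0 ger0_norm //; have := phi01 n t; rewrite /phi; lra.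
    apply/norm_cvg0P; under eq_fun do rewrite normrM.
    by apply: tends0_cvg => // n; rewrite mulr_ge0.
  have := cvg_lim (@Rhausdorff R) D.
  rewrite (lim_cst (@Rhausdorff R)) => H0.
  by apply/eqP; rewrite -oppr_eq0 H0.
have phi0 n : cintg (fun t => F t * (phi n t)%:C) = 0.
  have [p [m Hp]] := step_laurent h n.
  by under [X in cintg X]eq_fun do rewrite Hp; exact: cintg_laurent0.
split; apply: main.
- exact: cintegrable_Re.
- move=> n; have := phi0 n => /(congr1 (@complex.Re R)) /= <-.
  by congr rint; apply/funext => t; rewrite ReM /= mulr0 subr0.
- exact: cintegrable_Im.
- move=> n; have := phi0 n => /(congr1 (@complex.Im R)) /= <-.
  by congr rint; apply/funext => t; rewrite ImM /= mulr0 add0r.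
Qed.

End Uniqueness.

(** * A function with vanishing Fourier coefficients vanishes almost everywhere *)

Section UniquenessTheorem.
Variable R : realType.
Local Notation C := R[i].
Local Notation mu := (@lebesgue_measure R).
Local Notation period := (@period R).

(** The primitive of the extension of [f] by zero vanishes identically, and by Lebesgue's
    differentiation theorem its derivative is [f] almost everywhere. *)
Lemma rint_indic0_ae (f : R -> R) : rintegrable f ->
  (forall b, 0 < b <= 2 * pi -> rint (fun t => f t * \1_(`[0, b]) t) = 0) ->
  {ae mu, forall t, period t -> f t = 0}.
Proof.
move=> If H; pose g := f \_ period.
have ig : mu.-integrable setT (EFin \o g).
  have := If; rewrite /rintegrable (integrable_mkcond _ (@measurable_period R)).
  by rewrite /g -restrict_EFin.
have prim x : (\int[mu]_(t in `]-oo, x]) g t)%R = 0.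
  rewrite /g -Rintegral_mkcondr Rintegral_mkcondl -/(rint _).
  have [x0|x0] := ltP x 0.
    transitivity (rint (fun _ : R => 0 : R)); last by rewrite rint_cst mul0r.
    apply: eq_Rintegral => t; rewrite inE /Defs.period /= in_itv /= => /andP[t0 _].
    by rewrite patchE memNset //= in_itv /=; apply/negP; rewrite -ltNge (lt_le_trans x0).
  have [->|xn0] := eqVneq x 0.
    transitivity (rint (fun _ : R => 0 : R)); last by rewrite rint_cst mul0r.
    apply: rint_eq_ae.
    - apply/measurable_restrict => //.
      by apply: measurable_funS (rintegrable_meas If) => // t [].
    - exact: rmeas_cst.
    apply: aeS (ae_neq 0) => t tn; rewrite /Defs.period /= in_itv /= => /andP[t0 _].
    by rewrite patchE memNset //= in_itv /=; apply/negP; rewrite -ltNge lt0r tn.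
  have xgt0 : 0 < x by rewrite lt0r xn0.
  rewrite -(H (Num.min x (2 * pi))); last first.
    by rewrite lt_min xgt0 twopi_gt0 ge_min lexx orbT.
  apply: eq_Rintegral => t; rewrite inE /Defs.period /= in_itv /= => /andP[t0 t2].
  rewrite patchE indicE; case: (leP t x) => tx.
    by rewrite !mem_set ?mulr1 //= in_itv /= ?t0 ?le_min ?tx ?t2.
  by rewrite !memNset ?mulr0 //= in_itv /=; apply/negP; rewrite ?le_min -?ltNge // leNgt tx andbF.
have locg : locally_integrable [set: R] g.
  split; [by case/integrableP: ig => /measurable_EFinP | exact: openT |].
  move=> K _ cK; case/integrableP: (ig) => mg; apply: le_lt_trans.
  apply: ge0_subset_integral => //; first exact: compact_measurable.
  by have := measurableT_comp (@abse_measurable R setT) mg.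
have igy y : mu.-integrable `]-oo, y] (EFin \o g).
  by apply: integrableS ig.
have := FTC1Ny igy locg; apply: aeS => t [_].
have -> : (fun x => \int[mu]_(s in `]-oo, x]) g s)%R = cst 0.
  by apply/funext => x; rewrite prim.
by rewrite derive1_cst /g => /esym + Dt; rewrite patchE mem_set.
Qed.

Lemma fc0_ae (F : R -> C) : cintegrable F -> (forall n, fc F n = 0) ->
  {ae mu, forall t, period t -> F t = 0}.
Proof.
move=> iF F0.
have H1 : {ae mu, forall t, period t -> complex.Re (F t) = 0}.
  apply: rint_indic0_ae; first exact: cintegrable_Re.
  by move=> b b0; case: (rint_arc0 iF F0 b0).
have H2 : {ae mu, forall t, period t -> complex.Im (F t) = 0}.
  apply: rint_indic0_ae; first exact: cintegrable_Im.
  by move=> b b0; case: (rint_arc0 iF F0 b0).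
apply: aeS (aeI H1 H2) => t [h1 h2] Dt; apply: complex_eqP; rewrite /= ?h1 ?h2 //.
Qed.

End UniquenessTheorem.

(** * Series with geometrically small L1 norms *)

Section SummableSeries.
Variable R : realType.
Local Notation C := R[i].
Local Notation mu := (@lebesgue_measure R).
Local Notation period := (@period R).

Lemma cvg_of_abs_bounded (u v : nat -> R) (K : R) : (forall n, `|u n| <= v n) ->
  (forall n, \sum_(i < n) v i <= K) -> cvgn (fun n => \sum_(i < n) u i).
Proof.
move=> uv vK; have H : cvgn (series u).
  apply: normed_cvg; apply: nondecreasing_is_cvgn.
    by apply/nondecreasing_seqP => n; rewrite /normed_series_of seriesEord /= big_ord_recr /= lerDl.
  exists K => _ [n _ <-]; rewrite /normed_series_of seriesEord /=.
  by apply: le_trans (vK n); apply: ler_sum => i _; exact: uv.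
have -> // : (fun n => \sum_(i < n) u i) = series u.
by apply/funext => n; rewrite seriesEord.
Qed.

(** The Riesz-Fischer argument: the sum [D] of the moduli is integrable, hence finite almost
    everywhere, and it dominates all the errors, so that dominated convergence gives the L1
    statement. *)
Lemma L1_series (F : nat -> R -> C) (K : R) :
  (forall k, cintegrable (F k)) ->
  (forall k, rint (fun t => absc (F k t)) <= K * 2^-1 ^+ k) ->
  exists h : R -> C, [/\ cintegrable h,
    tends0 (fun n => rint (fun t => absc (\sum_(i < n) F i t - h t))) &
    {ae mu, forall t, period t -> tends0 (fun n => absc (\sum_(i < n) F i t - h t))}].
Proof.
move=> iF FK; pose D t := (\sum_(0 <= k <oo) (absc (F k t))%:E)%E.
have mF k : measurable_fun (period : set (measurableTypeR R)) (fun t => (absc (F k t))%:E).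
  apply/measurable_EFinP; exact: (rmeas_absc (iF k).1).
have D0 t : (0 <= D t)%E by apply: nneseries_ge0 => n _ _; rewrite lee_fin absc_ge0.
have DleS t n : ((\sum_(i < n) absc (F i t))%:E <= D t)%E.
  rewrite -sumEFin -(big_mkord predT (fun i => (absc (F i t))%:E)).
  by apply: nneseries_lim_ge => k _ _; rewrite lee_fin absc_ge0.
have mD : measurable_fun (period : set (measurableTypeR R)) D.
  have h0 k (t : measurableTypeR R) : period t -> xpredT k -> (0 <= (absc (F k t))%:E)%E.
    by move=> _ _; rewrite lee_fin absc_ge0.
  have h1 k : xpredT k -> measurable_fun (period : set (measurableTypeR R)) (fun t => (absc (F k t))%:E).
    by move=> _; exact: mF.
  exact: (ge0_emeasurable_sum h0 h1).
have iD : mu.-integrable period D.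
  apply/integrableP; split => //.
  under eq_integral do rewrite gee0_abs //.
  rewrite integral_nneseries //; last by move=> n t _; rewrite lee_fin absc_ge0.
  apply: (@le_lt_trans _ _ (2 * K)%:E); last by rewrite ltry.
  apply: lime_le; first by apply: is_cvg_nneseries => n _ _; apply: integral_ge0 => t _; rewrite lee_fin absc_ge0.
  apply: nearW => n; rewrite big_mkord.
  apply: (@le_trans _ _ (\sum_(i < n) (K * 2^-1 ^+ i)%:E)%E).
    apply: lee_sum => i _; have := FK i; rewrite -lee_fin /rint /Rintegral fineK //.
    exact: integrable_fin_num (iF i).2.
  have K0 : 0 <= K.
    have := FK 0%N; rewrite expr0 mulr1; apply: le_trans.
    by apply: rint_ge0 => t _; exact: absc_ge0.
  rewrite sumEFin lee_fin -mulr_sumr mulrC ler_wpM2r //.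
  have -> : \sum_(i < n) 2^-1 ^+ i = 2 - 2 * 2^-1 ^+ n :> R.
    elim: n => [|n IH]; first by rewrite big_ord0 expr0; ring.
    by rewrite big_ord_recr /= IH exprS; field.
  by rewrite gerBl mulr_ge0 // exprn_ge0 // invr_ge0.
(* Where [D] is infinite the partial sums are multiplied by 0, so that the limit [h] exists at every
   point and is measurable. *)
pose A := period `&` [set t | D t \is a fin_num].
have mA : measurable (A : set (measurableTypeR R)) by exact: emeasurable_fin_num.
pose a : R -> R := \1_A.
have ma : rmeas a by exact: measurable_indic.
have a1 t : A t -> a t = 1 by move=> At; rewrite /a indicE mem_set.
have a0 t : ~ A t -> a t = 0 by move=> At; rewrite /a indicE memNset.
pose S n t := (a t)%:C * \sum_(i < n) F i t.
have mS n : cmeas (S n).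
  apply: cmeasM; first by split => //=; exact: rmeas_cst.
  by apply: cmeas_sum => i; exact: (iF i).1.
have bS t : A t -> forall n, \sum_(i < n) absc (F i t) <= fine (D t).
  by move=> [_ fD] n; rewrite -lee_fin fineK.
have cS t : exists l : C, (complex.Re (S n t) @[n --> \oo] --> complex.Re l) /\
     (complex.Im (S n t) @[n --> \oo] --> complex.Im l).
  have [At|nAt] := pselect (A t); last first.
    exists 0 => /=; split; rewrite [X in X @ _](_ : _ = fun=> 0); try exact: cvg_cst;
      by apply/funext => n; rewrite /S a0 // mul0r.
  have c1 : cvgn (fun n => \sum_(i < n) complex.Re (F i t)).
    exact: (cvg_of_abs_bounded (fun n => Re_le_absc (F n t)) (bS t At)).
  have c2 : cvgn (fun n => \sum_(i < n) complex.Im (F i t)).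
    exact: (cvg_of_abs_bounded (fun n => Im_le_absc (F n t)) (bS t At)).
  have ReS n : complex.Re (S n t) = \sum_(i < n) complex.Re (F i t).
    rewrite /S a1 // mul1r.
    by elim: n => [|n IH]; rewrite ?big_ord0 // !big_ord_recr /= ReD IH.
  have ImS n : complex.Im (S n t) = \sum_(i < n) complex.Im (F i t).
    rewrite /S a1 // mul1r.
    by elim: n => [|n IH]; rewrite ?big_ord0 // !big_ord_recr /= ImD IH.
  exists (limn (fun n => \sum_(i < n) complex.Re (F i t)) +i*
          limn (fun n => \sum_(i < n) complex.Im (F i t))) => /=.
  by split; [under eq_fun do rewrite ReS | under eq_fun do rewrite ImS].
have [h Hh] := choice cS.
have mh : cmeas h.
  split.
    exact: (measurable_fun_cvg (fun n => (mS n).1) (fun t _ => (Hh t).1)).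
  exact: (measurable_fun_cvg (fun n => (mS n).2) (fun t _ => (Hh t).2)).
have tS t : tends0 (fun n => absc (S n t - h t)).
  have [h1 h2] := Hh t.
  have T1 : tends0 (fun n => `|complex.Re (S n t) - complex.Re (h t)|).
    apply: cvg_tends0; apply/norm_cvg0P.
    by rewrite -[0](subrr (complex.Re (h t))); apply: cvgB => //; exact: cvg_cst.
  have T2 : tends0 (fun n => `|complex.Im (S n t) - complex.Im (h t)|).
    apply: cvg_tends0; apply/norm_cvg0P.
    by rewrite -[0](subrr (complex.Im (h t))); apply: cvgB => //; exact: cvg_cst.
  apply: tends0_le (tends0D T1 T2) => n.
  by apply: le_trans (absc_le_ReIm _) _; rewrite ReD ImD ReN ImN.
have SS n m t : (n <= m)%N -> absc (S n t - S m t) <= fine (D t).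
  move=> nm; have [At|nAt] := pselect (A t); last first.
    by rewrite /S a0 // !mul0r subrr absc0 fine_ge0.
  apply: le_trans (bS t At m); rewrite /S a1 // !mul1r absc_dist.
  rewrite -!(big_mkord predT (fun i => F i t)) -(big_mkord predT (fun i => absc (F i t))).
  rewrite (big_cat_nat (leq0n n) nm) //= addrAC subrr add0r (big_cat_nat (leq0n n) nm) //=.
  rewrite (le_trans (absc_sum _ _ _)) // lerDr sumr_ge0 // => i _; exact: absc_ge0.
have Sh n t : absc (S n t - h t) <= fine (D t).
  apply/ler_addgt0Pr => e e0; have [M HM] := tS t e e0.
  have := HM (maxn n M) (leq_maxr _ _); have := SS n (maxn n M) t (leq_maxl _ _).
  move=> H1 H2; apply: le_trans (lerD H1 H2).
  have -> : S n t - h t = (S n t - S (maxn n M) t) + (S (maxn n M) t - h t) by ring.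
  exact: abscD.
have iDf : rintegrable (fine \o D).
  apply: (le_integrable _ _ _ iD) => //.
    apply/measurable_EFinP.
    have mfine := @fine_measurable R setT measurableT.
    exact: (measurableT_comp mfine mD).
  move=> t _ /=; rewrite gee0_abs //; case: (D t) (D0 t) => //= [r r0|_]; last by rewrite normr0 leey.
  by rewrite ger0_norm.
have aeA : {ae mu, forall t, period t -> A t}.
  by apply: aeS (integrable_ae (@measurable_period R) iD) => t H Dt; split => //; exact: H.
have ih : cintegrable h.
  apply: (cintegrable_le mh) iDf => t _.
  by have := Sh 0%N t; rewrite /S big_ord0 mulr0 sub0r abscN.
exists h; split => //.
- have : tends0 (fun n => rint (fun t => absc (S n t - h t))).
    apply: cvg_tends0; apply: (rint_dct _ _ iDf).
    + by move=> n; apply: rmeas_absc; exact: cmeasB.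
    + apply: aeW => t _; apply: tends0_cvg (tS t) => n; exact: absc_ge0.
    + by move=> n t _; rewrite ger0_norm ?absc_ge0 // Sh.
  apply: tends0_le => n; rewrite le_eqVlt; apply/orP; left; apply/eqP.
  apply: rint_eq_ae.
  + apply: rmeas_absc; apply: cmeasB => //; apply: cmeas_sum => i; exact: (iF i).1.
  + by apply: rmeas_absc; exact: cmeasB.
  + by apply: aeS aeA => t At Dt; rewrite /S a1 ?mul1r //; exact: At.
- apply: aeS aeA => t At Dt; apply: tends0_le (tS t) => n.
  by rewrite /S a1 ?mul1r //; exact: At.
Qed.

End SummableSeries.

(** * Lacunary partial sums of an imaginary function of finite energy *)

Section ImaginaryFourierSeries.
Variable R : realType.
Local Notation C := R[i].
Local Notation mu := (@lebesgue_measure R).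
Local Notation period := (@period R).

Definition pos_part (X : R -> C) (N : nat) : {poly C} :=
  \poly_(j < N) (if j == 0%N then 0 else fc X j).

Lemma coef_pos_part X N j :
  (pos_part X N)`_j = if (0 < j < N)%N then fc X j else 0.
Proof. by rewrite coef_poly; case: j => [|j] /=; [case: N|]. Qed.

Lemma N2_poly_widen (p : {poly C}) M : (size p <= M)%N ->
  N2 (fun t => p.[cis t]) = 2 * pi * \sum_(k < M) absc p`_k ^+ 2.
Proof.
move=> sM; rewrite N2_poly (big_ord_widen M (fun k => absc p`_k ^+ 2) sM).
congr (_ * _); rewrite [LHS]big_mkcond; apply: eq_bigr => k _; case: ltnP => // ks.
by rewrite nth_default // absc0 expr0n.
Qed.

Variable X : R -> C.
Hypothesis LX : L2 X.
Hypothesis X_imag : {ae mu, forall t, period t -> complex.Re (X t) = 0}.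

Lemma fc_imag n : fc X (- n) = - conjc (fc X n).
Proof.
have iX := L2_cintegrable LX; have iN := cintegrableN (cintegrable_conj iX).
have -> : fc X (- n) = fc (fun t => - conjc (X t)) (- n).
  apply: fc_eq_ae; [exact: iX.1 | exact: iN.1 |].
  by apply: aeS X_imag => t H Dt; apply: complex_eqP; rewrite !ReIm ?opprK // H // oppr0.
have -> : (fun t => - conjc (X t)) = (fun t => -1 * conjc (X t)).
  by apply/funext => t; rewrite mulN1r.
by rewrite fcZ ?mulN1r ?fc_conj ?opprK //; exact: cintegrable_conj.
Qed.

Variable E : R.
Hypothesis XE : forall N, \sum_(j < N) j%:R * absc (fc X j) ^+ 2 <= E.

Let F k t := (pos_part X (4 ^ k.+1) - pos_part X (4 ^ k)).[cis t].

(** On the block [4^k <= j < 4^(k+1)] the weight [j] is at least [4^k], so the square norm is at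
    most [2 pi E / 4^k]. Young's inequality against the constant 1 with [lam = 2^-k] turns this into
    a geometric L1 bound; the base 4 makes the balancing [lam] a power of 2. *)
Let rint_F k : rint (fun t => absc (F k t)) <= 2 * pi * (1 + E) * 2^-1 ^+ k.
Proof.
set q := pos_part X (4 ^ k.+1) - pos_part X (4 ^ k).
have lam0 : 0 < (2^-1 : R) ^+ k by rewrite exprn_gt0 // invr_gt0.
have p0 := @twopi_gt0 R.
have [_] := L2_young lam0 (L2_cst 1) (L2_poly q).
under [X in rint X]eq_fun do rewrite mul1r.
move/le_trans; apply.
have -> : N2 (fun=> 1 : C) = 2 * pi.
  by rewrite /N2; under [X in rint X]eq_fun do rewrite absc1 expr1n; rewrite rint_cst mul1r.
have sq : (size q <= 4 ^ k.+1)%N.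
  rewrite (leq_trans (size_polyD _ _)) // size_polyN geq_max size_poly.
  by rewrite (leq_trans (size_poly _ _)) // leq_exp2l.
have N2q : N2 (fun t => q.[cis t]) <= 2 * pi * ((4^-1) ^+ k * E).
  rewrite (N2_poly_widen sq) ler_pM2l //.
  apply: (@le_trans _ _ ((4^-1) ^+ k * \sum_(j < 4 ^ k.+1) j%:R * absc (fc X j) ^+ 2)).
    rewrite mulr_sumr; apply: ler_sum => j _.
    rewrite coefB !coef_pos_part; case: (posnP j) => [->|j0] /=.
      by rewrite subrr absc0 expr0n mul0r mulr0.
    rewrite ltn_ord; case: ltnP => jk.
      by rewrite subrr absc0 expr0n /= !mulr_ge0 ?exprn_ge0 ?invr_ge0 // absc_ge0.
    rewrite subr0 mulrA ler_peMl ?sqr_ge0 // exprVn mulrC ler_pdivlMr ?exprn_gt0 //.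
    by rewrite mul1r -natrX ler_nat.
  by rewrite ler_wpM2l // exprn_ge0 // invr_ge0.
have l4 : (4^-1 : R) ^+ k = 2^-1 ^+ k * 2^-1 ^+ k.
  by rewrite -exprMn; congr (_ ^+ _); field.
rewrite -exprVn invrK in N2q *.
apply: (@le_trans _ _ (2^-1 ^+ k * (2 * pi) + 2 ^+ k * (2 * pi * ((4^-1) ^+ k * E)))).
  by rewrite lerD2l ler_pM2l // exprn_gt0.
have l2 : 2 ^+ k * 2^-1 ^+ k = 1 :> R by rewrite -exprMn divff // expr1n.
rewrite le_eqVlt; apply/orP; left; apply/eqP.
rewrite l4; set l := 2^-1 ^+ k in l2 *.
transitivity (l * (2 * pi) + (2 ^+ k * l) * (2 * pi * (l * E))); first by ring.
by rewrite l2; ring.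
Qed.

Let tele n t : \sum_(i < n) F i t = (pos_part X (4 ^ n)).[cis t].
Proof.
elim: n => [|n IH]; last by rewrite big_ord_recr /= IH /F hornerD hornerN addrC subrK.
rewrite big_ord0 (_ : pos_part X _ = 0) ?horner0 //.
by apply/polyP => j; rewrite coef_pos_part coef0; case: j.
Qed.

(** The blocks sum, in L1 and almost everywhere, to some [h] whose coefficients are those of [X] at
    positive indices and 0 elsewhere. As [X] is imaginary, [fc X 0 + h - conj h] has all the
    coefficients of [X], and uniqueness identifies the two. *)
Lemma imag_series_ae : {ae mu, forall t, period t ->
  tends0 (fun k => absc (fc X 0 + (pos_part X (4 ^ k)).[cis t]
                       - conjc (pos_part X (4 ^ k)).[cis t] - X t))}.
Proof.
have iF k : cintegrable (F k) by apply: L2_cintegrable; exact: L2_poly.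
have [h [ih Lh aeh]] := L1_series iF rint_F.
have iP k : cintegrable (fun t => (pos_part X (4 ^ k)).[cis t]).
  by apply: L2_cintegrable; exact: L2_poly.
have p0 : 0 <= (2 * pi)^-1 :> R by rewrite invr_ge0 ltW // twopi_gt0.
have fch m : tends0 (fun n => absc (fc (fun t => (pos_part X (4 ^ n)).[cis t]) m - fc h m)).
  apply: tends0_le (tends0Z p0 Lh) => n.
  rewrite -fcB //; apply: le_trans (absc_fc _ _) _; first exact: cintegrableB.
  by under [X in _ <= _ * rint X]eq_fun do rewrite tele.
have fch_neg n : fc h (Negz n) = 0.
  apply: esym; apply: (@absc_lim_unique _ _ _ (fun=> 0)); last first.
    by apply: tends0_le (fch (Negz n)) => m; rewrite fc_poly.
  by move=> e e0; exists 0%N => m _; rewrite subrr absc0 ltW.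
have fch_0 : fc h 0 = 0.
  apply: esym; apply: (@absc_lim_unique _ _ _ (fun=> 0)); last first.
    by apply: tends0_le (fch 0) => m; rewrite fc_poly /= coef_pos_part.
  by move=> e e0; exists 0%N => m _; rewrite subrr absc0 ltW.
have fch_pos (n : nat) : fc h n.+1%:Z = fc X n.+1%:Z.
  apply: esym; apply: (@absc_lim_unique _ _ _ (fun m => (pos_part X (4 ^ m))`_n.+1)); last first.
    by apply: tends0_le (fch n.+1%:Z) => m; rewrite fc_poly.
  move=> e e0; exists n.+1 => m nm; rewrite coef_pos_part /=.
  have -> : (n.+1 < 4 ^ m)%N by apply: leq_trans (ltn_expl m (isT : 1 < 4)%N).
  by rewrite subrr absc0 ltW.
have iX := L2_cintegrable LX.
pose H t := fc X 0 + h t - conjc (h t).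
have iH : cintegrable H.
  apply: cintegrableB; last exact: cintegrable_conj.
  by apply: cintegrableD => //; exact: cintegrable_cst.
have fcH n : fc H n = fc X n.
  have icst := @cintegrable_cst R (fc X 0).
  rewrite /H fcB; [|exact: cintegrableD|exact: cintegrable_conj].
  rewrite fcD // fc_conj //.
  have -> : fc (fun=> fc X 0) n = fc X 0 * (n == 0)%:R.
    have := @fc_poly R ((fc X 0)%:P) n.
    under [X in fc X]eq_fun do rewrite hornerC.
    move=> ->; case: n => [n|n]; last by rewrite mulr0.
    by rewrite coefC; case: n => [|n] /=; rewrite ?mulr1 ?mulr0.
  case: n => [[|n]|n].
  - by rewrite oppr0 fch_0 mulr1 conjc0 subr0 addr0.
  - have -> : - (n.+1%:Z) = Negz n by lia.
    by rewrite mulr0 add0r fch_pos fch_neg conjc0 subr0.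
  - have -> : - Negz n = n.+1%:Z by lia.
    rewrite mulr0 add0r fch_pos fch_neg sub0r.
    have -> : Negz n = - (n.+1%:Z) by lia.
    by rewrite fc_imag.
have XH : {ae mu, forall t, period t -> X t - H t = 0}.
  apply: fc0_ae; first exact: cintegrableB.
  by move=> n; rewrite fcB // fcH subrr.
apply: aeS (aeI aeh XH) => t [h1 h2] Dt.
have tX := subr0_eq (h2 Dt).
apply: tends0_le (tends0D (h1 Dt) (h1 Dt)) => n.
rewrite tele tX /H; set P := _.[_].
have -> : fc X 0 + P - conjc P - (fc X 0 + h t - conjc (h t)) =
  (P - h t) - conjc (P - h t) by rewrite conjcB; ring.
by apply: le_trans (abscB _ _) _; rewrite absc_conj.
Qed.

End ImaginaryFourierSeries.

(** * Polynomial approximation of the exponential and the Lebedev-Milin inequality *)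

Section ExponentialApproximation.
Variable R : realType.
Local Notation C := R[i].

(** From [1 - x <= exp (-x)] one gets [exp x - 1 - x <= x^2 / (1 - x)], and [1 - x >= 1/2]. *)
Lemma expR_approx (x : R) : `|x| <= 2^-1 -> `|expR x - 1 - x| <= 2 * x ^+ 2.
Proof.
rewrite ler_norml => /andP[x1 x2]; have h1 := expR_ge1Dx x.
have h2 := expR_ge1Dx (- x); rewrite expRN in h2.
have e0 := expR_gt0 x.
have h3 : expR x * (1 - x) <= 1.
  by rewrite mulrC -ler_pdivlMr // mul1r.
rewrite ger0_norm; last by lra.
by have := sqr_ge0 x; nra.
Qed.

Lemma mvt_abs (f df : R -> R) (K y : R) : 0 <= y ->
  (forall x : R, is_derive x 1 f (df x)) -> (forall x, 0 <= x <= y -> `|df x| <= K) ->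
  `|f y - f 0| <= K * y.
Proof.
move=> y0 dF bK; have [->|yn0] := eqVneq y 0; first by rewrite subrr normr0 mulr0.
have ygt0 : 0 < y by rewrite lt0r yn0.
have cf : {within `[0, y], continuous f}.
  apply: continuous_subspaceT => x; apply: differentiable_continuous.
  by apply/derivable1_diffP; case: (dF x).
have [c] := MVT ygt0 (fun x _ => dF x) cf.
rewrite in_itv /= => /andP[c0 cy] ->; rewrite subr0 normrM (gtr0_norm ygt0).
by rewrite ler_wpM2r ?bK // !ltW.
Qed.

Lemma abs_sin_le (y : R) : `|sin y| <= `|y|.
Proof.
wlog y0 : y / 0 <= y => [H|].
  have [/H//|/ltW y0] := leP 0 y.
  by rewrite -normrN -sinN -[leRHS]normrN H // oppr_ge0.
have := @mvt_abs sin cos 1 y y0 (fun x => is_derive_sin x).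
rewrite sin0 subr0 mul1r (ger0_norm y0); apply => x _.
by rewrite ler_norml cos_geN1 cos_le1.
Qed.

Lemma abs_cosB1_le (y : R) : `|cos y - 1| <= y ^+ 2.
Proof.
wlog y0 : y / 0 <= y => [H|].
  have [/H//|/ltW y0] := leP 0 y.
  by rewrite -cosN -sqrrN H // oppr_ge0.
have := @mvt_abs cos (fun x => - sin x) y y y0 (fun x => is_derive_cos x).
rewrite cos0 expr2; apply => x /andP[x0 xy].
by rewrite normrN (le_trans (abs_sin_le x)) // ger0_norm.
Qed.

Lemma abs_cosB1_le2 (y : R) : `|cos y - 1| <= `|y|.
Proof.
wlog y0 : y / 0 <= y => [H|].
  have [/H//|/ltW y0] := leP 0 y.
  by rewrite -cosN -[leRHS]normrN H // oppr_ge0.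
have := @mvt_abs cos (fun x => - sin x) 1 y y0 (fun x => is_derive_cos x).
rewrite cos0 mul1r (ger0_norm y0); apply => x _.
by rewrite normrN ler_norml sin_geN1 sin_le1.
Qed.

Lemma abs_sinB_le (y : R) : `|sin y - y| <= y ^+ 2.
Proof.
wlog y0 : y / 0 <= y => [H|].
  have [/H//|/ltW y0] := leP 0 y.
  rewrite -normrN opprB -sqrrN; have := H (- y); rewrite sinN opprK oppr_ge0.
  by rewrite (addrC y); apply.
have dF (x : R) : is_derive x 1 (fun y : R => sin y - y) (cos x - 1).
  exact: is_deriveB.
have := @mvt_abs _ _ y y y0 dF.
rewrite sin0 subr0 subr0 expr2; apply => x /andP[x0 xy].
by rewrite (le_trans (abs_cosB1_le2 x)) // ger0_norm.
Qed.

(** The error splits into a real-exponential error times [cis y], a trigonometric error times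
    [1 + x], and the cross term [i x y]. They contribute at most 2, 4 and 1 times [|v|^2]; the
    constant 16 is generous. *)
Lemma cexp_approx (v : C) : absc v <= 2^-1 -> absc (cexp v - 1 - v) <= 16 * absc v ^+ 2.
Proof.
case: v => x y; set v := x +i* y => vs.
have xv : `|x| <= absc v := Re_le_absc v.
have yv : `|y| <= absc v := Im_le_absc v.
have x2 : x ^+ 2 <= absc v ^+ 2 by rewrite -real_normK ?num_real // lerXn2r ?nnegrE ?absc_ge0.
have y2 : y ^+ 2 <= absc v ^+ 2 by rewrite -[y ^+ 2]real_normK ?num_real // lerXn2r ?nnegrE ?absc_ge0.
have xy : `|x| * `|y| <= absc v ^+ 2 by rewrite expr2 ler_pM.
have -> : cexp v - 1 - v = (expR x - 1 - x)%:C * cis y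
   + (1 + x)%:C * (cis y - 1 - 0 +i* y) + x%:C * (0 +i* y).
  rewrite /cexp; apply: complex_eqP; rewrite !ReIm /=; by ring.
have ex := expR_approx (le_trans xv vs).
have c1 := abs_cosB1_le y; have s1 := abs_sinB_le y.
have h3 : absc (x%:C * (0 +i* y)) <= absc v ^+ 2.
  rewrite abscM absc_real; apply: le_trans xy; rewrite ler_wpM2l //.
  by apply: le_trans (absc_le_ReIm _) _; rewrite /= normr0 add0r.
have h1 : absc ((expR x - 1 - x)%:C * cis y) <= 2 * absc v ^+ 2.
  rewrite abscM absc_real absc_cis mulr1; apply: le_trans ex _.
  by rewrite ler_pM2l.
have h2 : absc ((1 + x)%:C * (cis y - 1 - 0 +i* y)) <= 2 * (2 * absc v ^+ 2).
  rewrite abscM absc_real ler_pM ?absc_ge0 //.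
    by rewrite (le_trans (ler_normD _ _)) // normr1; lra.
  have -> : cis y - 1 - 0 +i* y = (cos y - 1) +i* (sin y - y).
    by apply: complex_eqP; rewrite !ReIm /= !subr0.
  apply: le_trans (absc_le_ReIm _) _.
  rewrite [in leRHS]mulr2n mulrDl mul1r lerD //=.
    exact: le_trans c1 y2.
  exact: le_trans s1 y2.
apply: le_trans (abscD _ _) _; apply: le_trans (lerD (abscD _ _) (lexx _)) _.
by have := sqr_ge0 (absc v); lra.
Qed.

Lemma absc_subX (a b : C) (M : R) m : 1 <= M -> absc a <= M -> absc b <= M ->
  absc (a ^+ m - b ^+ m) <= m%:R * absc (a - b) * M ^+ m.
Proof.
move=> M1 aM bM; elim: m => [|m IH]; first by rewrite !expr0 subrr absc0 !mul0r.
have -> : a ^+ m.+1 - b ^+ m.+1 = a * (a ^+ m - b ^+ m) + (a - b) * b ^+ m.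
  by rewrite !exprS; ring.
apply: le_trans (abscD _ _) _; rewrite !abscM abscX.
have M0 : 0 <= M by lra.
have Mm : 0 <= M ^+ m by rewrite exprn_ge0.
have h1 : absc a * absc (a ^+ m - b ^+ m) <= M * (m%:R * absc (a - b) * M ^+ m).
  by rewrite ler_pM ?absc_ge0.
have h2 : absc (a - b) * absc b ^+ m <= absc (a - b) * (M * M ^+ m).
  rewrite ler_wpM2l ?absc_ge0 //; apply: (@le_trans _ _ (M ^+ m)).
    by rewrite lerXn2r ?nnegrE ?absc_ge0.
  by rewrite ler_peMl.
apply: le_trans (lerD h1 h2) _; rewrite exprS -natr1 le_eqVlt; apply/orP; left.
by apply/eqP; ring.
Qed.

(** Euler's approximation of [exp w], of order [m + 1] so that no division by 0 occurs. It is a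
    polynomial in [w], hence in [z] when [w] is. *)
Definition euler (w : C) (m : nat) : C := (1 + (m.+1%:R^-1)%:C * w) ^+ m.+1.

Lemma expR_div (x : R) m : expR (m.+1%:R^-1 * x) ^+ m.+1 = expR x.
Proof. by rewrite -expRM_natl mulrA divff ?mul1r. Qed.

Lemma absc_1Dv (w : C) m : absc (1 + (m.+1%:R^-1)%:C * w) <= expR (m.+1%:R^-1 * absc w).
Proof.
apply: le_trans (abscD _ _) _; rewrite absc1 abscM absc_real ger0_norm ?invr_ge0 //.
exact: expR_ge1Dx.
Qed.

Lemma absc_euler (w : C) m : absc (euler w m) <= expR (absc w).
Proof.
rewrite abscX -(expR_div (absc w) m) lerXn2r ?nnegrE ?absc_ge0 ?expR_ge0 //.
exact: absc_1Dv.
Qed.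

Lemma inv_tends0 (K : R) : 0 <= K -> tends0 (fun m => K / m.+1%:R).
Proof.
move=> K0; apply: tends0Z => //; apply: (@cvg_tends0 _ (@harmonic R)).
exact: cvg_harmonic.
Qed.

Lemma euler_lim (w : C) : tends0 (fun m => absc (euler w m - cexp w)).
Proof.
(* With [v = w / (m + 1)], the difference of the two powers of exponent [m + 1] is at most [(m + 1)
   * 16 |v|^2 * exp |w| = K / (m + 1)]. *)
set K := 16 * absc w ^+ 2 * expR (absc w).
have K0 : 0 <= K by rewrite /K mulr_ge0 ?expR_ge0 // mulr_ge0 // sqr_ge0.
move=> e e0; have [M1 HM1] := inv_tends0 K0 e0.
have i2 : 0 < 2^-1 :> R by rewrite invr_gt0.
have [M2 HM2] := inv_tends0 (absc_ge0 w) i2.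
exists (maxn M1 M2) => m; rewrite geq_max => /andP[m1 m2].
apply: le_trans (HM1 m m1).
set v := (m.+1%:R^-1)%:C * w.
have av : absc v = m.+1%:R^-1 * absc w.
  by rewrite abscM absc_real ger0_norm ?invr_ge0.
have v2 : absc v <= 2^-1 by rewrite av mulrC HM2.
have -> : cexp w = cexp v ^+ m.+1.
  rewrite -cexpM_nat /v mulrA; congr cexp.
  have -> : m.+1%:R = (m.+1%:R)%:C :> C by rewrite rmorph_nat.
  by rewrite -rmorphM divff // mul1r.
have M1' : 1 <= expR (absc v) by rewrite -[leLHS]expR0 ler_expR absc_ge0.
have b1 : absc (1 + v) <= expR (absc v) by rewrite av; exact: absc_1Dv.
have b2 : absc (cexp v) <= expR (absc v).
  by rewrite absc_cexp ler_expR (le_trans (ler_norm _)) // Re_le_absc.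
apply: le_trans (absc_subX _ M1' b1 b2) _.
have -> : expR (absc v) ^+ m.+1 = expR (absc w) by rewrite av expR_div.
have := cexp_approx v2.
have -> : cexp v - 1 - v = cexp v - (1 + v) by rewrite opprD addrA.
rewrite absc_dist => h.
apply: (@le_trans _ _ (m.+1%:R * (16 * absc v ^+ 2) * expR (absc w))).
  by rewrite ler_wpM2r ?expR_ge0 // ler_wpM2l.
rewrite av /K le_eqVlt; apply/orP; left; apply/eqP.
have : (m.+1%:R : R) != 0 by rewrite pnatr_eq0.
by move: (m.+1%:R : R) => k k0; field.
Qed.

(* Lebedev and Milin's inequality for [exp (- p)], with [exp x] replaced by
   its approximation [(1 + x / m) ^ m] so that only polynomials occur. *)
Lemma sum_sqr_le (n : nat) (a : nat -> R) :
  (\sum_(j < n) a j) ^+ 2 <= n%:R * \sum_(j < n) a j ^+ 2.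
Proof.
case: n => [|n]; first by rewrite big_ord0 expr0n mul0r.
set S := \sum_(j < _) a j; set x := S / n.+1%:R.
have : 0 <= \sum_(j < n.+1) (a j - x) ^+ 2 by apply: sumr_ge0 => j _; exact: sqr_ge0.
have -> : \sum_(j < n.+1) (a j - x) ^+ 2 =
    \sum_(j < n.+1) a j ^+ 2 - 2 * x * S + n.+1%:R * x ^+ 2.
  have e j : (a j - x) ^+ 2 = a j ^+ 2 + (- 2 * x) * a j + x ^+ 2 by ring.
  under eq_bigr do rewrite e.
  rewrite !big_split /= -mulr_sumr sumr_const card_ord -/S -[x ^+ 2 *+ _]mulr_natl.
  by move: (n.+1%:R : R) => k; ring.
set Q := \sum_(j < _) _; rewrite /x => h.
have n0 : 0 < n.+1%:R :> R by rewrite ltr0n.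
have : 0 <= n.+1%:R * (Q - 2 * (S / n.+1%:R) * S + n.+1%:R * (S / n.+1%:R) ^+ 2).
  by rewrite mulr_ge0 // ltW.
have -> : n.+1%:R * (Q - 2 * (S / n.+1%:R) * S + n.+1%:R * (S / n.+1%:R) ^+ 2)
   = n.+1%:R * Q - S ^+ 2.
  by move: (n.+1%:R : R) (lt0r_neq0 n0) => k k0; field.
by rewrite subr_ge0.
Qed.

Variable p : {poly C}.

(** Its value at 1 is, up to a constant, the Dirichlet energy of [p]. *)
Definition lm_weight : {poly R} := \poly_(j < size p) (j%:R * absc p`_j ^+ 2).

Lemma coef_lm_weight j : lm_weight`_j = j%:R * absc p`_j ^+ 2.
Proof.
by rewrite coef_poly; case: ltnP => // h; rewrite nth_default // absc0 expr0n mulr0.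
Qed.

Lemma lm_weight_ge0 (s : R) k i : 0 <= s -> 0 <= ((1 + s *: lm_weight) ^+ k)`_i.
Proof.
move=> s0; elim: k i => [|k IH] i; first by rewrite expr0 coef1 ler0n.
rewrite exprS coefM sumr_ge0 // => j _; rewrite mulr_ge0 // coefD coef1 coefZ.
by rewrite addr_ge0 ?ler0n // mulr_ge0 // coef_lm_weight mulr_ge0 // sqr_ge0.
Qed.

Lemma deriv_coefX (A : comNzRingType) (q : {poly A}) (s : A) k i :
  ((1 + s *: q) ^+ k.+1)`_i.+1 *+ i.+1 =
  (s *+ k.+1) * \sum_(j < i.+1) (q`_j.+1 *+ j.+1) * ((1 + s *: q) ^+ k)`_(i - j).
Proof.
rewrite -coef_deriv deriv_exp /= derivD derivZ -polyC1 derivC add0r.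
rewrite -scalerAl coefMn coefZ coefM mulrnAl; congr (_ * _ *+ _).
by apply: eq_bigr => j _; rewrite coef_deriv polyC1.
Qed.

(** Differentiating [(1 - s p)^(k+1)] expresses [i + 1] times the coefficient of index [i + 1]
    through the coefficients of the [k]-th power, and likewise on the right-hand side. Squaring that
    sum of [i + 1] terms costs, by Cauchy-Schwarz, the factor [i + 1], absorbed by the second factor
    [j] which differentiation creates on the right. A factor [(k + 1) s] is left over, and it is at
    most 1. *)
Lemma lebedev_milin_coef (s : R) k i : p`_0 = 0 -> 0 <= s -> k%:R * s <= 1 ->
  absc ((1 - s%:C *: p) ^+ k)`_i ^+ 2 <= ((1 + s *: lm_weight) ^+ k)`_i.
Proof.
move=> p0 s0; elim: k i => [|k IH] i ks.
  by rewrite !expr0 !coef1; case: (i == _); rewrite ?absc1 ?absc0 ?expr1n ?expr0n.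
have ks' : k%:R * s <= 1.
  by apply: le_trans ks; rewrite ler_wpM2r // ler_nat.
case: i => [|i].
  have e1 m : ((1 - s%:C *: p) ^+ m)`_0 = 1.
    rewrite -horner_coef0 horner_exp hornerD hornerN hornerZ (horner_coef0 p) p0.
    by rewrite mulr0 subr0 -polyC1 hornerC expr1n.
  have e2 m : ((1 + s *: lm_weight) ^+ m)`_0 = 1.
    rewrite -horner_coef0 horner_exp hornerD hornerZ (horner_coef0 lm_weight) coef_lm_weight.
    by rewrite mul0r mulr0 addr0 -polyC1 hornerC expr1n.
  by rewrite e1 e2 absc1 expr1n.
set B := (1 - s%:C *: p) ^+ k.+1; set T := (1 + s *: lm_weight) ^+ k.+1.
have T0 : 0 <= T`_i.+1 by exact: lm_weight_ge0.
have dB : B`_i.+1 *+ i.+1 = (- s%:C *+ k.+1) *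
    \sum_(j < i.+1) (p`_j.+1 *+ j.+1) * ((1 - s%:C *: p) ^+ k)`_(i - j).
  by have := deriv_coefX p (- s%:C) k i; rewrite scaleNr.
have dT := deriv_coefX lm_weight s k i.
rewrite -/T in dT; set b := fun j => ((1 - s%:C *: p) ^+ k)`_j in dB.
set u := fun j => ((1 + s *: lm_weight) ^+ k)`_j in dT.
have n0 : 0 < i.+1%:R :> R by rewrite ltr0n.
have abs_nat (A : C) m : absc (A *+ m) = m%:R * absc A.
  by rewrite -[A *+ m]mulr_natl abscM -(rmorph_nat (real_complex R)) absc_real normr_nat.
have hB : i.+1%:R * absc B`_i.+1 <= (k.+1%:R * s) *
    \sum_(j < i.+1) (j.+1%:R * absc p`_j.+1 * absc (b (i - j)%N)).
  rewrite -abs_nat dB abscM abs_nat abscN absc_real ger0_norm //.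
  rewrite ler_wpM2l ?mulr_ge0 // (le_trans (absc_sum _ _ _)) // ler_sum // => j _.
  by rewrite abscM abs_nat.
set W := \sum_(j < i.+1) (j.+1%:R * absc p`_j.+1 * absc (b (i - j)%N)) in hB.
have hT : i.+1%:R * T`_i.+1 = (k.+1%:R * s) *
    \sum_(j < i.+1) (j.+1%:R * (j.+1%:R * absc p`_j.+1 ^+ 2) * u (i - j)%N).
  rewrite mulr_natl dT -[s *+ k.+1]mulr_natl; congr (_ * _); apply: eq_bigr => j _.
  by rewrite coef_lm_weight -[_ *+ j.+1]mulr_natl.
set V := \sum_(j < i.+1) (j.+1%:R * (j.+1%:R * absc p`_j.+1 ^+ 2) * u (i - j)%N) in hT.
have WV : W ^+ 2 <= i.+1%:R * V.
  apply: le_trans (sum_sqr_le i.+1 (fun j => j.+1%:R * absc p`_j.+1 * absc (b (i - j)%N))) _.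
  rewrite ler_wpM2l //; apply: ler_sum => j _.
  rewrite !exprMn mulrA -expr2 ler_wpM2l ?mulr_ge0 ?sqr_ge0 ?absc_ge0 //.
  exact: (IH (i - j)%N ks').
set c := k.+1%:R * s in hB hT ks; set n := i.+1%:R in n0 hB hT WV.
set x := absc B`_i.+1 in hB *; set y := T`_i.+1 in T0 hT *.
have c0 : 0 <= c by rewrite mulr_ge0.
have x0 : 0 <= x := absc_ge0 _.
have nx2 : (n * x) ^+ 2 <= (c * W) ^+ 2.
  rewrite lerXn2r ?nnegrE //; first by rewrite mulr_ge0 // ltW.
  by apply: le_trans hB; rewrite mulr_ge0 // ltW.
have cV : c ^+ 2 * W ^+ 2 <= c * (n * (n * y)).
  have h : c * (c * W ^+ 2) <= c * (c * (n * V)) by rewrite !ler_wpM2l.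
  by rewrite hT (mulrCA n c V) [c ^+ 2]expr2 -mulrA.
have : n ^+ 2 * x ^+ 2 <= n ^+ 2 * y.
  rewrite -exprMn (le_trans nx2) // exprMn (le_trans cV) //.
  have -> : c * (n * (n * y)) = c * (n ^+ 2 * y) by ring.
  by rewrite ler_piMl // mulr_ge0 // sqr_ge0.
by rewrite ler_pM2l // exprn_gt0.
Qed.

Definition euler_poly (m : nat) : {poly C} := (1 - (m.+1%:R^-1)%:C *: p) ^+ m.+1.

Lemma horner_euler_poly m z : (euler_poly m).[z] = euler (- p.[z]) m.
Proof.
rewrite /euler_poly /euler horner_exp hornerD hornerN hornerZ -polyC1 hornerC.
by rewrite mulrN.
Qed.

(** By Parseval and the coefficientwise domination, the norm is at most [2 pi] times the majorant
    polynomial at 1, that is [(1 + e / (m + 1))^(m + 1) <= exp e] for the energy [e]. *)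
Lemma N2_euler_poly m : p`_0 = 0 ->
  N2 (fun t => (euler_poly m).[cis t]) <=
    2 * pi * expR (\sum_(j < size p) j%:R * absc p`_j ^+ 2).
Proof.
move=> p0; set s : R := m.+1%:R^-1; set T := (1 + s *: lm_weight) ^+ m.+1.
have s0 : 0 <= s by rewrite invr_ge0.
have s1 : m.+1%:R * s <= 1 by rewrite divff.
have M := leq_maxl (size (euler_poly m)) (size T).
rewrite (N2_poly_widen M) ler_pM2l ?twopi_gt0 //.
apply: (@le_trans _ _ (\sum_(k < maxn (size (euler_poly m)) (size T)) T`_k)).
  by apply: ler_sum => k _; exact: lebedev_milin_coef.
have -> : \sum_(k < maxn (size (euler_poly m)) (size T)) T`_k = T.[1].
  rewrite (@horner_coef_wide _ (maxn (size (euler_poly m)) (size T))) ?leq_maxr //.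
  by apply: eq_bigr => k _; rewrite expr1n mulr1.
have -> : T.[1] = (1 + s * \sum_(j < size p) j%:R * absc p`_j ^+ 2) ^+ m.+1.
  rewrite horner_exp hornerD hornerZ -polyC1 hornerC horner_poly.
  by under eq_bigr do rewrite expr1n mulr1.
rewrite -(expR_div _ m) lerXn2r ?nnegrE ?expR_ge0 ?expR_ge1Dx //.
rewrite addr_ge0 // mulr_ge0 // sumr_ge0 // => j _.
by rewrite mulr_ge0 // sqr_ge0.
Qed.

End ExponentialApproximation.

(** * The relation [exp X * conj Phi = Theta] has only the zero solution *)

Section ScalarFactorization.
Variable R : realType.
Local Notation C := R[i].
Local Notation mu := (@lebesgue_measure R).
Local Notation period := (@period R).

Lemma cmeas_cexp (X : R -> C) : cmeas X -> cmeas (fun t => cexp (X t)).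
Proof.
move=> [m1 m2]; apply: cmeasM; split => /=.
- exact: (rmeas_comp m1 (@continuous_expR R)).
- exact: rmeas_cst.
- exact: (rmeas_comp m2 (@continuous_cos R)).
- exact: (rmeas_comp m2 (@continuous_sin R)).
Qed.

Lemma cexp_lim (z : nat -> C) (w : C) : tends0 (fun k => absc (z k - w)) ->
  tends0 (fun k => absc (cexp (z k) - cexp w)).
Proof.
move=> tz; have i2 : 0 < 2^-1 :> R by rewrite invr_gt0.
have [M HM] := tz _ i2.
(* For [|v| <= 1/2] one has [16 |v|^2 + |v| <= 9 |v|]. *)
have T := tends0Z (expR_ge0 (complex.Re w)) (tends0Z (_ : 0 <= 9) tz).
have {T} /(tends0_shift M) T : tends0 (fun k => expR (complex.Re w) * (9 * absc (z k - w))).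
  exact: T.
have T' : tends0 (fun m => absc (cexp (z (m + M)%N) - cexp w)).
  apply: tends0_le T => m; set v := z (m + M)%N - w.
  have v2 : absc v <= 2^-1 by apply: HM; exact: leq_addl.
  have -> : cexp (z (m + M)%N) - cexp w = cexp w * ((cexp v - 1 - v) + v).
    have -> : z (m + M)%N = w + v by rewrite /v addrC subrK.
    by rewrite cexpD; ring.
  rewrite abscM absc_cexp ler_wpM2l ?expR_ge0 // (le_trans (abscD _ _)) //.
  have h := cexp_approx v2; have v0 := absc_ge0 v.
  by nra.
move=> e e0; have [N HN] := T' e e0; exists (N + M)%N => m Nm.
have -> : m = ((m - M) + M)%N by lia.
by apply: HN; lia.
Qed.

Variables (X Phi Theta : R -> C) (E : R).
Hypothesis LX : L2 X.
Hypothesis X_imag : {ae mu, forall t, period t -> complex.Re (X t) = 0}.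
Hypothesis XE : forall N, \sum_(j < N) j%:R * absc (fc X j) ^+ 2 <= E.
Hypothesis LPhi : L2 Phi.
Hypothesis Phi_causal : causal Phi.
Hypothesis mTheta : cmeas Theta.
Hypothesis Theta_causal : causal Theta.
Hypothesis Theta0 : fc Theta 0 = 0.
Hypothesis Phi_Theta :
  {ae mu, forall t, period t -> cexp (X t) * conjc (Phi t) = Theta t}.

Let c0 := fc X 0.

Let Re_c0 : complex.Re c0 = 0.
Proof.
have := fc_imag LX X_imag 0; rewrite oppr0 -/c0 => /(congr1 (@complex.Re R)).
rewrite ReN Re_conj; lra.
Qed.

Let absc_cexp_c0 : absc (cexp c0) = 1.
Proof. by rewrite absc_cexp Re_c0 expR0. Qed.

Let S N t := c0 + (pos_part X N).[cis t] - conjc (pos_part X N).[cis t].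

Let absc_cexp_S N t : absc (cexp (S N t)) = 1.
Proof. by rewrite absc_cexp /S ReD ReD ReN Re_conj Re_c0 add0r subrr expR0. Qed.

Let mS N : cmeas (S N).
Proof.
apply: cmeasB; last by apply: cmeas_conj; exact: cmeas_poly.
by apply: cmeasD; [exact: cmeas_cst | exact: cmeas_poly].
Qed.

Let Dlt N t := cexp (X t) - cexp (S N t).

Let mDlt N : cmeas (Dlt N).
Proof. by apply: cmeasB; apply: cmeas_cexp => //; case: LX. Qed.

Let absc_cexp_X : {ae mu, forall t, period t -> absc (cexp (X t)) = 1}.
Proof. by apply: aeS X_imag => t H Dt; rewrite absc_cexp H // expR0. Qed.

Let Dlt2 N : {ae mu, forall t, period t -> absc (Dlt N t) <= 2}.
Proof.
apply: aeS absc_cexp_X => t H Dt; apply: le_trans (abscB _ _) _.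
by rewrite H // absc_cexp_S.
Qed.

Let LPD N : L2 (fun t => Phi t * Dlt N t).
Proof. exact: L2Mb LPhi (mDlt N) (Dlt2 N). Qed.

Let PD_lim : tends0 (fun k => N2 (fun t => Phi t * Dlt (4 ^ k) t)).
Proof.
(* [rint_dct] asks for a majorant at every point, while [|Dlt| <= 2] holds only almost everywhere;
   the truncation at 2 alters a null set only. *)
pose D' k t := Num.min (absc (Dlt (4 ^ k) t)) 2.
have D'0 k t : 0 <= D' k t by rewrite le_min absc_ge0 /=.
have mD' k : rmeas (D' k).
  by apply: measurable_minr; [exact: rmeas_absc | exact: rmeas_cst].
have iP : rintegrable (fun t => 4 * absc (Phi t) ^+ 2) by apply: rintegrableZ; case: LPhi.
have sq (r : R) : 0 <= r <= 2 -> r ^+ 2 <= 4.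
  by move=> /andP[r0 r2]; nra.
have H : tends0 (fun k => rint (fun t => absc (Phi t) ^+ 2 * D' k t ^+ 2)).
  apply: cvg_tends0; apply: (rint_dct _ _ iP).
  - move=> k; apply: rmeasM; first by apply: rmeas_sqr_absc; case: LPhi.
    by under eq_fun do rewrite expr2; exact: rmeasM.
  - apply: aeS (imag_series_ae LX X_imag XE) => t H Dt.
    apply: tends0_cvg => [k|]; first by rewrite mulr_ge0 ?sqr_ge0.
    apply: tends0Z; first exact: sqr_ge0.
    apply: (@tends0_le _ _ (fun k => 2 * absc (Dlt (4 ^ k) t))).
      move=> k; have : D' k t <= absc (Dlt (4 ^ k) t) by rewrite ge_min lexx.
      have : D' k t <= 2 by rewrite ge_min lexx orbT.
      by have := D'0 k t; nra.
    apply: tends0Z => //; apply: tends0_le (cexp_lim (H Dt)) => k.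
    by rewrite absc_dist.
  - move=> k t _.
    have d0 : 0 <= absc (Phi t) ^+ 2 * D' k t ^+ 2 := mulr_ge0 (sqr_ge0 _) (sqr_ge0 _).
    rewrite (ger0_norm d0) mulrC ler_wpM2r ?sqr_ge0 //.
    by apply: sq; rewrite D'0 /= ge_min lexx orbT.
apply: tends0_le H => k; rewrite le_eqVlt; apply/orP; left; apply/eqP.
apply: rint_eq_ae.
- by apply: rmeas_sqr_absc; case: (LPD (4 ^ k)).
- apply: rmeasM; first by apply: rmeas_sqr_absc; case: LPhi.
  by under eq_fun do rewrite expr2; exact: rmeasM.
- apply: aeS (Dlt2 (4 ^ k)) => t H Dt.
  by rewrite abscM exprMn /D' (min_idPl _) ?H.
Qed.

Let poly0 N : (pos_part X N)`_0 = 0.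
Proof. by rewrite coef_pos_part. Qed.

Let b N m := euler_poly (pos_part X N) m.

Let b0 N m : (b N m)`_0 = 1.
Proof.
by rewrite -horner_coef0 horner_euler_poly horner_coef0 poly0 /euler oppr0 mulr0 addr0 expr1n.
Qed.

Let N2b N m : N2 (fun t => (b N m).[cis t]) <= 2 * pi * expR E.
Proof.
apply: le_trans (N2_euler_poly m (poly0 N)) _.
rewrite ler_pM2l ?twopi_gt0 // ler_expR; apply: le_trans (XE N).
have sN : (size (pos_part X N) <= N)%N by exact: size_poly.
rewrite (big_ord_widen N (fun j => j%:R * absc (pos_part X N)`_j ^+ 2) sN).
rewrite big_mkcond; apply: ler_sum => j _.
case: ltnP => _; last by rewrite mulr_ge0 // sqr_ge0.
rewrite ler_wpM2l // coef_pos_part; case: ifP => // _.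
by rewrite absc0 expr0n sqr_ge0.
Qed.

Let be N t := cexp (- (pos_part X N).[cis t]).

(** For fixed [N] the polynomial [pos_part X N] is bounded by some [K] on the circle, so the Euler
    approximations are all bounded by [exp K]. No uniformity in [N] is claimed. *)
Let b_lim N : tends0 (fun m => rint (fun t => absc (Phi t) * absc ((b N m).[cis t] - be N t))).
Proof.
have [K HK] := poly_bounded (pos_part X N).
have iP : rintegrable (fun t => (expR K + expR K) * absc (Phi t)).
  by apply: rintegrableZ; case: (L2_cintegrable LPhi).
have mbe : cmeas (be N).
  by apply: cmeas_cexp; apply: cmeasN; exact: cmeas_poly.
apply: cvg_tends0; apply: (rint_dct _ _ iP).
- move=> m; apply: rmeasM; first by apply: rmeas_absc; case: LPhi.
  by apply: rmeas_absc; apply: cmeasB => //; exact: cmeas_poly.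
- apply: aeW => t _; apply: tends0_cvg => [k|]; first by rewrite mulr_ge0 ?absc_ge0.
  apply: tends0Z; first exact: absc_ge0.
  by apply: tends0_le (euler_lim (- (pos_part X N).[cis t])) => m; rewrite horner_euler_poly.
- move=> m t _; rewrite ger0_norm ?mulr_ge0 ?absc_ge0 // mulrC ler_wpM2r ?absc_ge0 //.
  apply: le_trans (abscB _ _) _; rewrite lerD //.
    by rewrite horner_euler_poly (le_trans (absc_euler _ _)) // ler_expR abscN.
  rewrite absc_cexp ler_expR ReN (le_trans _ (HK t)) //.
  by rewrite (le_trans _ (Re_le_absc _)) // -normrN ler_norm.
Qed.

(* With [p] the positive part of the [N]-th partial sum of [X], the [-n]-th
   coefficient of [Theta exp (-p) - exp c0 conj (Phi exp (-p))] is
   [- exp c0 conj (fc Phi n)], while pointwise this function has modulus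
   [|Phi| |exp X - exp (S N)| |exp (-p)|]. The polynomials [b N m] tend to
   [exp (-p)], and their L2 norm is bounded independently of [N] and [m]. *)
Let bound n N m : (forall k : nat, (k < n)%N -> fc Phi k = 0) ->
  2 * pi * absc (fc Phi n) <= rint (fun t => absc (Phi t * Dlt N t * (b N m).[cis t]))
    + 2 * rint (fun t => absc (Phi t) * absc ((b N m).[cis t] - be N t)).
Proof.
move=> Phi_lt; have iPhi := L2_cintegrable LPhi.
have p0 := @twopi_gt0 R.
have LPb : L2 (fun t => Phi t * (b N m).[cis t]).
  have [K HK] := poly_bounded (b N m).
  by apply: (L2Mb (K := K)) => //; [exact: cmeas_poly | apply: aeW => t _].
have iPb := L2_cintegrable LPb; have iPbc := cintegrable_conj iPb.
have iTh : cintegrable Theta.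
  apply: (cintegrable_le_ae mTheta _ iPhi.2).
  apply: aeS (aeI absc_cexp_X Phi_Theta) => t [h1 h2] Dt.
  by rewrite -h2 // abscM h1 // mul1r absc_conj.
pose G t := cexp c0 * conjc (Phi t * (b N m).[cis t]).
have iG : cintegrable G by exact: cintegrableZ.
pose H t := Theta t * (b N m).[cis t].
have iH : cintegrable H.
  have [K HK] := poly_bounded (b N m).
  by apply: (cintegrableMb (K := K)) => //; exact: cmeas_poly.
(* For [n > 0] the index is negative and causality suffices; for [n = 0] the mean value is meant,
   which is why [Theta0] is assumed. *)
have fH : fc H (- n%:Z) = 0.
  case: n Phi_lt => [|n] _.
    by rewrite oppr0 fc_mul_poly_causal // /cauchy big_ord_recl big_ord0 /= Theta0 mulr0 addr0.
  have -> : - n.+1%:Z = Negz n by lia.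
  exact: causal_mul_poly.
have fG : fc G (- n%:Z) = cexp c0 * conjc (fc Phi n).
  rewrite fcZ // fc_conj // opprK fc_mul_poly_causal // /cauchy big_ord_recl /= b0 mul1r subn0.
  rewrite big1 ?addr0 // => i _; rewrite Phi_lt ?mulr0 //.
  by rewrite /bump leq0n add1n; have := ltn_ord i; lia.
have -> : absc (fc Phi n) = absc (fc (fun t => H t - G t) (- n%:Z)).
  by rewrite fcB // fH fG sub0r abscN abscM absc_cexp_c0 mul1r absc_conj.
rewrite -ler_pdivlMl //; apply: le_trans (absc_fc _ (cintegrableB iH iG)) _.
rewrite ler_pM2l ?invr_gt0 //.
have LB := L2_poly (b N m).
have i1 := L2M_cintegrable (LPD N) LB.
have mbe : cmeas (be N).
  by apply: cmeas_cexp; apply: cmeasN; exact: cmeas_poly.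
have i2 : rintegrable (fun t => absc (Phi t) * absc ((b N m).[cis t] - be N t)).
  have Lbe : L2 (be N).
    have [K HK] := poly_bounded (pos_part X N).
    apply: (@L2_bounded _ _ (expR K)) => //; apply: aeW => t _.
    rewrite absc_cexp ler_expR ReN (le_trans _ (HK t)) //.
    by rewrite (le_trans _ (Re_le_absc _)) // -normrN ler_norm.
  have [_] := L2M_cintegrable LPhi (L2B LB Lbe).
  by under eq_fun do rewrite abscM.
rewrite -rintZ // -rintD; [|exact: i1.2|exact: rintegrableZ].
apply: rint_le_ae.
- by case: (cintegrableB iH iG).
- by apply: rintegrableD; [exact: i1.2 | exact: rintegrableZ].
apply: aeS Phi_Theta => t h Dt; rewrite /H /G -(h Dt) conjcM.
set B := (b N m).[cis t]; set P := Phi t; set be' := be N t.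
(* As [S N = c0 + p - conj p], the exact exponential [exp (-p)] makes the two main terms cancel, and
   only [B - be'] survives. *)
have Se : cexp (S N t) * be' = cexp c0 * conjc be'.
  rewrite /S /be' /be -cexp_conj -!cexpD conjcN; congr cexp; ring.
have -> : cexp (X t) * conjc P * B - cexp c0 * (conjc P * conjc B) =
  conjc P * (Dlt N t * B) + conjc P * (cexp (S N t) * (B - be') - cexp c0 * conjc (B - be')).
  rewrite /Dlt conjcB !mulrBr mulrBl Se; ring.
apply: le_trans (abscD _ _) _; rewrite lerD //.
  by rewrite !abscM absc_conj mulrA.
rewrite abscM absc_conj mulrCA ler_wpM2l ?absc_ge0 // (le_trans (abscB _ _)) //.
by rewrite (abscM (cexp (S N t))) (abscM (cexp c0)) absc_cexp_S absc_cexp_c0 !mul1r absc_conj mulr2n mulrDl mul1r.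
Qed.

(** Strong induction on [n]: since [b N m] has constant term 1, once the earlier coefficients vanish
    the product with [Phi] has [n]-th coefficient exactly [fc Phi n]. For each [k] the order [M] of
    the Euler approximation is chosen after [N = 4^k]; then [k] grows, with [PD_lim] as the
    vanishing factor and [N2b] as the bounded one. *)
Lemma scalar_factorization_fc0 (n : nat) : fc Phi n = 0.
Proof.
elim/ltn_ind: n => n IH; apply/eqP; rewrite -absc_eq0 eq_le absc_ge0 andbT.
have p0 := @twopi_gt0 R.
rewrite -(pmulr_rle0 _ p0); apply: tends0_ge0.
have a0 : 0 <= 2 * pi * expR E by rewrite mulr_ge0 ?expR_ge0 // ltW.
apply: (young_tends0 a0 (fun k => N2_ge0 _) _ PD_lim) => lam k l0.
apply/ler_addgt0Pr => e e0; have e2 : 0 < e / 2 by rewrite divr_gt0.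
have [M HM] := @b_lim (4 ^ k) (e / 2) e2.
apply: le_trans (@bound n (4 ^ k) M IH) _; rewrite lerD //; last first.
  by have := HM M (leqnn M); lra.
have li : 0 < lam^-1 by rewrite invr_gt0.
have [_ h] := L2_young li (LPD (4 ^ k)) (L2_poly (b (4 ^ k) M)).
apply: le_trans h _; rewrite invrK addrC lerD2r.
by apply: ler_wpM2l (N2b _ _); exact: ltW.
Qed.

End ScalarFactorization.

(** * Goursat's theorem on rectangles in the left half plane *)

Section Goursat.
Variable R : realType.
Local Notation mu := (@lebesgue_measure R).

Definition itvint (f : R -> R) (a b : R) : R := (\int[mu]_(x in `[a, b]) f x)%R.

Lemma itv_integrable (f : R -> R) a b :
  (forall x, a <= x <= b -> {for x, continuous f}) ->
  mu.-integrable `[a, b] (EFin \o f).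
Proof.
move=> cf; apply: continuous_compact_integrable; first exact: segment_compact.
apply: continuous_in_subspaceT => x; rewrite inE /= in_itv /=; exact: cf.
Qed.

Lemma itvint_split (f : R -> R) a m b : a <= m <= b ->
  (forall x, a <= x <= b -> {for x, continuous f}) ->
  itvint f a b = itvint f a m + itvint f m b.
Proof.
move=> /andP[am mb] cf; have iab := itv_integrable cf.
have := @Rintegral_itvB R f (BLeft a) (BRight b) m iab.
rewrite !bnd_simp => /(_ am mb) E.
rewrite /itvint -(@Rintegral_itv_obnd_cbnd _ m (BRight b)); last first.
  by apply: integrableS iab => //; apply: subset_itvr; rewrite bnd_simp.
by rewrite -E addrC subrK.
Qed.

Lemma itvint_approx (f : R -> R) a b (k K : R) : a <= b ->
  (forall x, a <= x <= b -> {for x, continuous f}) ->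
  (forall x, a <= x <= b -> `|f x - k| <= K) ->
  `|itvint f a b - k * (b - a)| <= K * (b - a).
Proof.
move=> ab cf fK; have iab := itv_integrable cf.
have cst c : mu.-integrable `[a, b] (EFin \o (fun=> c)).
  by apply: itv_integrable => x _; exact: cst_continuous.
have vol c : (\int[mu]_(x in `[a, b]) (fun=> c) x)%R = c * (b - a).
  rewrite Rintegral_cst //= lebesgue_measure_itv /= lte_fin; have [ab'|ba|->] := ltgtP a b => //=.
    by rewrite leNgt ba in ab.
  by rewrite subrr !mulr0.
rewrite ler_norml lerBrDl addrC -mulNr -mulrDl lerBlDl -mulrDl -!vol.
by apply/andP; split; apply: le_Rintegral => // x; rewrite /= in_itv /= => /fK;
  rewrite ler_norml; lra.
Qed.

Variables P Q : R -> R -> R.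

(* The 1-form P dx + Q dy is differentiable at (x0, y0), and closed there. *)
Definition closed_at (x0 y0 : R) := exists p1 p2 q2 : R, forall e : R, 0 < e ->
  exists2 d : R, 0 < d & forall x y, `|x - x0| < d -> `|y - y0| < d ->
    `|P x y - (P x0 y0 + p1 * (x - x0) + p2 * (y - y0))|
      <= e * (`|x - x0| + `|y - y0|) /\
    `|Q x y - (Q x0 y0 + p2 * (x - x0) + q2 * (y - y0))|
      <= e * (`|x - x0| + `|y - y0|).

Hypothesis PQ : forall x y, x < 0 -> closed_at x y.

Lemma closed_at_cvg (f : R -> R) (x0 k : R) :
  (forall e : R, 0 < e -> exists2 d : R, 0 < d &
    forall x, `|x - x0| < d -> `|f x - (f x0 + k * (x - x0))| <= e * `|x - x0|) ->
  {for x0, continuous f}.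
Proof.
move=> H; have [d d0 Hd] := H 1 ltr01.
apply/cvgrPdist_le => e e0; have k1 : 0 < 1 + `|k| by rewrite ltr_wpDr.
have m0 : 0 < Num.min d (e / (1 + `|k|)) by rewrite lt_min d0 divr_gt0.
near=> x.
have : `|x0 - x| < Num.min d (e / (1 + `|k|)).
  by near: x; apply: (@cvgr_dist_lt _ _ _ (nbhs x0) _ id x0) => //; exact: cvg_id.
rewrite lt_min distrC => /andP[xd xe].
rewrite distrC; have := Hd x xd; rewrite mul1r => h.
have -> : f x - f x0 = (f x - (f x0 + k * (x - x0))) + k * (x - x0) by ring.
apply: le_trans (ler_normD _ _) _; rewrite normrM.
apply: (@le_trans _ _ ((1 + `|k|) * `|x - x0|)); first by rewrite mulrDl mul1r lerD2r.
by rewrite mulrC -ler_pdivlMr // ltW.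
Unshelve. all: by end_near.
Qed.

Lemma closed_at_cont (x0 y0 : R) : closed_at x0 y0 ->
  [/\ {for x0, continuous (fun x => P x y0)} & {for y0, continuous (fun y => Q x0 y)}].
Proof.
move=> [p1 [p2 [q2 H]]]; split.
  apply: (@closed_at_cvg _ _ p1) => e e0; have [d d0 Hd] := H e e0; exists d => // x xd.
  have zz : `|y0 - y0| < d by rewrite subrr normr0.
  have [+ _] := Hd x y0 xd zz.
  by rewrite subrr normr0 mulr0 !addr0.
apply: (@closed_at_cvg _ _ q2) => e e0; have [d d0 Hd] := H e e0; exists d => // y yd.
have zz : `|x0 - x0| < d by rewrite subrr normr0.
have [_] := Hd x0 y zz yd.
by rewrite subrr normr0 mulr0 addr0 add0r.
Qed.

Lemma contP x y : x < 0 -> {for x, continuous (fun x => P x y)}.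
Proof. by move=> x0; case: (closed_at_cont (PQ y x0)). Qed.

Lemma contQ x y : x < 0 -> {for y, continuous (Q x)}.
Proof. by move=> x0; case: (closed_at_cont (PQ y x0)). Qed.

(** The counterclockwise integral of [P dx + Q dy] along the boundary of [[a, b] x [c, d]], with
    opposite sides grouped. *)
Definition loopint (a b c d : R) : R :=
  itvint (fun x => P x c - P x d) a b + itvint (fun y => Q b y - Q a y) c d.

Lemma loopint_quarters a m b c n d : a <= m <= b -> b < 0 -> c <= n <= d ->
  loopint a b c d = loopint a m c n + loopint m b c n + loopint a m n d + loopint m b n d.
Proof.
move=> amb b0 cnd; have /andP[am mb] := amb; have /andP[cn nd] := cnd.
have cP u v x : x <= b -> {for x, continuous (fun x => P x u - P x v)}.
  by move=> xb; apply: cvgB; apply: contP; exact: le_lt_trans b0.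
have cQ u v y : u <= b -> v <= b -> {for y, continuous (fun y => Q u y - Q v y)}.
  by move=> ub vb; apply: cvgB; apply: contQ; exact: le_lt_trans b0.
have iB (f g : R -> R) u v : (forall x, u <= x <= v -> {for x, continuous f}) ->
    (forall x, u <= x <= v -> {for x, continuous g}) ->
    itvint (fun x => f x - g x) u v = itvint f u v - itvint g u v.
  by move=> cf cg; rewrite /itvint RintegralB //; exact: itv_integrable.
have cP' u x : x <= b -> {for x, continuous (fun x => P x u)}.
  by move=> xb; apply: contP; exact: le_lt_trans b0.
have cQ' u y : u <= b -> {for y, continuous (Q u)}.
  by move=> ub; apply: contQ; exact: le_lt_trans b0.
have ab := le_trans am mb.
rewrite /loopint (@itvint_split _ a m b) //; last by move=> x /andP[_ ?]; exact: cP.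
rewrite (@itvint_split (fun y => Q b y - Q a y) c n d) //; last by move=> y _; exact: cQ.
rewrite !iB; try by move=> x /andP[_ xb]; apply: cP'; rewrite ?(le_trans xb).
all: try by move=> y _; apply: cQ'.
ring.
Qed.

(** The affine parts contribute [- p2 (d - c) (b - a)] and [p2 (b - a) (d - c)], which cancel
    because closedness provides the same [p2] for [P] and [Q]. Each pair of opposite sides evaluates
    the remainder twice, whence [e / 2]. *)
Lemma loopint_small x0 y0 (e : R) : x0 < 0 -> 0 < e -> exists2 dl : R, 0 < dl &
  forall a b c d, a <= x0 <= b -> b < 0 -> c <= y0 <= d ->
    (b - a) + (d - c) < dl ->
    `|loopint a b c d| <= e * ((b - a) + (d - c)) ^+ 2.
Proof.
move=> xlt e0; have [p1 [p2 [q2 H]]] := PQ y0 xlt.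
have e2 : 0 < e / 2 by rewrite divr_gt0.
have [dl dl0 Hd] := H _ e2; exists dl => // a b c d /andP[ax xb] b0 /andP[cy yd] small.
have near_ x y : a <= x <= b -> c <= y <= d -> [/\ `|x - x0| < dl, `|y - y0| < dl &
   `|x - x0| + `|y - y0| <= (b - a) + (d - c)].
  move=> /andP[a1 a2] /andP[a3 a4].
  have h1 : `|x - x0| <= b - a by rewrite ler_norml; lra.
  have h2 : `|y - y0| <= d - c by rewrite ler_norml; lra.
  by split; lra.
set L := (b - a) + (d - c) in small *.
have cyd : c <= d := le_trans cy yd; have axb : a <= b := le_trans ax xb.
have HP x y : a <= x <= b -> c <= y <= d ->
   `|P x y - (P x0 y0 + p1 * (x - x0) + p2 * (y - y0))| <= e / 2 * L /\
   `|Q x y - (Q x0 y0 + p2 * (x - x0) + q2 * (y - y0))| <= e / 2 * L.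
  move=> hx hy; have [n1 n2 n3] := near_ x y hx hy; have [h1 h2] := Hd x y n1 n2.
  by split; [apply: le_trans h1 _ | apply: le_trans h2 _]; rewrite ler_wpM2l // ltW.
have cc : c <= c <= d by rewrite lexx cyd.
have dd : c <= d <= d by rewrite lexx cyd.
have aa : a <= a <= b by rewrite lexx axb.
have bb : a <= b <= b by rewrite lexx axb.
have IP : `|itvint (fun x => P x c - P x d) a b - (- p2 * (d - c)) * (b - a)| <= e * L * (b - a).
  apply: itvint_approx => //.
    move=> x /andP[_ xb']; apply: cvgB; apply: contP; exact: le_lt_trans b0.
  move=> x hx; have [h1 _] := HP x c hx cc; have [h2 _] := HP x d hx dd.
  by move: h1 h2; rewrite !ler_norml; lra.
have IQ : `|itvint (fun y => Q b y - Q a y) c d - (p2 * (b - a)) * (d - c)| <= e * L * (d - c).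
  apply: itvint_approx => //.
    by move=> y _; apply: cvgB; apply: contQ => //; exact: le_lt_trans b0.
  move=> y hy; have [_ h1] := HP b y bb hy; have [_ h2] := HP a y aa hy.
  by move: h1 h2; rewrite !ler_norml; lra.
have : e * L ^+ 2 = e * L * (b - a) + e * L * (d - c) by rewrite /L; ring.
by move: IP IQ; rewrite !ler_norml /loopint; lra.
Qed.

(** Goursat's bisection: the right-hand side is divided by 4 under halving, so a failure is
    inherited by one of the four quarters. The nested rectangles shrink to a point, where
    [loopint_small] contradicts the failure. *)
Lemma loopint_le (e a b c d : R) : 0 < e -> a <= b -> b < 0 -> c <= d ->
  `|loopint a b c d| <= e * ((b - a) + (d - c)) ^+ 2.
Proof.
move=> e0 ab b0 cd; apply: contrapT => bad0.
pose w k := (b - a) / 2 ^+ k; pose h k := (d - c) / 2 ^+ k.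
have w0 k : 0 <= w k by rewrite divr_ge0 ?subr_ge0 ?exprn_ge0.
have h0 k : 0 <= h k by rewrite divr_ge0 ?subr_ge0 ?exprn_ge0.
have wS k : w k = w k.+1 + w k.+1.
  by rewrite /w exprS; field; rewrite expf_neq0 // pnatr_eq0.
have hS k : h k = h k.+1 + h k.+1.
  by rewrite /h exprS; field; rewrite expf_neq0 // pnatr_eq0.
pose bad k (z : R * R) := z.1 + w k <= b /\
  ~ (`|loopint z.1 (z.1 + w k) z.2 (z.2 + h k)| <= e * (w k + h k) ^+ 2).
(* The hypothesis [bad] stands under the existential so that [choice] yields a total map from
   rectangles to quarters. *)
have step (kz : nat * (R * R)) : exists z' : R * R, bad kz.1 kz.2 ->
   [/\ bad kz.1.+1 z', kz.2.1 <= z'.1 <= kz.2.1 + w kz.1.+1 &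
       kz.2.2 <= z'.2 <= kz.2.2 + h kz.1.+1].
  case: kz => k [x y] /=; have wk := w0 k.+1; have hk := h0 k.+1.
  apply: contrapT => /forallNP no.
  have good z' : x <= z'.1 <= x + w k.+1 -> y <= z'.2 <= y + h k.+1 -> bad k (x, y) ->
      `|loopint z'.1 (z'.1 + w k.+1) z'.2 (z'.2 + h k.+1)| <= e * (w k.+1 + h k.+1) ^+ 2.
    move=> hx hy bk; apply: contrapT => ng; apply: (no z') => _; split => //.
    split => //; case: bk => /= bk _; rewrite wS in bk; lra.
  have [bk] : bad k (x, y) by apply: contrapT => nb; apply: (no (x, y)).
  apply; have bxy : bad k (x, y) by apply: contrapT => nb; apply: (no (x, y)).
  rewrite /= in bk *.
  have g1 := good (x, y); have g2 := good (x + w k.+1, y).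
  have g3 := good (x, y + h k.+1); have g4 := good (x + w k.+1, y + h k.+1).
  rewrite /= in g1 g2 g3 g4.
  have {}g1 := g1 ltac:(lra) ltac:(lra) bxy. have {}g2 := g2 ltac:(lra) ltac:(lra) bxy.
  have {}g3 := g3 ltac:(lra) ltac:(lra) bxy. have {}g4 := g4 ltac:(lra) ltac:(lra) bxy.
  rewrite (@loopint_quarters x (x + w k.+1) (x + w k) y (y + h k.+1) (y + h k)); first last.
  - by rewrite (hS k); lra.
  - by apply: le_lt_trans b0.
  - by rewrite (wS k); lra.
  have ew : x + w k = x + w k.+1 + w k.+1 by rewrite (wS k) addrA.
  have eh : y + h k = y + h k.+1 + h k.+1 by rewrite (hS k) addrA.
  rewrite -ew -eh in g2 g3 g4 *; rewrite -?ew -?eh in g2 g3 g4.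
  have -> : e * (w k + h k) ^+ 2 = 4 * (e * (w k.+1 + h k.+1) ^+ 2).
    by rewrite (wS k) (hS k); ring.
  by move: g1 g2 g3 g4; rewrite !ler_norml; lra.
have [nxt Hn] := choice step.
pose z := fix z k := if k is k'.+1 then nxt (k', z k') else (a, c).
have badz k : bad k (z k).
  elim: k => [|k IH]; last by have [] := Hn (k, z k) IH.
  rewrite /bad /= /w /h !expr0 !divr1; split; first by rewrite addrC subrK.
  by rewrite (addrC a) (addrC c) !subrK.
have sz k : (z k).1 <= (z k.+1).1 <= (z k).1 + w k.+1 /\
            (z k).2 <= (z k.+1).2 <= (z k).2 + h k.+1.
  by have [] := Hn (k, z k) (badz k).
have lim (u : nat -> R) (v : nat -> R) : (forall k, 0 <= v k) ->
    (forall k, v k = v k.+1 + v k.+1) ->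
    (forall k, u k <= u k.+1 <= u k + v k.+1) ->
    exists x, forall k, u k <= x <= u k + v k.
  move=> v0 vS uS.
  have inc k j : u k <= u (k + j)%N.
    elim: j => [|j IH]; first by rewrite addn0.
    by rewrite addnS (le_trans IH) //; case/andP: (uS (k + j)%N).
  have dec k j : u (k + j)%N + v (k + j)%N <= u k + v k.
    elim: j => [|j IH]; first by rewrite addn0.
    rewrite addnS (le_trans _ IH) //; have := uS (k + j)%N; have := vS (k + j)%N; lra.
  have ub k j : u j <= u k + v k.
    have [kj|jk] := leqP k j.
      by have := dec k (j - k)%N; rewrite subnKC //; have := v0 j; lra.
    by have := inc j (k - j)%N; rewrite subnKC 1?ltnW //; have := v0 k; lra.
  have hs : has_sup (range u).
    split; first by exists (u 0%N), 0%N.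
    by exists (u 0%N + v 0%N) => _ [j _ <-].
  exists (sup (range u)) => k; apply/andP; split.
    by apply: sup_upper_bound => //; exists k.
  apply: ge_sup; first by exists (u 0%N), 0%N.
  by move=> _ [j _ <-].
have [x0 Hx] := lim (fun k => (z k).1) w w0 wS (fun k => (sz k).1).
have [y0 Hy] := lim (fun k => (z k).2) h h0 hS (fun k => (sz k).2).
have x0lt : x0 < 0.
  apply: le_lt_trans b0; have := (badz 0%N).1; have := Hx 0%N; lra.
have [dl dl0 Hd] := loopint_small y0 x0lt e0.
have [k Hk] : exists k, w k + h k < dl.
  have : tends0 (fun k => ((b - a) + (d - c)) * (2^-1) ^+ k).
    apply: tends0Z; first by rewrite addr_ge0 // subr_ge0.
    apply: cvg_tends0; apply: cvg_expr; rewrite ger0_norm ?invr_ge0 //.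
    by rewrite invf_lt1 // ltr1n.
  move=> /(_ (dl / 2) (divr_gt0 dl0 (ltr0n R 2))) [k /(_ k (leqnn k))].
  rewrite exprVn mulrDl => hk; exists k; rewrite /w /h; lra.
have [bk nb] := badz k; apply: nb.
have := Hd (z k).1 ((z k).1 + w k) (z k).2 ((z k).2 + h k) (Hx k) (le_lt_trans bk b0) (Hy k).
have e1 (u v : R) : u + v - u = v by rewrite addrC addKr.
by rewrite !e1; apply.
Qed.

Lemma loopint0 a b c d : a <= b -> b < 0 -> c <= d -> loopint a b c d = 0.
Proof.
move=> ab b0 cd; apply/eqP; rewrite -normr_eq0 eq_le normr_ge0 andbT.
set L2 := ((b - a) + (d - c)) ^+ 2.
have L0 : 0 <= L2 by exact: sqr_ge0.
apply/ler_addgt0Pr => e e0; rewrite add0r.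
have L1 : 0 < L2 + 1 by rewrite ltr_wpDl.
apply: le_trans (loopint_le (divr_gt0 e0 L1) ab b0 cd) _.
rewrite -/L2 mulrAC ler_pdivrMr // ler_wpM2l ?lerDl //; exact: ltW.
Qed.

End Goursat.

(** * Complex differentiability and integrals of periodic holomorphic functions *)

Section ComplexDifferentiability.
Variable R : realType.
Local Notation C := R[i].
Implicit Types (f g F G : C -> C) (w : C).

Definition littleo w0 (e : C -> R) := forall eps : R, 0 < eps ->
  exists2 d : R, 0 < d & forall w, absc (w - w0) < d -> e w <= eps * absc (w - w0).

Lemma littleo_le w0 (e1 e2 : C -> R) (d : R) : 0 < d ->
  (forall w, absc (w - w0) < d -> e1 w <= e2 w) -> littleo w0 e2 -> littleo w0 e1.
Proof.
move=> d0 h H eps eps0; have [d' d'0 H'] := H eps eps0.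
exists (Num.min d d'); first by rewrite lt_min d0.
by move=> w; rewrite lt_min => /andP[h1 h2]; apply: le_trans (h w h1) (H' w h2).
Qed.

Lemma littleoD w0 e1 e2 : littleo w0 e1 -> littleo w0 e2 ->
  littleo w0 (fun w => e1 w + e2 w).
Proof.
move=> H1 H2 eps eps0; have e2' : 0 < eps / 2 by rewrite divr_gt0.
have [d1 d10 h1] := H1 _ e2'; have [d2 d20 h2] := H2 _ e2'.
exists (Num.min d1 d2); first by rewrite lt_min d10.
move=> w; rewrite lt_min => /andP[w1 w2].
by apply: le_trans (lerD (h1 w w1) (h2 w w2)) _; rewrite -mulrDl -splitr.
Qed.

Lemma littleoZ w0 (c : R) e : 0 <= c -> (forall w, 0 <= e w) -> littleo w0 e ->
  littleo w0 (fun w => c * e w).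
Proof.
move=> c0 e0 H eps eps0; have c1 : 0 < c + 1 by rewrite ltr_wpDl.
have [d d0 h] := H _ (divr_gt0 eps0 c1); exists d => // w /h {}h.
apply: (@le_trans _ _ ((c + 1) * e w)); first by rewrite ler_wpM2r // lerDl.
by rewrite mulrC -ler_pdivlMr // mulrAC.
Qed.

Lemma littleo_sqr w0 (c : R) : 0 <= c -> littleo w0 (fun w => c * absc (w - w0) ^+ 2).
Proof.
move=> c0 eps eps0; have c1 : 0 < c + 1 by rewrite ltr_wpDl.
exists (eps / (c + 1)); first by rewrite divr_gt0.
move=> w; rewrite ltr_pdivlMr // => h; have := absc_ge0 (w - w0).
by set a := absc _ in h *; move=> a0; rewrite expr2 mulrA ler_wpM2r //; nra.
Qed.

Definition cderiv F w0 (D : C) :=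
  littleo w0 (fun w => absc (F w - F w0 - D * (w - w0))).

Definition cdiff F w0 := exists D, cderiv F w0 D.

Lemma cdiff_lip F w0 : cdiff F w0 -> exists L d : R, [/\ 0 < L, 0 < d &
  forall w, absc (w - w0) < d -> absc (F w - F w0) <= L * absc (w - w0)].
Proof.
move=> [D HD]; have [d d0 h] := HD 1 ltr01; exists (1 + absc D), d; split => //.
  by rewrite ltr_wpDr ?absc_ge0.
move=> w /h {}h; have -> : F w - F w0 = (F w - F w0 - D * (w - w0)) + D * (w - w0).
  by rewrite subrK.
by apply: le_trans (abscD _ _) _; rewrite abscM mulrDl lerD.
Qed.

Lemma cdiff_comp F G w0 : cdiff G w0 -> cdiff F (G w0) -> cdiff (F \o G) w0.
Proof.
move=> cG [Df Hf]; have [L [d [L0 d0 lip]]] := cdiff_lip cG.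
case: cG => Dg Hg; exists (Df * Dg).
have o1 := littleoZ (absc_ge0 Df) (fun w => absc_ge0 _) Hg.
have o2 : littleo w0 (fun w => absc (F (G w) - F (G w0) - Df * (G w - G w0))).
  move=> eps eps0; have [d' d'0 h'] := Hf _ (divr_gt0 eps0 L0).
  exists (Num.min d (d' / L)); first by rewrite lt_min d0 divr_gt0.
  move=> w; rewrite lt_min => /andP[/lip h1 h2].
  have h3 : absc (G w - G w0) < d'.
    by apply: le_lt_trans h1 _; rewrite mulrC -ltr_pdivlMr.
  apply: le_trans (h' _ h3) _; rewrite mulrAC ler_pdivrMr //.
  by rewrite -mulrA; apply: ler_wpM2l; [exact: ltW | rewrite mulrC].
apply: littleo_le (@ltr01 R) _ (littleoD o2 o1) => w _ /=.
have -> : F (G w) - F (G w0) - Df * Dg * (w - w0) =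
  (F (G w) - F (G w0) - Df * (G w - G w0)) + Df * (G w - G w0 - Dg * (w - w0)) by ring.
by apply: le_trans (abscD _ _) _; rewrite abscM.
Qed.

Lemma cdiffM F G w0 : cdiff F w0 -> cdiff G w0 -> cdiff (fun w => F w * G w) w0.
Proof.
move=> cF cG; have [L [d [L0 d0 lip]]] := cdiff_lip cF.
have [L' [d' [L'0 d'0 lip']]] := cdiff_lip cG.
case: cF cG => [D HD] [D' HD']; exists (D * G w0 + F w0 * D').
have o1 := littleoZ (absc_ge0 (G w0)) (fun w => absc_ge0 _) HD.
have o2 := littleoZ (absc_ge0 (F w0)) (fun w => absc_ge0 _) HD'.
have LL : 0 <= L * L' by rewrite mulr_ge0 // ltW.
have o3 := @littleo_sqr w0 _ LL.
have m0 : 0 < Num.min d d' by rewrite lt_min d0.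
apply: littleo_le m0 _ (littleoD (littleoD o1 o2) o3) => w.
rewrite lt_min => /andP[/lip h1 /lip' h2].
have -> : F w * G w - F w0 * G w0 - (D * G w0 + F w0 * D') * (w - w0) =
  G w0 * (F w - F w0 - D * (w - w0)) + F w0 * (G w - G w0 - D' * (w - w0))
  + (F w - F w0) * (G w - G w0) by ring.
apply: le_trans (abscD _ _) _; rewrite lerD //.
  by apply: le_trans (abscD _ _) _; rewrite !abscM.
rewrite abscM expr2 mulrACA; apply: ler_pM => //; exact: absc_ge0.
Qed.

Lemma cdiff_cst (c : C) w0 : cdiff (fun=> c) w0.
Proof.
exists 0 => eps eps0; exists 1 => // w _; rewrite subrr mul0r subrr absc0.
by rewrite mulr_ge0 ?absc_ge0 // ltW.
Qed.

Lemma cdiff_id w0 : cdiff id w0.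
Proof.
exists 1 => eps eps0; exists 1 => // w _; rewrite mul1r subrr absc0.
by rewrite mulr_ge0 ?absc_ge0 // ltW.
Qed.

Lemma cdiff_cexp w0 : cdiff (@cexp R) w0.
Proof.
exists (cexp w0); have e0 := expR_ge0 (complex.Re w0).
have c0 : 0 <= expR (complex.Re w0) * 16 by rewrite mulr_ge0.
have d0 : 0 < 2^-1 :> R by rewrite invr_gt0.
apply: (littleo_le d0 _ (littleo_sqr w0 c0)) => w wd.
have -> : cexp w - cexp w0 - cexp w0 * (w - w0) =
  cexp w0 * (cexp (w - w0) - 1 - (w - w0)).
  by have -> : cexp w = cexp w0 * cexp (w - w0); [rewrite -cexpD addrC subrK | ring].
by rewrite abscM absc_cexp -mulrA ler_wpM2l // cexp_approx // ltW.
Qed.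

Lemma cdiff_derivable f z : derivable (f : C^o -> C^o) z 1 -> cdiff f z.
Proof.
move=> /cvg_ex[D HD]; exists D => eps eps0.
have epsC : 0 < eps%:C :> C by rewrite ltcR.
move/cvgrPdist_le : HD => /(_ _ epsC) /nbhs_ballP[d /= d0 H].
have dE : d = (complex.Re d)%:C by rewrite RRe_real // realE ltW.
exists (complex.Re d); first by rewrite -ltcR -dE.
move=> w wd; have [->|wz] := eqVneq w z.
  by rewrite !subrr mulr0 subrr absc0 mulr0.
have wz0 : w - z != 0 by rewrite subr_eq0.
have := H (w - z); rewrite /ball /= sub0r normrN abscE dE ltcR => /(_ wd wz0).
rewrite abscE lecR /= /GRing.scale /= mulr1 subrK => h.
have -> : f w - f z - D * (w - z) = - ((D - (w - z)^-1 * (f w - f z)) * (w - z)).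
  by rewrite mulrBl mulrAC mulVf // mul1r opprB.
by rewrite abscN abscM ler_wpM2r ?absc_ge0.
Qed.

Lemma cderiv_Re F (t0 : R) (D : C) : cderiv F t0%:C D ->
  {for t0, continuous (fun t : R => complex.Re (F t%:C))}.
Proof.
move=> H; apply: (@closed_at_cvg _ _ _ (complex.Re D)) => e e0.
have [d d0 h] := H e e0; exists d => // t td.
have := h t%:C; rewrite -rmorphB absc_real => /(_ td); apply: le_trans.
apply: le_trans (Re_le_absc _).
by rewrite !ReIm /= mulr0 subr0 opprD addrA.
Qed.

Lemma cderiv_Im F (t0 : R) (D : C) : cderiv F t0%:C D ->
  {for t0, continuous (fun t : R => complex.Im (F t%:C))}.
Proof.
move=> H; apply: (@closed_at_cvg _ _ _ (complex.Im D)) => e e0.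
have [d d0 h] := H e e0; exists d => // t td.
have := h t%:C; rewrite -rmorphB absc_real => /(_ td); apply: le_trans.
apply: le_trans (Im_le_absc _).
by rewrite !ReIm /= mulr0 add0r opprD addrA.
Qed.

Lemma L2_continuous (F : R -> C) : continuous (fun t : R => complex.Re (F t)) ->
  continuous (fun t : R => complex.Im (F t)) -> L2 F.
Proof.
move=> c1 c2; split; first by split; apply: rmeas_continuous.
have -> : (fun t => absc (F t) ^+ 2) = (fun t : R => complex.Re (F t) * complex.Re (F t)
    + complex.Im (F t) * complex.Im (F t)).
  by apply/funext => t; rewrite absc_sqr !expr2.
apply: itv_integrable => t _.
by apply: cvgD; apply: cvgM; (exact: c1 || exact: c2).
Qed.

(** Cauchy's theorem on the rectangle of height [2 pi] between the two vertical segments; the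
    horizontal sides cancel by periodicity. *)
Lemma loop_closed (H : C -> C) : (forall w, complex.Re w < 0 -> cdiff H w) ->
  (forall w, H (w + 0 +i* (2 * pi)) = H w) ->
  forall a b : R, a <= b -> b < 0 ->
  cintg (fun t => H (b +i* t)) = cintg (fun t => H (a +i* t)).
Proof.
move=> dH pH a b ab b0.
have bnd D (x y x0 y0 : R) (e : R) :
   absc (H (x +i* y) - H (x0 +i* y0) - D * ((x +i* y) - (x0 +i* y0))) <=
      e / 2 * absc ((x +i* y) - (x0 +i* y0)) -> 0 < e ->
   absc (H (x +i* y) - H (x0 +i* y0) - D * ((x +i* y) - (x0 +i* y0))) <=
      e * (`|x - x0| + `|y - y0|).
  move=> h e0; apply: le_trans h _; apply: ler_pM; rewrite ?absc_ge0 //; try lra.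
  exact: absc_le_ReIm.
(* The two forms are [Im (H dz)] and [Re (H dz)]; that a single number serves as the mixed
   coefficient is the Cauchy-Riemann equation. *)
have cl x y : x < 0 -> closed_at (fun x y => complex.Im (H (x +i* y)))
       (fun x y => complex.Re (H (x +i* y))) x y /\
   closed_at (fun x y => complex.Re (H (x +i* y)))
       (fun x y => - complex.Im (H (x +i* y))) x y.
  move=> x0; have [D HD] := dH (x +i* y) x0.
  have P e : 0 < e -> exists2 d : R, 0 < d & forall x' y', `|x' - x| < d -> `|y' - y| < d ->
     absc (H (x' +i* y') - H (x +i* y) - D * ((x' +i* y') - (x +i* y))) <=
      e * (`|x' - x| + `|y' - y|).
    move=> e0; have [d d0 h] := HD _ (divr_gt0 e0 (ltr0n R 2)).
    exists (d / 2); first by rewrite divr_gt0.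
    move=> x' y' hx hy; apply: bnd => //; apply: h.
    apply: le_lt_trans (absc_le_ReIm _) _; rewrite /=; lra.
  split; [exists (complex.Im D), (complex.Re D), (- complex.Im D) |
          exists (complex.Re D), (- complex.Im D), (- complex.Re D)];
  move=> e e0; have [d d0 h] := P e e0; exists d => // x' y' hx hy;
  have {}h := h x' y' hx hy; split; apply: le_trans h.
  - apply: le_trans (Im_le_absc _); rewrite !ReIm /= le_eqVlt; apply/orP; left.
    by apply/eqP; congr `|_|; ring.
  - apply: le_trans (Re_le_absc _); rewrite !ReIm /= le_eqVlt; apply/orP; left.
    by apply/eqP; congr `|_|; ring.
  - apply: le_trans (Re_le_absc _); rewrite !ReIm /= le_eqVlt; apply/orP; left.
    by apply/eqP; congr `|_|; ring.
  - rewrite -normrN; apply: le_trans (Im_le_absc _); rewrite !ReIm /= le_eqVlt.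
    by apply/orP; left; apply/eqP; congr `|_|; ring.
have per x : H (x +i* (2 * pi)) = H (x +i* 0).
  by rewrite -[RHS]pH; congr H; apply: complex_eqP; rewrite /= ?addr0 ?add0r.
have p0 : (0 : R) <= 2 * pi by rewrite ltW // twopi_gt0.
have key (P Q : R -> R -> R) : (forall x y, x < 0 -> closed_at P Q x y) ->
    (forall x, P x (2 * pi) = P x 0) -> rint (Q b) = rint (Q a).
  move=> PQ pP; have := loopint0 PQ ab b0 p0; rewrite /loopint.
  rewrite (_ : itvint (fun x => P x 0 - P x (2 * pi)) a b = 0); last first.
    rewrite /itvint (_ : (fun x => P x 0 - P x (2 * pi)) = cst 0).
      by rewrite /Rintegral integral0.
    by apply/funext => x; rewrite pP subrr.
  have iQ u : u < 0 -> rintegrable (Q u).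
    by move=> u0; apply: itv_integrable => y _; apply: (contQ PQ).
  rewrite add0r (_ : itvint _ 0 _ = rint (fun y => Q b y - Q a y)) // rintB; [|exact: iQ|by apply: iQ; exact: le_lt_trans b0].
  by move=> /eqP; rewrite subr_eq0 => /eqP.
apply: complex_eqP; rewrite /cintg /=.
  apply: (key _ (fun x y => complex.Re (H (x +i* y))) (fun x y h => (cl x y h).1)).
  by move=> x; rewrite per.
have cl2 := fun x y h => (cl x y h).2.
have rN u : u <= b -> rint (fun t => complex.Im (H (u +i* t))) =
    -1 * rint (fun t => - complex.Im (H (u +i* t))).
  move=> ub; rewrite -rintZ; first by congr rint; apply/funext => t; rewrite mulN1r opprK.
  by apply: itv_integrable => y _; apply: (contQ cl2); exact: le_lt_trans b0.
rewrite !rN //; congr (_ * _).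
apply: (key _ (fun x y => - complex.Im (H (x +i* y))) cl2).
by move=> x; rewrite per.
Qed.

End ComplexDifferentiability.

(** * Fourier coefficients of a holomorphic function on circles inside the disk *)

Section RadialFourier.
Variable R : realType.
Local Notation C := R[i].
Variable f : C -> C.
Hypothesis hf : forall z : C, absc z < 1 -> cdiff f z.

Let fr (r : R) (t : R) : C := f (r%:C * cis t).

Lemma absc_rcis (r t : R) : absc (r%:C * cis t) = `|r|.
Proof. by rewrite abscM absc_real absc_cis mulr1. Qed.

Lemma cexp_i (t : R) : cexp (0 +i* 1 * t%:C) = cis t.
Proof. by rewrite /cexp !ReIm /= !mul0r !mul1r subrr add0r expR0 mul1r. Qed.

Lemma cexp_int (w : C) (n : int) : cexp (n%:~R * w) = cexp w ^ n.
Proof.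
case: n => n; first exact: cexpM_nat.
by rewrite NegzE mulrNz mulNr cexpN cexpM_nat.
Qed.

Lemma L2_radial (r : R) : 0 <= r < 1 -> L2 (fr r).
Proof.
move=> /andP[r0 r1]; pose G (w : C) := f (r%:C * cexp (0 +i* 1 * w)).
have dG (t : R) : cdiff G t%:C.
  apply: (@cdiff_comp _ f (fun w => r%:C * cexp (0 +i* 1 * w))).
    apply: cdiffM; first exact: cdiff_cst.
    apply: (@cdiff_comp _ (@cexp R) (fun w => 0 +i* 1 * w)); last exact: cdiff_cexp.
    by apply: cdiffM; [exact: cdiff_cst | exact: cdiff_id].
  by apply: hf; rewrite cexp_i absc_rcis ger0_norm.
have frE t : fr r t = G t%:C by rewrite /G cexp_i.
have -> : fr r = (fun t : R => G t%:C) by apply/funext.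
by apply: L2_continuous => t; have [D HD] := dG t; [exact: cderiv_Re HD | exact: cderiv_Im HD].
Qed.

(** In the coordinate [w = log z] a circle of radius [r] becomes a segment on [Re w = ln r], and
    [f (exp w) exp (- n w)] is holomorphic and [2 pi i]-periodic. *)
Lemma fc_radial_const (n : int) (r1 r2 : R) : 0 < r1 -> r1 <= r2 -> r2 < 1 ->
  r2%:C ^ (- n) * fc (fr r2) n = r1%:C ^ (- n) * fc (fr r1) n.
Proof.
move=> r10 r12 r21; have r20 : 0 < r2 := lt_le_trans r10 r12.
pose H w := f (cexp w) * cexp ((- n)%:~R * w).
have dH w : complex.Re w < 0 -> cdiff H w.
  move=> w0; apply: cdiffM.
    apply: (@cdiff_comp _ f (@cexp R)); first exact: cdiff_cexp.
    by apply: hf; rewrite absc_cexp -[ltRHS]expR0 ltr_expR.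
  apply: (@cdiff_comp _ (@cexp R) (fun w => (- n)%:~R * w)); last exact: cdiff_cexp.
  by apply: cdiffM; [exact: cdiff_cst | exact: cdiff_id].
have e1 : cexp (0 +i* (2 * pi)) = 1 :> C by rewrite /cexp /= expR0 mul1r cis2pi.
have pH w : H (w + 0 +i* (2 * pi)) = H w.
  by rewrite /H !cexp_int cexpD e1 mulr1.
have HE r t : 0 < r -> H (ln r +i* t) = r%:C ^ (- n) * (fr r t * cis t ^ (- n)).
  move=> r0; rewrite /H cexp_int.
  have -> : cexp (ln r +i* t) = r%:C * cis t by rewrite /cexp /= lnK // posrE.
  by rewrite expfzMl mulrCA.
have ir r : 0 < r -> r < 1 -> cintegrable (fun t => fr r t * cis t ^ (- n)).
  by move=> a0 a1; apply: cintegrable_cisz; apply: L2_cintegrable; apply: L2_radial; rewrite ltW.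
have main r : 0 < r -> r < 1 -> r%:C ^ (- n) * fc (fr r) n =
    ((2 * pi)^-1)%:C * cintg (fun t => H (ln r +i* t)).
  move=> a0 a1; rewrite /fc mulrCA -(cintgZ (r%:C ^ (- n))); last exact: ir.
  by congr (_ * cintg _); apply/funext => t; rewrite HE.
have r11 : r1 < 1 := le_lt_trans r12 r21.
apply: (etrans (main _ r20 r21)); apply: etrans (esym (main _ r10 r11)).
apply: (congr1 (fun w => ((2 * pi)^-1)%:C * w)); apply: loop_closed => //.
  by rewrite ler_ln ?posrE.
by rewrite ln_lt0 // r20.
Qed.

Lemma le_small_le0 (x K d : R) : 0 < d -> (forall r, 0 < r -> r < d -> x <= r * K) -> x <= 0.
Proof.
move=> d0 H; rewrite leNgt; apply/negP => x0.
have K1 : 0 < `|K| + 1 by rewrite ltr_wpDl.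
set r := Num.min (d / 2) (x / (`|K| + 1) / 2).
have r0 : 0 < r by rewrite lt_min !divr_gt0.
have rd : r < d by rewrite gt_min; apply/orP; left; lra.
have rx : r <= x / (`|K| + 1) / 2 by rewrite ge_min lexx orbT.
have := H r r0 rd; apply/negP; rewrite -ltNge.
apply: (@le_lt_trans _ _ (r * (`|K| + 1))).
  by rewrite ler_wpM2l ?(ltW r0) // (le_trans (ler_norm K)) // lerDl.
apply: (@le_lt_trans _ _ (x / (`|K| + 1) / 2 * (`|K| + 1))).
  by rewrite ler_wpM2r // ltW.
have -> : x / (`|K| + 1) / 2 * (`|K| + 1) = x / 2 by field; rewrite gt_eqF.
lra.
Qed.

Let lip0 : exists L d : R, [/\ 0 < L, 0 < d, d < 1 &
  forall r t, 0 < r -> r < d -> absc (fr r t - f 0) <= L * r].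
Proof.
have h0 : absc (0 : C) < 1 by rewrite absc0.
have [L [d [L0 d0 lip]]] := cdiff_lip (hf h0).
exists L, (Num.min d 2^-1); split => //.
- by rewrite lt_min d0 invr_gt0 /=.
- by rewrite gt_min invf_lt1 // ltr1n orbT.
move=> r t r0; rewrite lt_min => /andP[rd _]; have := lip (r%:C * cis t).
by rewrite subr0 absc_rcis gtr0_norm //; apply.
Qed.

(** The invariant [r^(n+1)] times the coefficient can be evaluated on a small circle of radius [s],
    where the coefficient stays bounded; so it is [O(s)], hence 0. *)
Lemma fc_radial_neg (r : R) n : 0 < r -> r < 1 -> fc (fr r) (Negz n) = 0.
Proof.
move=> r0 r1; have [L [d [L0 d0 d1 lip]]] := lip0.
suff : r%:C ^ (- Negz n) * fc (fr r) (Negz n) = 0.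
  move/eqP; rewrite mulf_eq0 => /orP[|/eqP //].
  rewrite expfz_eq0 => /andP[_ /eqP /complexI h]; by rewrite h ltxx in r0.
apply/eqP; rewrite -absc_eq0 eq_le absc_ge0 andbT.
set c := absc _; have m0 : 0 < Num.min d r by rewrite lt_min d0.
apply: (@le_small_le0 _ (absc (f 0) + L) (Num.min d r)) => // s s0.
rewrite lt_min => /andP[sd sr].
have s1 : s < 1 := lt_trans sr r1.
rewrite /c (fc_radial_const _ s0 (ltW sr) r1).
have -> : - Negz n = n.+1%:Z by rewrite NegzE opprK.
rewrite -exprnP abscM abscX absc_real (gtr0_norm s0) exprS -mulrA.
apply: ler_wpM2l; first exact: ltW.
have is_ : L2 (fr s) by apply: L2_radial; rewrite ltW.
have b : absc (fc (fr s) (Negz n)) <= absc (f 0) + L.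
  apply: le_trans (absc_fc _ (L2_cintegrable is_)) _.
  rewrite ler_pdivrMl ?twopi_gt0 // mulrC -rint_cst; apply: rint_le.
  - by case: (L2_cintegrable is_).
  - exact: rintegrable_cst.
  move=> t _; have -> : fr s t = (fr s t - f 0) + f 0 by rewrite subrK.
  apply: le_trans (abscD _ _) _; rewrite addrC lerD2l.
  apply: le_trans (lip s t s0 sd) _; rewrite ler_piMr // ltW //.
apply: le_trans b; rewrite ler_piMl ?absc_ge0 //.
by apply: exprn_ile1; rewrite ltW.
Qed.

Lemma fc_radial_0 (r : R) : 0 < r -> r < 1 -> fc (fr r) 0 = f 0.
Proof.
move=> r0 r1; have [L [d [L0 d0 d1 lip]]] := lip0.
apply/eqP; rewrite -subr_eq0 -absc_eq0 eq_le absc_ge0 andbT.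
have m0 : 0 < Num.min d r by rewrite lt_min d0.
apply: (@le_small_le0 _ L (Num.min d r)) => // s s0.
rewrite lt_min => /andP[sd sr]; have s1 : s < 1 := lt_trans sr r1.
have := fc_radial_const 0 s0 (ltW sr) r1; rewrite oppr0 !expr0z !mul1r => ->.
have is_ : L2 (fr s) by apply: L2_radial; rewrite ltW.
have ic := cintegrable_cst (f 0).
have -> : f 0 = fc (fun=> f 0) 0.
  have := @fc_poly R (f 0)%:P 0; under [X in fc X]eq_fun do rewrite hornerC.
  by move=> -> /=; rewrite coefC.
rewrite -fcB //; last exact: L2_cintegrable.
have iB := cintegrableB (L2_cintegrable is_) ic.
apply: le_trans (absc_fc _ iB) _.
rewrite ler_pdivrMl ?twopi_gt0 // mulrC -rint_cst; apply: rint_le.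
- by case: iB.
- exact: rintegrable_cst.
- by move=> t _; rewrite mulrC; exact: lip.
Qed.

Lemma fc_radial_pos (r s : R) (n : nat) : 0 < r -> r < 1 -> 0 < s -> s < 1 ->
  s%:C ^+ n * fc (fr r) n = r%:C ^+ n * fc (fr s) n.
Proof.
wlog rs : r s / r <= s => [H r0 r1 s0 s1|r0 r1 s0 s1].
  by have [h|/ltW h] := leP r s; [exact: H | apply/esym; exact: H].
have := fc_radial_const n%:Z r0 rs s1; rewrite -!exprnN -!exprVn.
have h (x : R) : 0 < x -> x%:C ^+ n * x%:C^-1 ^+ n = 1 :> C.
  move=> x0; rewrite -exprMn divff ?expr1n //.
  by apply/eqP => /complexI h; rewrite h ltxx in x0.
move=> E; transitivity (s%:C ^+ n * (r%:C ^+ n * (r%:C^-1 ^+ n * fc (fr r) n))).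
  by rewrite (mulrA (r%:C ^+ n)) h // mul1r.
by rewrite -E mulrCA (mulrA (s%:C ^+ n)) h // mul1r.
Qed.

End RadialFourier.

(** * Boundary values in the Hardy space *)

Section BoundaryValues.
Variable R : realType.
Local Notation C := R[i].
Local Notation mu := (@lebesgue_measure R).
Local Notation period := (@period R).
Implicit Types (F G : R -> C) (f : C -> C).

Lemma inL2_L2 f : inL2 f -> L2 (fun t => f (cis t)).
Proof.
move=> [[m1 m2] fin].
have mF : cmeas (fun t => f (cis t)) by split; [exact: (rmeas_default m1) | exact: (rmeas_default m2)].
split => //; apply/integrableP; split.
  by apply/measurable_EFinP; exact: (rmeas_sqr_absc mF).
move: fin; rewrite /sqL2; congr (_ < _)%E; apply: eq_integral => t _ /=.
by rewrite ger0_norm // sqr_ge0.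
Qed.

Lemma sqL2_N2 f : L2 (fun t => f (cis t)) -> sqL2 f = (N2 (fun t => f (cis t)))%:E.
Proof.
move=> [_ iF]; rewrite /sqL2 /N2 /rint /Rintegral fineK //.
exact: (integrable_fin_num _ iF).
Qed.

Lemma sqL2_tends0 (f : nat -> C -> C) : (forall n, L2 (fun t => f n (cis t))) ->
  (sqL2 (f n) @[n --> \oo] --> 0%E) -> tends0 (fun n => N2 (fun t => f n (cis t))).
Proof.
move=> LF H; apply: cvg_tends0.
have E : (fun n => sqL2 (f n)) = (fun n => (N2 (fun t => f n (cis t)))%:E).
  by apply/funext => n; rewrite sqL2_N2.
by move: H; rewrite E => /fine_cvg.
Qed.

(** All Fourier coefficients are bounded by the L1 norm, so uniqueness applies. *)
Lemma rint0_ae F : cintegrable F -> rint (fun t => absc (F t)) <= 0 ->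
  {ae mu, forall t, period t -> F t = 0}.
Proof.
move=> iF F0; apply: fc0_ae => // n; apply/eqP; rewrite -absc_eq0 eq_le absc_ge0 andbT.
apply: le_trans (absc_fc n iF) _.
by rewrite pmulr_rle0 // invr_gt0 twopi_gt0.
Qed.

Lemma N1_lim_mul (a b : nat -> R -> C) A B : (forall m, L2 (a m)) -> (forall m, L2 (b m)) ->
  L2 A -> L2 B -> tends0 (fun m => N2 (fun t => a m t - A t)) ->
  tends0 (fun m => N2 (fun t => b m t - B t)) ->
  tends0 (fun m => rint (fun t => absc (a m t * b m t - A t * B t))).
Proof.
move=> La Lb LA LB ta tb.
have LaA m : L2 (fun t => a m t - A t) by exact: L2B.
have LbB m : L2 (fun t => b m t - B t) by exact: L2B.
have T := tends0D (tends0D (tends0D ta tb) (N1_lim LA LbB tb)) (N1_lim LB LaA ta).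
apply: tends0_le T => m.
have [i1 h1] := L2_young (@ltr01 R) (LaA m) (LbB m).
rewrite invr1 !mul1r in h1.
have i2 := L2M_cintegrable LA (LbB m); have i3 := L2M_cintegrable LB (LaA m).
apply: (@le_trans _ _ (rint (fun t => absc ((a m t - A t) * (b m t - B t))) +
   rint (fun t => absc (A t * (b m t - B t))) +
   rint (fun t => absc (B t * (a m t - A t))))); last by rewrite !lerD.
rewrite -(rintD i1.2 i2.2) -(rintD (rintegrableD i1.2 i2.2) i3.2).
apply: rint_le.
- have i := cintegrableB (L2M_cintegrable (La m) (Lb m)) (L2M_cintegrable LA LB).
  by case: i.
- by apply: rintegrableD; [apply: rintegrableD; [exact: i1.2|exact: i2.2]|exact: i3.2].
move=> t _; have -> : a m t * b m t - A t * B t = (a m t - A t) * (b m t - B t) +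
   A t * (b m t - B t) + B t * (a m t - A t) by ring.
by apply: le_trans (abscD _ _) _; rewrite lerD // abscD.
Qed.

(** L2 convergence of the entries gives L1 convergence of the determinant. Serves both for the
    boundary values of [l] and for the limit [k2]. *)
Lemma det1_ae (a b c d : nat -> R -> C) A B C' D :
  (forall m, [/\ L2 (a m), L2 (b m), L2 (c m) & L2 (d m)]) ->
  [/\ L2 A, L2 B, L2 C' & L2 D] ->
  tends0 (fun m => N2 (fun t => a m t - A t)) ->
  tends0 (fun m => N2 (fun t => b m t - B t)) ->
  tends0 (fun m => N2 (fun t => c m t - C' t)) ->
  tends0 (fun m => N2 (fun t => d m t - D t)) ->
  (forall m t, a m t * d m t - b m t * c m t = 1) ->
  {ae mu, forall t, period t -> A t * D t - B t * C' t = 1}.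
Proof.
move=> Lm [LA LB LC LD] ta tb tc td det.
have La m : L2 (a m) by case: (Lm m). have Lb m : L2 (b m) by case: (Lm m).
have Lc m : L2 (c m) by case: (Lm m). have Ld m : L2 (d m) by case: (Lm m).
have T := tends0D (N1_lim_mul La Ld LA LD ta td) (N1_lim_mul Lb Lc LB LC tb tc).
have iAD := L2M_cintegrable LA LD; have iBC := L2M_cintegrable LB LC.
have iS : cintegrable (fun t => A t * D t - B t * C' t - 1).
  by apply: cintegrableB; [exact: cintegrableB | exact: cintegrable_cst].
have H : {ae mu, forall t, period t -> A t * D t - B t * C' t - 1 = 0}.
  apply: rint0_ae => //; apply: tends0_ge0; apply: tends0_le T => m.
  have i1 := cintegrableB (L2M_cintegrable (La m) (Ld m)) iAD.
  have i2 := cintegrableB (L2M_cintegrable (Lb m) (Lc m)) iBC.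
  rewrite -rintD; [|exact: i1.2|exact: i2.2]; apply: rint_le.
  - by case: iS.
  - by apply: rintegrableD; [exact: i1.2|exact: i2.2].
  move=> t _; rewrite -(det m t).
  have -> : A t * D t - B t * C' t - (a m t * d m t - b m t * c m t) =
    (b m t * c m t - B t * C' t) - (a m t * d m t - A t * D t) by ring.
  by rewrite [leRHS]addrC; exact: abscB.
by apply: aeS H => t h Dt; apply/eqP; rewrite -subr_eq0 h.
Qed.

(** The excess [max (|A| - 1) 0] is at most [|a m - A|] for every [m], so its integral is 0. *)
Lemma bound1_ae (a : nat -> R -> C) A : (forall m, L2 (a m)) -> L2 A ->
  tends0 (fun m => N2 (fun t => a m t - A t)) -> (forall m t, absc (a m t) <= 1) ->
  {ae mu, forall t, period t -> absc (A t) <= 1}.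
Proof.
move=> La LA ta a1; pose u t : R := Num.max (absc (A t) - 1) 0.
have u0 t : 0 <= u t by rewrite le_max lexx orbT.
have mu_ : rmeas u.
  apply: measurable_maxr; last exact: rmeas_cst.
  by apply: rmeasB; [apply: rmeas_absc; case: LA | exact: rmeas_cst].
have mU : cmeas (fun t => (u t)%:C) by split => //=; exact: rmeas_cst.
have Ub m t : absc ((u t)%:C) <= absc (1 * (a m t - A t)).
  rewrite mul1r absc_real ger0_norm // ge_max absc_ge0 andbT lerBlDr.
  have := abscD (A t - a m t) (a m t); rewrite subrK absc_dist => h.
  by apply: le_trans h _; rewrite lerD2l.
have LaA m : L2 (fun t => a m t - A t) by exact: L2B.
have T := N1_lim (L2_cst 1) LaA ta.
have i1 m := L2M_cintegrable (L2_cst 1) (LaA m).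
have iU : cintegrable (fun t => (u t)%:C).
  by apply: cintegrable_le (i1 0%N).2 => // t _; exact: Ub.
have H : {ae mu, forall t, period t -> (u t)%:C = 0 :> C}.
  apply: rint0_ae => //; apply: tends0_ge0; apply: tends0_le T => m.
  by apply: rint_le; [exact: iU.2 | exact: (i1 m).2 | move=> t _; exact: Ub].
apply: aeS H => t h Dt; have := h Dt => /complexI ut.
have : absc (A t) - 1 <= u t by rewrite le_max lexx.
by rewrite ut subr_le0.
Qed.

(** A sequence of radii replacing the one-sided limits: it tends to 1 from below for functions on
    the disk, its inverse from above for functions outside. *)
Definition rad (m : nat) : R := (1 + m.+1%:R^-1)^-1.

Lemma radV_gt1 m : 1 < (rad m)^-1.
Proof. by rewrite invrK ltrDl invr_gt0. Qed.

Lemma rad_gt0 m : 0 < rad m.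
Proof. by rewrite invr_gt0 addr_gt0 // invr_gt0. Qed.

Lemma rad_lt1 m : rad m < 1.
Proof. by rewrite /rad invf_lt1 ?ltrDl ?invr_gt0 // addr_gt0 // invr_gt0. Qed.

Lemma cvg_radV : (rad m)^-1 @[m --> \oo] --> (1 : R).
Proof.
under eq_fun do rewrite /rad invrK.
have H : (1 + m.+1%:R^-1 : R) @[m --> \oo] --> (1 + 0 : R).
  by apply: cvgD; [exact: cvg_cst | exact: cvg_harmonic].
by rewrite addr0 in H.
Qed.

Lemma cvg_rad : rad m @[m --> \oo] --> (1 : R).
Proof.
have -> : rad = (fun m => ((rad m)^-1)^-1) by apply/funext => m; rewrite invrK.
have H : ((rad m)^-1)^-1 @[m --> \oo] --> (1 : R)^-1.
  by apply: cvgV; [exact: oner_neq0 | exact: cvg_radV].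
by rewrite invr1 in H.
Qed.

Lemma rad_at_left : rad m @[m --> \oo] --> (1 : R)^'-.
Proof.
move=> A hA; have [N _ HN] := cvg_rad hA; exists N => // m Nm.
by apply: (HN m Nm); exact: rad_lt1.
Qed.

Lemma radV_at_right : (rad m)^-1 @[m --> \oo] --> (1 : R)^'+.
Proof.
move=> A hA; have [N _ HN] := cvg_radV hA; exists N => // m Nm.
by apply: (HN m Nm); exact: radV_gt1.
Qed.

(* [f] belongs to the Hardy space H^2, with its own values on the circle as
   boundary values. *)
Definition hardy f :=
  [/\ forall z, absc z < 1 -> cdiff f z, L2 (fun t => f (cis t)) &
      tends0 (fun m => N2 (fun t => f ((rad m)%:C * cis t) - f (cis t)))].

Lemma hardy_disk f : holomorphic_disk f -> L2_boundary_disk f -> hardy f.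
Proof.
move=> hf [inf lim]; have LF := inL2_L2 inf.
have cf z : absc z < 1 -> cdiff f z.
  by move=> z1; apply: cdiff_derivable; apply: hf; rewrite abscE ltcR.
have LB m : L2 (fun t => f ((rad m)%:C * cis t) - f (cis t)).
  by apply: L2B => //; apply: L2_radial => //; rewrite ltW ?rad_gt0 ?rad_lt1.
split=> //; apply: (@sqL2_tends0 (fun m z => f ((rad m)%:C * z) - f z)) => //.
exact: (cvg_comp _ _ rad_at_left lim).
Qed.

Lemma cdiff_conj f z : cdiff f (conjc z) -> cdiff (fun w => conjc (f (conjc w))) z.
Proof.
move=> [D HD]; exists (conjc D) => e e0; have [d d0 h] := HD e e0; exists d => // w wd.
have cw : absc (conjc w - conjc z) = absc (w - z) by rewrite -conjcB absc_conj.
have := h (conjc w); rewrite cw => /(_ wd); apply: le_trans.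
have -> : conjc (f (conjc w)) - conjc (f (conjc z)) - conjc D * (w - z) =
    @conjc R (f (conjc w) - f (conjc z) - D * (conjc w - conjc z)).
  by rewrite conjcB conjcB conjcM conjcB !conjcK.
by rewrite absc_conj.
Qed.

Lemma star_circle (l : sphere R -> C) t : star l (cis t) = conjc (l (Some (cis t))).
Proof.
rewrite /star /sphere_inv conjc_eq0 (negbTE (cis_neq0 t)).
by rewrite conj_cis invrK.
Qed.

Lemma star_radial (l : sphere R -> C) (r t : R) : 0 < r ->
  star l (r%:C * cis t) = conjc (l (Some (r^-1%:C * cis t))).
Proof.
move=> r0; have rc : r%:C != 0 :> C by apply/eqP => /complexI h; rewrite h ltxx in r0.
have cE : @conjc R (r%:C * cis t) = r%:C * (cis t)^-1.
  by have := conjcM r%:C (cis t); rewrite conj_real conj_cis.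
rewrite /star /sphere_inv cE mulf_eq0 (negbTE rc) invr_eq0 (negbTE (cis_neq0 t)) /=.
by rewrite invfM invrK fmorphV.
Qed.

(** Reflection in the circle: the radius [r] for [star l] corresponds to the radius [1 / r] for [l],
    and conjugation preserves the modulus of the differences. *)
Lemma hardy_codisk (l : sphere R -> C) :
  holomorphic_disk (fun z => l (sphere_inv z)) -> L2_boundary_codisk l -> hardy (star l).
Proof.
move=> hl [inl lim].
have Ll : L2 (fun t => l (Some (cis t))) := inL2_L2 inl.
have cf z : absc z < 1 -> cdiff (star l) z.
  move=> z1; apply: (@cdiff_conj (fun z => l (sphere_inv z))); apply: cdiff_derivable.
  by apply: hl; rewrite abscE ltcR absc_conj.
have LF : L2 (fun t => star l (cis t)).
  by under eq_fun do rewrite star_circle; exact: L2_conj.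
have LB m : L2 (fun t => star l ((rad m)%:C * cis t) - star l (cis t)).
  by apply: L2B => //; apply: L2_radial => //; rewrite ltW ?rad_gt0 ?rad_lt1.
split=> //; have E m t : absc (star l ((rad m)%:C * cis t) - star l (cis t)) =
    absc (l (Some (((rad m)^-1)%:C * cis t)) - l (Some (cis t))).
  by rewrite star_radial ?rad_gt0 // star_circle -conjcB absc_conj.
have := @sqL2_tends0 (fun m z => star l ((rad m)%:C * z) - star l z) LB.
apply; have -> : (fun m => sqL2 (fun z => star l ((rad m)%:C * z) - star l z)) =
   (fun m => sqL2 (fun z => l (Some (((rad m)^-1)%:C * z)) - l (Some z))).
  by apply/funext => m; apply: eq_integral => t _; rewrite E.
exact: (cvg_comp _ _ radV_at_right lim).
Qed.

Lemma hardy_radial_fc f (n : int) : hardy f ->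
  tends0 (fun m => absc (fc (fun t => f ((rad m)%:C * cis t)) n - fc (fun t => f (cis t)) n)).
Proof.
move=> [cf LF tf].
have Lr m : L2 (fun t => f ((rad m)%:C * cis t)).
  by apply: L2_radial => //; rewrite ltW ?rad_gt0 ?rad_lt1.
have := fc_lim n (L2_cst 1) Lr LF tf.
apply: tends0_le => m; under [X in _ <= absc (fc X n - _)]eq_fun do rewrite mul1r.
by under [X in _ <= absc (_ - fc X n)]eq_fun do rewrite mul1r.
Qed.

Lemma tends0_cst0 (u : nat -> C) c : (forall m, u m = c) -> tends0 (fun m => absc (u m - c)).
Proof. by move=> uc e e0; exists 0%N => m _; rewrite uc subrr absc0 ltW. Qed.

Lemma hardy_causal f : hardy f -> causal (fun t => f (cis t)).
Proof.
move=> hf n; apply: (absc_lim_unique (hardy_radial_fc (Negz n) hf)).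
by apply: tends0_cst0 => m; rewrite fc_radial_neg ?rad_gt0 ?rad_lt1 //; case: hf.
Qed.

Lemma hardy_fc0 f : hardy f -> fc (fun t => f (cis t)) 0 = f 0.
Proof.
move=> hf; apply: (absc_lim_unique (hardy_radial_fc 0 hf)).
by apply: tends0_cst0 => m; rewrite fc_radial_0 ?rad_gt0 ?rad_lt1 //; case: hf.
Qed.

(** The rule comparing two radii below 1 is applied to [r] and [rad m], and [m] tends to infinity:
    the same sequence tends to both sides. *)
Lemma hardy_fc f (n : nat) (r : R) : hardy f -> 0 < r -> r < 1 ->
  fc (fun t => f (r%:C * cis t)) n = r%:C ^+ n * fc (fun t => f (cis t)) n.
Proof.
move=> hf r0 r1; have [cf LF tf] := hf.
have rn : 0 <= r ^+ n by rewrite exprn_ge0 // ltW.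
apply: (@absc_lim_unique _ _ _ (fun m => r%:C ^+ n * fc (fun t => f ((rad m)%:C * cis t)) n)).
  have T : tends0 (fun m => absc (fc (fun t => f (r%:C * cis t)) n) * (1 - rad m ^+ n)).
    apply: tends0Z; first exact: absc_ge0.
    have radX k : rad m ^+ k @[m --> \oo] --> (1 : R).
      elim: k => [|k IH]; first by under eq_fun do rewrite expr0; exact: cvg_cst.
      under eq_fun do rewrite exprS.
      have H : (rad m * rad m ^+ k) @[m --> \oo] --> (1 * 1 : R) by exact: cvgM cvg_rad IH.
      by rewrite mulr1 in H.
    apply: cvg_tends0.
    have H : (1 - rad m ^+ n) @[m --> \oo] --> (1 - 1 : R).
      by apply: cvgB => //; exact: cvg_cst.
    by rewrite subrr in H.
  apply: tends0_le T => m.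
  have E : r%:C ^+ n * fc (fun t => f ((rad m)%:C * cis t)) n =
      (rad m)%:C ^+ n * fc (fun t => f (r%:C * cis t)) n.
    exact: (fc_radial_pos cf n (rad_gt0 m) (rad_lt1 m) r0 r1).
  rewrite E; set X := fc _ _; have -> : (rad m)%:C ^+ n * X - X = ((rad m)%:C ^+ n - 1) * X by ring.
  rewrite abscM mulrC ler_wpM2l ?absc_ge0 //.
  rewrite -rmorphXn -(rmorph1 (real_complex R)) -rmorphB absc_real ler0_norm ?opprB //.
  by rewrite subr_le0; apply: exprn_ile1; rewrite ltW ?rad_gt0 ?rad_lt1.
have := tends0Z rn (hardy_radial_fc n hf); apply: tends0_le => m.
by rewrite -mulrBr abscM abscX absc_real (gtr0_norm r0).
Qed.

End BoundaryValues.

(** * Taylor coefficients at 0 as Fourier coefficients *)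

Section TaylorCoefficients.
Variable R : realType.
Local Notation C := R[i].
Implicit Types (f h : C -> C) (c psi : nat -> C).

Lemma cvgC_tends0 (u : nat -> C) (l : C) :
  (u n : C^o) @[n --> \oo] --> (l : C^o) -> tends0 (fun n => absc (u n - l)).
Proof.
move=> H e e0; have eC : 0 < e%:C :> C by rewrite ltcR.
move/cvgrPdist_le : H => /(_ _ eC) [N _ HN]; exists N => n Nn.
by have := HN n Nn; rewrite /= abscE lecR absc_dist.
Qed.

Lemma tends0_cvgC (u : nat -> C) (l : C) :
  tends0 (fun n => absc (u n - l)) -> (u n : C^o) @[n --> \oo] --> (l : C^o).
Proof.
move=> H; apply/cvgrPdist_le => e e0.
have eE : e = (complex.Re e)%:C by rewrite RRe_real // realE ltW.
have e0' : 0 < complex.Re e by rewrite -ltcR -eE.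
have [N HN] := H _ e0'; exists N => // n /= Nn.
by rewrite eE abscE lecR absc_dist HN.
Qed.

(** Only pointwise convergence is given. It bounds the terms at radius [s / 2], so below radius
    [s / 4] the series is dominated by a geometric one of ratio [1/2] and converges uniformly. *)
Lemma taylor_poly_limit c f : taylor_at0 c f -> exists2 d : R, 0 < d &
  forall r, 0 < r -> r < d ->
    poly_limit (fun t => f (r%:C * cis t)) (fun n => \poly_(k < n) (c k * r%:C ^+ k)).
Proof.
move=> [s s0 Hs].
have Ht z : absc z < s -> tends0 (fun n => absc (\sum_(k < n) c k * z ^+ k - f z)).
  move=> zs; have := cvgC_tends0 (Hs z zs); apply: tends0_le => n.
  by rewrite big_mkord.
have s2 : 0 < s / 2 by rewrite divr_gt0.
(* From rank [N] on, a term is the difference of two partial sums within 1 of the limit, whence the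
   2; the terms of lower rank are added to the bound. *)
have [K [K0 HK]] : exists K : R, 0 <= K /\ forall k, absc (c k) * (s / 2) ^+ k <= K.
  have zs : absc (s / 2)%:C < s by rewrite absc_real gtr0_norm //; lra.
  have [N HN] := Ht _ zs 1 ltr01.
  have term k : absc (c k) * (s / 2) ^+ k = absc (c k * (s / 2)%:C ^+ k).
    by rewrite abscM abscX absc_real gtr0_norm.
  exists (2 + \sum_(k < N) absc (c k) * (s / 2) ^+ k).
  have pos k : 0 <= absc (c k) * (s / 2) ^+ k by rewrite term absc_ge0.
  split; first by rewrite addr_ge0 // sumr_ge0.
  move=> k; have [kN|Nk] := ltnP k N.
    rewrite (bigD1 (Ordinal kN)) //= addrCA lerDl addr_ge0 // sumr_ge0 // => i _; exact: pos.
  apply: (@le_trans _ _ 2); last by rewrite lerDl sumr_ge0 // => i _; exact: pos.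
  rewrite term; have h1 := HN k Nk; have h2 := HN k.+1 (leqW Nk).
  rewrite big_ord_recr /= in h2; set S := \sum_(i < k) _ in h1 h2.
  set T := c k * _ in h2 *; have -> : T = (S + T - f (s / 2)%:C) - (S - f (s / 2)%:C) by ring.
  by apply: le_trans (abscB _ _) _; rewrite -[2]/(1 + 1) lerD.
exists (s / 4); first by rewrite divr_gt0.
move=> r r0 rs.
have ck k : absc (c k * r%:C ^+ k) <= K * 2^-1 ^+ k.
  rewrite abscM abscX absc_real (gtr0_norm r0).
  apply: (@le_trans _ _ (absc (c k) * (s / 2 * 2^-1) ^+ k)).
    by rewrite ler_wpM2l ?absc_ge0 // lerXn2r ?nnegrE; lra.
  by rewrite exprMn mulrA ler_wpM2r // exprn_ge0 // invr_ge0.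
pose p n : {poly C} := \poly_(k < n) (c k * r%:C ^+ k).
have pE n t : (p n).[cis t] = \sum_(k < n) c k * (r%:C * cis t) ^+ k.
  by rewrite horner_poly; apply: eq_bigr => k _; rewrite exprMn mulrA.
have zr t : absc (r%:C * cis t) < s by rewrite absc_rcis gtr0_norm //; lra.
have tp t : tends0 (fun n => absc ((p n).[cis t] - f (r%:C * cis t))).
  by apply: tends0_le (Ht _ (zr t)) => n; rewrite pE.
have pp n j t : absc ((p (n + j)%N).[cis t] - (p n).[cis t]) <= 2 * K * 2^-1 ^+ n - 2 * K * 2^-1 ^+ (n + j).
  elim: j => [|j IH]; first by rewrite addn0 !subrr absc0.
  have -> : (p (n + j.+1)%N).[cis t] - (p n).[cis t] =
    ((p (n + j)%N).[cis t] - (p n).[cis t]) + c (n + j)%N * (r%:C * cis t) ^+ (n + j).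
    by rewrite addnS pE big_ord_recr /= -pE; ring.
  apply: le_trans (abscD _ _) _.
  have : absc (c (n + j)%N * (r%:C * cis t) ^+ (n + j)) <= K * 2^-1 ^+ (n + j).
    by rewrite exprMn mulrA abscM abscX absc_cis expr1n mulr1.
  rewrite addnS exprS; move: IH; set l := 2^-1 ^+ (n + j).
  have -> : 2 * K * (2^-1 * l) = K * l by field.
  have -> : 2 * K * l = K * l + K * l by ring.
  by move: (K * l) => x; lra.
have pf n t : absc ((p n).[cis t] - f (r%:C * cis t)) <= 2 * K * 2^-1 ^+ n.
  apply/ler_addgt0Pr => e e0; have [N HN] := tp t e e0.
  have -> : (p n).[cis t] - f (r%:C * cis t) = ((p (n + N)%N).[cis t] - f (r%:C * cis t))
     - ((p (n + N)%N).[cis t] - (p n).[cis t]) by ring.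
  apply: le_trans (abscB _ _) _; rewrite addrC; apply: lerD; last by apply: HN; exact: leq_addl.
  apply: le_trans (pp n N t) _; rewrite gerBl.
  by apply: mulr_ge0; [exact: mulr_ge0 | apply: exprn_ge0; rewrite invr_ge0].
have mf : cmeas (fun t => f (r%:C * cis t)).
  have cv t : tends0 (fun n => `|complex.Re ((p n).[cis t]) - complex.Re (f (r%:C * cis t))|) /\
     tends0 (fun n => `|complex.Im ((p n).[cis t]) - complex.Im (f (r%:C * cis t))|).
    split; apply: tends0_le (tp t) => n.
      by apply: le_trans (Re_le_absc _); rewrite ReD ReN.
    by apply: le_trans (Im_le_absc _); rewrite ImD ImN.
  have cvr (u : nat -> R) l : tends0 (fun n => `|u n - l|) -> u n @[n --> \oo] --> l.
    move=> H; apply/cvgrPdist_le => e e0; have [N HN] := H e e0.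
    by exists N => // n /= Nn; rewrite distrC HN.
  split.
    exact: (measurable_fun_cvg (fun n => (cmeas_poly (p n)).1) (fun t _ => cvr _ _ (cv t).1)).
  exact: (measurable_fun_cvg (fun n => (cmeas_poly (p n)).2) (fun t _ => cvr _ _ (cv t).2)).
have Lf : L2 (fun t => f (r%:C * cis t)).
  apply: (@L2_bounded _ _ (2 * K)) => //; apply: aeW => t _.
  have := pf 0%N t; rewrite expr0 mulr1 -absc_dist.
  by rewrite (_ : (p 0%N).[cis t] = 0) ?subr0 // pE big_ord0.
split => //.
have T : tends0 (fun n => 2 * pi * (2 * K) ^+ 2 * 2^-1 ^+ n).
  apply: tends0Z; first by rewrite mulr_ge0 ?sqr_ge0 // ltW // twopi_gt0.
  by apply: cvg_tends0; apply: cvg_expr; rewrite ger0_norm ?invr_ge0 // invf_lt1 // ltr1n.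
apply: tends0_le T => n.
have LB : L2 (fun t => (p n).[cis t] - f (r%:C * cis t)) by apply: L2B => //; exact: L2_poly.
apply: (@le_trans _ _ (rint (fun=> (2 * K * 2^-1 ^+ n) ^+ 2))).
  apply: rint_le; [by case: LB | exact: rintegrable_cst |] => t _.
  have h := pf n t; rewrite lerXn2r ?nnegrE ?absc_ge0 //.
  exact: le_trans (absc_ge0 _) h.
rewrite rint_cst [leLHS]mulrC -[leRHS]mulrA ler_pM2l ?twopi_gt0 // exprMn ler_wpM2l ?sqr_ge0 //.
have l0 : 0 <= (2^-1 : R) ^+ n by rewrite exprn_ge0 // invr_ge0.
by rewrite expr2 ler_piMl // exprn_ile1 ?invr_ge0 // invf_le1 // ler1n.
Qed.

Lemma taylor_fc_radial c f : taylor_at0 c f -> exists2 d : R, 0 < d &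
  forall r, 0 < r -> r < d ->
  [/\ exists p, poly_limit (fun t => f (r%:C * cis t)) p &
      forall n : nat, fc (fun t => f (r%:C * cis t)) n = c n * r%:C ^+ n].
Proof.
move=> /taylor_poly_limit[d d0 Hd]; exists d => // r r0 rd.
have PL := Hd r r0 rd; split; first by eexists; exact: PL.
move=> n; apply: (absc_lim_unique (poly_limit_coef n PL)).
move=> e e0; exists n.+1 => m nm.
by rewrite coef_poly nm subrr absc0 ltW.
Qed.

Lemma hardy_taylor_fc c f (n : nat) : hardy f -> taylor_at0 c f ->
  fc (fun t => f (cis t)) n = c n.
Proof.
move=> hf /taylor_fc_radial[d d0 Hd].
pose r : R := Num.min (d / 2) 2^-1.
have r0 : 0 < r by rewrite lt_min divr_gt0 //= invr_gt0.
have rd : r < d by rewrite gt_min; apply/orP; left; lra.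
have r1 : r < 1 by rewrite gt_min; apply/orP; right; rewrite invf_lt1 // ltr1n.
have [_ /(_ n)] := Hd r r0 rd; rewrite (hardy_fc _ hf r0 r1) mulrC => /mulIf; apply.
by rewrite expf_neq0 //; apply/eqP => /complexI h; rewrite h ltxx in r0.
Qed.

(** The quotient is controlled only near 0, so [f = h * (f / h)] is expanded on a small circle;
    there all three coefficient sequences carry powers of [r], which cancel. *)
Lemma taylor_quotient psi f h (n : nat) : hardy f -> hardy h -> h 0 = 1 ->
  taylor_at0 psi (fun z => f z / h z) ->
  fc (fun t => f (cis t)) n = cauchy psi (fun k : nat => fc (fun t => h (cis t)) k) n.
Proof.
move=> hf hh h01 /taylor_fc_radial[d d0 Hd].
have [ch _ _] := hh.
have a0 : absc (0 : C) < 1 by rewrite absc0.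
have [L [e [L0 e0 lip]]] := cdiff_lip (ch _ a0).
(* Below [d] the quotient has its expansion, below 1 the Hardy rule applies, below [e] the Lipschitz
   bound holds, and [L * r < 1] then keeps [h] within distance less than 1 of [h 0 = 1], so away
   from 0. *)
pose r : R := Num.min (Num.min (d / 2) 2^-1) (Num.min (e / 2) (L^-1 / 2)).
have r0 : 0 < r.
  rewrite !lt_min; apply/andP; split; apply/andP; split; rewrite ?divr_gt0 ?invr_gt0 //.
have [rd r1 re rL] : [/\ r < d, r < 1, r < e & L * r < 1].
  have h1 : r <= d / 2 by rewrite !ge_min lexx.
  have h2 : r <= 2^-1 by rewrite !ge_min lexx orbT.
  have h3 : r <= e / 2 by rewrite !ge_min lexx !orbT.
  have h4 : r <= L^-1 / 2 by rewrite !ge_min lexx !orbT.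
  have h5 : L * r <= L * (L^-1 / 2) by rewrite ler_pM2l.
  rewrite mulrA mulfV ?gt_eqF // in h5.
  by split; lra.
have rc : r%:C != 0 :> C by apply/eqP => /complexI hr; rewrite hr ltxx in r0.
have [[p PL] cq] := Hd r r0 rd.
have hn t : h (r%:C * cis t) != 0.
  apply/eqP => h0; have := lip (r%:C * cis t).
  rewrite subr0 absc_rcis (gtr0_norm r0) h0 h01 sub0r abscN absc1 => /(_ re).
  by rewrite leNgt rL.
have Lh : L2 (fun t => h (r%:C * cis t)) by apply: L2_radial => //; rewrite ltW.
have ch' : causal (fun t => h (r%:C * cis t)).
  by move=> k; exact: (fc_radial_neg ch k r0 r1).
have [_ /(_ n)] := poly_limit_mul Lh ch' PL.
have -> : (fun t => h (r%:C * cis t) * (f (r%:C * cis t) / h (r%:C * cis t))) =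
    (fun t => f (r%:C * cis t)).
  by apply/funext => t; rewrite mulrC divfK.
rewrite (hardy_fc _ hf r0 r1) /cauchy => E.
apply: (mulfI (expf_neq0 n rc)); rewrite E mulr_sumr; apply: eq_bigr => k _.
rewrite cq (hardy_fc _ hh r0 r1).
have kn : (k <= n)%N by rewrite -ltnS ltn_ord.
have -> : r%:C ^+ n = r%:C ^+ k * r%:C ^+ (n - k) :> C by rewrite -exprD subnKC.
by ring.
Qed.

Lemma taylor_star c (l : sphere R -> C) :
  taylor_at_infty c l -> taylor_at0 (conj_seq c) (star l).
Proof.
move=> [r r0 H]; exists r; first exact: r0.
move=> z zr; apply: tends0_cvgC.
have zr' : absc (conjc z) < r by rewrite absc_conj.
have := cvgC_tends0 (H _ zr'); apply: tends0_le => n.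
rewrite -[leRHS]absc_conj conjcB conjc_sum le_eqVlt; apply/orP; left; apply/eqP.
congr (absc (_ - _)); apply: eq_bigr => k _.
by rewrite conjcM conjcX conjcK.
Qed.

End TaylorCoefficients.

(** * Partial products of the root subgroup factors *)

Section RootFactors.
Variable R : realType.
Local Notation cj := (@conjc R).
Local Notation C := R[i].
Local Notation mu := (@lebesgue_measure R).
Local Notation period := (@period R).
Implicit Types (eta zeta : nat -> C).

Lemma ord2 (i : 'I_2) : i = 0 \/ i = 1.
Proof.
by case: i => [[|[|i]] ilt] //; [left | right]; apply/val_inj.
Qed.

Lemma mx2P (M N : 'M[C]_2) : M 0 0 = N 0 0 -> M 0 1 = N 0 1 -> M 1 0 = N 1 0 ->
  M 1 1 = N 1 1 -> M = N.
Proof.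
by move=> h1 h2 h3 h4; apply/matrixP => i j; case: (ord2 i) => ->; case: (ord2 j) => ->.
Qed.

Lemma mulmx2 (M N : 'M[C]_2) i j : (M *m N) i j = M i 0 * N 0 j + M i 1 * N 1 j.
Proof. by rewrite mxE big_ord_recl big_ord1; congr (_ + M i _ * N _ j); exact/val_inj. Qed.

(** The conjugate [diag(1, z)^-1 M diag(1, z)]; it raises the frequency of a root factor by one. *)
Definition cz (z : C) (M : 'M[C]_2) : 'M[C]_2 :=
  mx2 (M 0 0) (z * M 0 1) (z^-1 * M 1 0) (M 1 1).

Lemma czM z (M N : 'M[C]_2) : z != 0 -> cz z (M *m N) = cz z M *m cz z N.
Proof.
move=> z0; apply: mx2P; rewrite !(mulmx2, mxE) /=.
- by field.
- by ring.
- by ring.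
- by field.
Qed.

Definition swap (M : 'M[C]_2) : 'M[C]_2 := mx2 (M 1 1) (M 1 0) (M 0 1) (M 0 0).

Lemma swapM (M N : 'M[C]_2) : swap (M *m N) = swap M *m swap N.
Proof. by apply: mx2P; rewrite /swap !(mulmx2, mxE) /= addrC. Qed.

Definition shift (eta : nat -> C) (n : nat) : C := eta n.+1.

Lemma k1_factor_shift eta n z : z != 0 -> k1_factor eta n.+1 z = cz z (k1_factor (shift eta) n z).
Proof.
move=> z0; have zn : z ^+ n != 0 by rewrite expf_neq0.
apply: mx2P; rewrite /k1_factor /cz /shift !mxE /= ?exprS //.
  by ring.
by rewrite invfM; ring.
Qed.

(** The innermost factor, of index 0, is the rightmost one; the product of all the others is the
    conjugate of a partial product for the shifted sequence. *)
Lemma k1_partial_shift eta n z : z != 0 ->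
  k1_partial eta n.+1 z = cz z (k1_partial (shift eta) n z) *m k1_factor eta 0 z.
Proof.
move=> z0; elim: n => [|n IH]; first by rewrite /= k1_factor_shift.
have -> : k1_partial eta n.+2 z = k1_factor eta n.+2 z *m k1_partial eta n.+1 z by [].
by rewrite IH mulmxA k1_factor_shift // -czM.
Qed.

(* The first row of [k1_partial eta n]; removing the innermost factor shifts [eta]. *)
Fixpoint AB (eta : nat -> C) (n : nat) : {poly C} * {poly C} :=
  let b := ba (eta 0%N) in
  if n is n'.+1 then
    let P := AB (shift eta) n' in
    (b *: (P.1 + eta 0%N *: ('X * P.2)), b *: ('X * P.2 - cj (eta 0%N) *: P.1))
  else (b%:P, (- (b * cj (eta 0%N)))%:P).

Lemma ba_real (t : C) : cj (ba t) = ba t.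
Proof. exact: conj_real. Qed.

Lemma k1_partial_AB eta n t : let z := cis t in
  k1_partial eta n z = mx2 (AB eta n).1.[z] (AB eta n).2.[z]
    (- cj (AB eta n).2.[z]) (cj (AB eta n).1.[z]).
Proof.
move=> z; have z0 : z != 0 := cis_neq0 t.
have zV : z^-1 = cj z by rewrite /z conj_cis.
have bR e : cj (ba e) = ba e := ba_real e.
elim: n eta => [|n IH] eta.
  rewrite /= /k1_factor !hornerC; apply: mx2P; rewrite !mxE /= ?expr0 ?invr1 ?mulr1 ?conjCE.
  - by [].
  - by rewrite mulrN.
  - by rewrite conjcN conjcM bR conjcK opprK.
  - exact/esym/ba_real.
rewrite k1_partial_shift // IH; set P := AB (shift eta) n.
rewrite [AB eta n.+1]/= -/P; set b := ba (eta 0%N); set e := eta 0%N.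
have {}bR : cj b = b by exact: bR.
apply: mx2P; rewrite mulmx2 !mxE /= ?expr0 ?invr1 ?mulr1 ?conjCE -/b -/e;
  rewrite !(hornerZ, hornerD, hornerN, hornerM, hornerX) ?zV;
  rewrite ?(conjcM, conjcD, conjcN, conjcB) ?conjcK ?bR.
all: by ring.
Qed.

Lemma ba_sqr (t : C) : ba t ^+ 2 * (1 + t * cj t) = 1.
Proof.
rewrite mul_conj /ba -rmorphXn -(rmorph1 (real_complex R)) -rmorphD -rmorphM /=.
congr (_%:C); rewrite exprVn sqr_sqrtr; last by rewrite addr_ge0 // sqr_ge0.
by rewrite mulVf // gt_eqF // ltr_pwDl // sqr_ge0.
Qed.

Lemma AB_unit eta n t : let z := cis t in
  (AB eta n).1.[z] * cj (AB eta n).1.[z] + (AB eta n).2.[z] * cj (AB eta n).2.[z] = 1.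
Proof.
move=> z; have zz : z * cj z = 1 by rewrite /z conj_cis divff // cis_neq0.
elim: n eta => [|n IH] eta.
  rewrite /= !hornerC conjcN conjcM ba_real conjcK -[RHS](ba_sqr (eta 0%N)); ring.
rewrite [AB eta n.+1]/=; move: (IH (shift eta)); set P := AB (shift eta) n.
rewrite !(hornerZ, hornerD, hornerN, hornerM, hornerX).
rewrite ?(conjcM, conjcD, conjcN, conjcB) ?conjcK ?ba_real.
set b := ba _; set e := eta 0%N; set p := P.1.[z]; set q := P.2.[z] => h.
have hb : b ^+ 2 * (1 + e * cj e) = 1 := ba_sqr e.
transitivity (b ^+ 2 * (1 + e * cj e) * (p * cj p + (z * cj z) * (q * cj q))).
  by ring.
by rewrite hb zz !mul1r.
Qed.

(** This bound survives in the L2 limit, and it makes products with square integrable entries of [l]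
    and [u] square integrable. *)
Lemma AB_le1 eta n t : absc (AB eta n).1.[cis t] <= 1 /\ absc (AB eta n).2.[cis t] <= 1.
Proof.
have := AB_unit eta n t; rewrite /= !mul_conj -rmorphD => /(congr1 (@complex.Re R)) /=.
set x := absc _; set y := absc _ => h.
have x0 : 0 <= x := absc_ge0 _; have y0 : 0 <= y := absc_ge0 _.
by split; rewrite -(ler_pXn2r (n := 2)) ?nnegrE // expr1n -h ?lerDl ?lerDr sqr_ge0.
Qed.

Lemma k2_factor_swap zeta n z : z != 0 ->
  k2_factor zeta n.+1 z = swap (cz z (k1_factor (shift zeta) n z)).
Proof.
move=> z0; have zn : z ^+ n != 0 by rewrite expf_neq0.
apply: mx2P; rewrite /k2_factor /swap /cz /k1_factor /shift !mxE //= exprS.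
  by rewrite invfM; ring.
by ring.
Qed.

Lemma k2_partial_swap zeta n z : z != 0 ->
  k2_partial zeta n.+1 z = swap (cz z (k1_partial (shift zeta) n z)).
Proof.
move=> z0; elim: n => [|n IH]; first by rewrite /= mulmx1 k2_factor_swap.
have -> : k2_partial zeta n.+2 z = k2_factor zeta n.+2 z *m k2_partial zeta n.+1 z by [].
by rewrite IH k2_factor_swap // -swapM -czM.
Qed.

Lemma k2_partial_AB zeta n t : let z := cis t in let P := AB (shift zeta) n in
  k2_partial zeta n.+1 z = mx2 (cj P.1.[z]) (- cj (('X * P.2).[z])) ('X * P.2).[z] P.1.[z].
Proof.
move=> z P; have z0 : z != 0 := cis_neq0 t.
rewrite k2_partial_swap // k1_partial_AB /swap /cz; apply: mx2P;
  rewrite !mxE /= ?hornerM ?hornerX //.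
by rewrite conjcM /z conj_cis mulrN.
Qed.

Lemma L2_limit_poly (K : nat -> C -> 'M[C]_2) (k : C -> 'M[C]_2) (i j : 'I_2)
  (p : nat -> {poly C}) s :
  L2_limit K k -> (forall n t, K (n + s)%N (cis t) i j = (p n).[cis t]) ->
  poly_limit (fun t => k (cis t) i j) p.
Proof.
move=> H Kp; have [/inL2_L2 Lk lim] := H i j; split=> //.
have LB n : L2 (fun t => K (n + s)%N (cis t) i j - k (cis t) i j).
  by apply: L2B => //; under eq_fun do rewrite Kp; exact: L2_poly.
have lim' : sqL2 (fun z => K (n + s)%N z i j - k z i j) @[n --> \oo] --> 0%E.
  by apply: (@cvg_comp _ _ _ (fun n => n + s)%N _ _ _ _ _ lim); exact: cvg_addnr.
have := @sqL2_tends0 _ (fun n z => K (n + s)%N z i j - k z i j) LB lim'.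
by apply: tends0_le => n; under [X in N2 X]eq_fun do rewrite -Kp.
Qed.

Lemma k1_poly_limit eta k1 : L2_limit (k1_partial eta) k1 ->
  poly_limit (fun t => k1 (cis t) 0 0) (fun n => (AB eta n).1) /\
  poly_limit (fun t => k1 (cis t) 0 1) (fun n => (AB eta n).2).
Proof.
move=> H; split; apply: (@L2_limit_poly _ _ _ _ _ 0%N H) => n t;
  by rewrite addn0 k1_partial_AB !mxE.
Qed.

Lemma k2_poly_limit zeta k2 : L2_limit (k2_partial zeta) k2 ->
  poly_limit (fun t => k2 (cis t) 1 1) (fun n => (AB (shift zeta) n).1) /\
  poly_limit (fun t => k2 (cis t) 1 0) (fun n => 'X * (AB (shift zeta) n).2).
Proof.
move=> H; split; apply: (@L2_limit_poly _ _ _ _ _ 1%N H) => n t;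
  by rewrite addn1 k2_partial_AB !mxE.
Qed.

Lemma k2_det zeta k2 : L2_limit (k2_partial zeta) k2 ->
  {ae mu, forall t, period t -> k2 (cis t) 0 0 * k2 (cis t) 1 1 -
     k2 (cis t) 0 1 * k2 (cis t) 1 0 = 1}.
Proof.
move=> H; pose K n t i j := k2_partial zeta n.+1 (cis t) i j.
have LK n i j : L2 (fun t => K n t i j).
  have := L2_poly (AB (shift zeta) n).1; have := L2_poly ('X * (AB (shift zeta) n).2).
  move=> h1 h2; case: (ord2 i) => ->; case: (ord2 j) => ->;
    rewrite /K; under eq_fun do rewrite k2_partial_AB !mxE /=.
  - exact: L2_conj.
  - by apply: L2N; exact: L2_conj.
  - exact: h1.
  - exact: h2.
have Lk i j : L2 (fun t => k2 (cis t) i j) by case: (H i j) => /inL2_L2.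
have tK i j : tends0 (fun n => N2 (fun t => K n t i j - k2 (cis t) i j)).
  apply: (@sqL2_tends0 _ (fun n z => k2_partial zeta n.+1 z i j - k2 z i j)).
    by move=> n; apply: L2B => //; exact: LK.
  have [_ lim] := H i j.
  by rewrite (cvg_shiftS (fun n => sqL2 (fun z => k2_partial zeta n z i j - k2 z i j))).
apply: (@det1_ae _ (fun n t => K n t 0 0) (fun n t => K n t 0 1) (fun n t => K n t 1 0)
  (fun n t => K n t 1 1)) => //.
move=> n t; rewrite /K k2_partial_AB !mxE /= hornerM hornerX.
have := AB_unit (shift zeta) n t; set P := AB _ _ => /= <-.
have zz : cis t * cj (cis t) = 1 :> C by rewrite conj_cis divff // cis_neq0.
rewrite conjcM; transitivity (P.1.[cis t] * cj P.1.[cis t] +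
   (cis t * cj (cis t)) * (P.2.[cis t] * cj P.2.[cis t])); first by ring.
by rewrite zz mul1r.
Qed.

End RootFactors.

(** * Comparison of the two factorizations *)

Section CoreRelation.
Variable R : realType.
Local Notation C := R[i].
Local Notation mu := (@lebesgue_measure R).
Local Notation period := (@period R).

Lemma W12_bound (f : C -> C) : W12 f -> exists E : R, forall N,
  \sum_(j < N) j%:R * absc (fc (fun t => f (cis t)) j) ^+ 2 <= E.
Proof.
move=> [_ fin]; set a := (fun n : int => _) in fin.
have a0 n : (0 <= a n)%E by rewrite lee_fin mulr_ge0 // sqr_ge0.
exists (fine (\esum_(n in [set: int]) a n)) => N.
have fn : (\esum_(n in [set: int]) a n)%E \is a fin_num.
  by rewrite ge0_fin_numE //; apply: esum_ge0.
rewrite -lee_fin fineK // -sumEFin.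
apply: (@le_trans _ _ (\esum_(n in [set Posz x | x in [set: nat]]) a n)%E).
  rewrite esum_set_image //; last by move=> x y _ _ [].
  rewrite -(big_mkord predT (fun j => (j%:R * absc (fc (fun t => f (cis t)) j) ^+ 2)%:E)).
  have := @nneseries_lim_ge R (fun i => a (Posz i)) (fun i => i \in setT) 0%N N
    (fun n _ _ => a0 (Posz n)).
  apply: le_trans; rewrite le_eqVlt; apply/orP; left; apply/eqP.
  by apply: eq_big => [i|i _ //]; rewrite in_setT.
rewrite [leRHS](esumID [set Posz x | x in [set: nat]]) // setTI leeDl //.
by apply: esum_ge0.
Qed.

Lemma L2Z (c : C) (F : R -> C) : L2 F -> L2 (fun t => c * F t).
Proof.
move=> LF; apply: (L2_le (K := absc c) _ LF).
  by apply: cmeasM; [exact: cmeas_cst | case: LF].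
by apply: aeW => t _; rewrite abscM.
Qed.

Variables (g : C -> 'M[C]_2) (l : sphere R -> 'M[C]_2) (m0 : C) (a0 : R)
  (u : C -> 'M[C]_2) (eta : nat -> C) (chi : C -> C) (zeta : nat -> C)
  (k1 k2 : C -> 'M[C]_2).
Hypothesis tri : triangular_factorization g l m0 a0 u.
Hypothesis chiW : W12 chi.
Hypothesis chi_imag : ae_circle (fun z => complex.Re (chi z) = 0).
Hypothesis k1_lim : L2_limit (k1_partial eta) k1.
Hypothesis k2_lim : L2_limit (k2_partial zeta) k2.
Hypothesis root_eq : ae_circle (fun z =>
  g z = ((k1 z)^t*)%sesqui *m mx2 (cexp (chi z)) 0 0 (cexp (- chi z)) *m k2 z).

Let lam i j := star (fun w => l w i j).

Lemma hardy_lam i j : hardy (lam i j).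
Proof.
apply: hardy_codisk; last exact: (tri_l_bdry tri).
exact: ((tri_l_holo tri).1 i j).
Qed.

Lemma hardy_u i j : hardy (fun z => u z i j).
Proof.
apply: hardy_disk; last exact: (tri_u_bdry tri).
exact: ((tri_u_holo tri).1 i j).
Qed.

Lemma det2 (M : 'M[C]_2) : \det M = M 0 0 * M 1 1 - M 0 1 * M 1 0.
Proof.
rewrite (expand_det_row _ 0) big_ord_recl big_ord1 /cofactor !det_mx11 !mxE /=.
rewrite expr0 expr1 mul1r mulN1r mulrN; congr (_ * M _ _ - M _ _ * M _ _); exact/val_inj.
Qed.

(** The determinant is 1 off the circle. The passage to the boundary is made for the reflected
    entries [lam i j], which are Hardy functions on the disk, and the conjugation is undone at the
    end. *)
Lemma lam_det : {ae mu, forall t, period t ->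
  l (Some (cis t)) 0 0 * l (Some (cis t)) 1 1 - l (Some (cis t)) 0 1 * l (Some (cis t)) 1 0 = 1}.
Proof.
pose K m t i j := lam i j ((rad R m)%:C * cis t).
have LK m i j : L2 (fun t => K m t i j).
  have [ch _ _] := hardy_lam i j.
  by apply: L2_radial => //; rewrite ltW ?rad_gt0 ?rad_lt1.
have Lk i j : L2 (fun t => lam i j (cis t)) by case: (hardy_lam i j).
have tK i j : tends0 (fun m => N2 (fun t => K m t i j - lam i j (cis t))).
  by case: (hardy_lam i j).
have dK m t : K m t 0 0 * K m t 1 1 - K m t 0 1 * K m t 1 0 = 1.
  have w1 : `|@conjc R ((rad R m)%:C * cis t)| < 1.
    by rewrite abscE ltcR absc_conj absc_rcis gtr0_norm ?rad_gt0 ?rad_lt1.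
  have KE i j : K m t i j = @conjc R (l (sphere_inv (@conjc R ((rad R m)%:C * cis t))) i j) by [].
  move: w1 KE; move: (@conjc R ((rad R m)%:C * cis t)) => w w1 KE; rewrite !KE.
  have := (tri_l_holo tri).2 w w1.
  by move=> /(congr1 (@conjc R)); rewrite det2 conjcB !conjcM conjc1 => <-.
have := @det1_ae _ (fun m t => K m t 0 0) (fun m t => K m t 0 1)
  (fun m t => K m t 1 0) (fun m t => K m t 1 1) _ _ _ _
  (fun m => And4 (LK m 0 0) (LK m 0 1) (LK m 1 0) (LK m 1 1))
  (And4 (Lk 0 0) (Lk 0 1) (Lk 1 0) (Lk 1 1)) (tK 0 0) (tK 0 1) (tK 1 0) (tK 1 1) dK.
apply: aeS => t H Dt; have := H Dt; rewrite /lam !star_circle.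
move=> /(congr1 (@conjc R)); rewrite conjcB !conjcM !conjcK => ->.
exact: conjc1.
Qed.

Let A t := k1 (cis t) 0 0.
Let B t := k1 (cis t) 0 1.
Let X t := chi (cis t).

Let Phi t := lam 0 0 (cis t) * B t - lam 1 0 (cis t) * A t.
Let c := (m0 * a0%:C)^-1.
Let Theta t := c * (u (cis t) 1 0 * k2 (cis t) 1 1) - c * (u (cis t) 1 1 * k2 (cis t) 1 0).

Let m0_neq0 : m0 != 0.
Proof. by rewrite -normr_eq0 (tri_m0 tri) oner_neq0. Qed.

Let a0_neq0 : a0%:C != 0.
Proof. by apply/eqP => /complexI h; have := tri_a0 tri; rewrite h ltxx. Qed.

(** This is the lower left entry of [m a u k2^-1 = l^-1 k1^* diag(exp chi, exp (- chi))], where both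
    inverses are adjugates since [l] and [k2] have determinant 1 almost everywhere. *)
Let Phi_Theta : {ae mu, forall t, period t -> cexp (X t) * conjc (Phi t) = Theta t}.
Proof.
have H := aeI (aeI lam_det (k2_det k2_lim)) (aeI (tri_eq tri) root_eq).
apply: aeS H => t [[dl dk] [e1 e2]] Dt.
have {}dl := dl Dt; have {}dk := dk Dt; rewrite e1 in e2.
have e00 := congr1 (fun M : 'M[C]_2 => M 0 0) e2.
have e01 := congr1 (fun M : 'M[C]_2 => M 0 1) e2.
have e10 := congr1 (fun M : 'M[C]_2 => M 1 0) e2.
have e11 := congr1 (fun M : 'M[C]_2 => M 1 1) e2.
move: e00 e01 e10 e11; rewrite !(mulmx2, mxE) /= !conjCE /Phi /Theta /X /A /B /lam !star_circle.
rewrite conjcB !conjcM !conjcK /c invfM.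
move: dl dk; set z := cis t.
move: (l (Some z) 0 0) (l (Some z) 0 1) (l (Some z) 1 0) (l (Some z) 1 1) => l00 l01 l10 l11.
move: (u z 0 0) (u z 0 1) (u z 1 0) (u z 1 1) => u00 u01 u10 u11.
move: (k2 z 0 0) (k2 z 0 1) (k2 z 1 0) (k2 z 1 1) => k00 k01 k10 k11.
move: (cexp (chi z)) (cexp (- chi z)) (a0%:C) (a0%:C)^-1 m0^-1 => ex ex' a ai mi.
set q00 := conjc (k1 z 0 0); set q01 := conjc (k1 z 0 1).
set q10 := conjc (k1 z 1 0); set q11 := conjc (k1 z 1 1).
move=> dl dk; rewrite !(mulr0, mul0r, addr0, add0r) => e00 e01 e10 e11.
transitivity ((k00 * k11 - k01 * k10) * (ex * (l00 * q01 - l10 * q00))).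
  by rewrite dk mul1r.
transitivity ((l00 * l11 - l01 * l10) * (mi * ai * (u10 * k11) - mi * ai * (u11 * k10))); last first.
  by rewrite dl mul1r.
transitivity (k11 * (l00 * (l10 * m0 * a * u00 + l11 * mi * ai * u10)
     - l10 * (l00 * m0 * a * u00 + l01 * mi * ai * u10))
   - k10 * (l00 * (l10 * m0 * a * u01 + l11 * mi * ai * u11)
     - l10 * (l00 * m0 * a * u01 + l01 * mi * ai * u11))); last by ring.
rewrite e00 e01 e10 e11; ring.
Qed.

Let pA := (k1_poly_limit k1_lim).1.
Let pB := (k1_poly_limit k1_lim).2.
Let pD := (k2_poly_limit k2_lim).1.
Let pE := (k2_poly_limit k2_lim).2.

Let bound_limit (F : R -> C) (p : nat -> {poly C}) : poly_limit F p ->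
  (forall n t, absc (p n).[cis t] <= 1) -> {ae mu, forall t, period t -> absc (F t) <= 1}.
Proof.
move=> [LF tF]; apply: (@bound1_ae _ (fun n t => (p n).[cis t])) => // n; exact: L2_poly.
Qed.

Let A1 := bound_limit pA (fun n t => (AB_le1 eta n t).1).
Let B1 := bound_limit pB (fun n t => (AB_le1 eta n t).2).
Let D1 := bound_limit pD (fun n t => (AB_le1 (shift zeta) n t).1).

Let E1 : {ae mu, forall t, period t -> absc (k2 (cis t) 1 0) <= 1}.
Proof.
apply: (bound_limit pE) => n t; rewrite hornerM hornerX abscM absc_cis mul1r.
by case: (AB_le1 (shift zeta) n t).
Qed.

Let L2lam i j : L2 (fun t => lam i j (cis t)).
Proof. by case: (hardy_lam i j). Qed.

Let L2u i j : L2 (fun t => u (cis t) i j).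
Proof. by case: (hardy_u i j). Qed.

Let LlB : L2 (fun t => lam 0 0 (cis t) * B t) := L2Mb (L2lam 0 0) pB.1.1 B1.
Let LlA : L2 (fun t => lam 1 0 (cis t) * A t) := L2Mb (L2lam 1 0) pA.1.1 A1.
Let LuD : L2 (fun t => u (cis t) 1 0 * k2 (cis t) 1 1) := L2Mb (L2u 1 0) pD.1.1 D1.
Let LuE : L2 (fun t => u (cis t) 1 1 * k2 (cis t) 1 0) := L2Mb (L2u 1 1) pE.1.1 E1.

Let LPhi : L2 Phi := L2B LlB LlA.
Let LTheta : L2 Theta := L2B (L2Z c LuD) (L2Z c LuE).

Let hlB := poly_limit_mul (L2lam 0 0) (hardy_causal (hardy_lam 0 0)) pB.
Let hlA := poly_limit_mul (L2lam 1 0) (hardy_causal (hardy_lam 1 0)) pA.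
Let huD := poly_limit_mul (L2u 1 0) (hardy_causal (hardy_u 1 0)) pD.
Let huE := poly_limit_mul (L2u 1 1) (hardy_causal (hardy_u 1 1)) pE.

Let fcPhi n : fc Phi n = fc (fun t => lam 0 0 (cis t) * B t) n -
  fc (fun t => lam 1 0 (cis t) * A t) n.
Proof. by apply: fcB; exact: L2_cintegrable. Qed.

Let fcTheta n : fc Theta n = c * fc (fun t => u (cis t) 1 0 * k2 (cis t) 1 1) n -
  c * fc (fun t => u (cis t) 1 1 * k2 (cis t) 1 0) n.
Proof.
rewrite fcB; [|exact: L2_cintegrable (L2Z c LuD)|exact: L2_cintegrable (L2Z c LuE)].
by congr (_ - _); apply: fcZ; exact: L2_cintegrable.
Qed.

Let Phi_causal : causal Phi.
Proof. by move=> n; rewrite fcPhi hlB.1 hlA.1 subrr. Qed.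

Let Theta_causal : causal Theta.
Proof. by move=> n; rewrite fcTheta huD.1 huE.1 mulr0 subrr. Qed.

Let u0_10 : u 0 1 0 = 0.
Proof. by have := tri_u_0 tri => /(congr1 (fun M : 'M[C]_2 => M 1 0)); rewrite mxE. Qed.

Lemma u0_11 : u 0 1 1 = 1.
Proof. by have := tri_u_0 tri => /(congr1 (fun M : 'M[C]_2 => M 1 1)); rewrite mxE. Qed.

Lemma lam0_00 : lam 0 0 0 = 1.
Proof.
rewrite /lam /star conjc0 /sphere_inv eqxx (tri_l_infty tri) mxE /=.
exact: conjc1.
Qed.

Let fcE0 : fc (fun t => k2 (cis t) 1 0) 0 = 0.
Proof.
apply: (absc_lim_unique (poly_limit_coef 0%N pE)).
by apply: tends0_cst0 => m; rewrite coefXM.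
Qed.

Let Theta0 : fc Theta 0 = 0.
Proof.
rewrite fcTheta (huD.2 0%N) (huE.2 0%N) /cauchy !big_ord_recl !big_ord0 /= !addr0.
by rewrite fcE0 (hardy_fc0 (hardy_u 1 0)) u0_10 mulr0 mul0r mulr0 subrr.
Qed.

Let LX : L2 X := inL2_L2 chiW.1.

Let X_imag : {ae mu, forall t, period t -> complex.Re (X t) = 0}.
Proof. by apply: aeS chi_imag => t H _. Qed.

Let Phi0 (n : nat) : fc Phi n = 0.
Proof.
have [E XE] := W12_bound chiW.
exact: (scalar_factorization_fc0 LX X_imag XE LPhi Phi_causal LTheta.1 Theta_causal
  Theta0 Phi_Theta n).
Qed.

(* Conjugating the relation exchanges the roles of Phi and Theta, as exp X is unimodular. *)
Let Theta_Phi : {ae mu, forall t, period t -> cexp (X t) * conjc (Theta t) = Phi t}.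
Proof.
apply: aeS (aeI X_imag Phi_Theta) => t [h1 h2] Dt.
rewrite -(h2 Dt) conjcM conjcK mulrA mul_conj absc_cexp (h1 Dt) expR0 expr1n.
by rewrite mul1r.
Qed.

Let Theta_fc0 (n : nat) : fc Theta n = 0.
Proof.
have [E XE] := W12_bound chiW.
exact: (scalar_factorization_fc0 LX X_imag XE LTheta Theta_causal LPhi.1 Phi_causal
  (Phi0 0%N) Theta_Phi n).
Qed.

(** The vanishing of [Phi] says that [lam 0 0 * B = lam 1 0 * A] as power series. The product form
    is kept because the constant term of [A] is seen to be nonzero only later, from the decay of
    [eta]. *)
Lemma k1_row_quotient psi : taylor_at0 psi (fun z => lam 1 0 z / lam 0 0 z) ->
  forall n : nat, fc B n = cauchy psi (fun k : nat => fc A k) n.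
Proof.
move=> tpsi.
apply: (@cauchy_quotient _ _ (fun k : nat => fc B k) _ (fun k : nat => fc (fun t => lam 0 0 (cis t)) k)
  (fun k : nat => fc (fun t => lam 1 0 (cis t)) k)).
- by rewrite (hardy_fc0 (hardy_lam 0 0)) lam0_00 oner_neq0.
- move=> n; have := Phi0 n; rewrite fcPhi hlB.2 hlA.2 => /eqP.
  by rewrite subr_eq0 => /eqP.
- by move=> n; exact: (taylor_quotient n (hardy_lam 1 0) (hardy_lam 0 0) lam0_00 tpsi).
Qed.

Lemma k2_row_quotient xi : taylor_at0 xi (fun z => u z 1 0 / u z 1 1) ->
  forall n : nat, fc (fun t => k2 (cis t) 1 0) n =
    cauchy xi (fun k : nat => fc (fun t => k2 (cis t) 1 1) k) n.
Proof.
move=> txi.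
apply: (@cauchy_quotient _ _ (fun k : nat => fc (fun t => k2 (cis t) 1 0) k) _
  (fun k : nat => fc (fun t => u (cis t) 1 1) k) (fun k : nat => fc (fun t => u (cis t) 1 0) k)).
- by rewrite (hardy_fc0 (hardy_u 1 1)) u0_11 oner_neq0.
- move=> n; have := Theta_fc0 n; rewrite fcTheta huD.2 huE.2 -mulrBr => /eqP.
  rewrite mulf_eq0 /c invr_eq0 mulf_eq0 (negbTE m0_neq0) (negbTE a0_neq0) /=.
  by rewrite subr_eq0 => /eqP /esym.
- by move=> n; exact: (taylor_quotient n (hardy_u 1 0) (hardy_u 1 1) u0_11 txi).
Qed.

End CoreRelation.

(** * Division of power series *)

Section PowerSeriesDivision.
Variable K : fieldType.

(** Course-of-values recursion: each coefficient of the quotient depends on all earlier ones, which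
    are collected in a list. *)
Fixpoint quo_seq (e d : nat -> K) (n : nat) : seq K :=
  if n is n'.+1 then
    let s := quo_seq e d n' in
    rcons s ((e n' - \sum_(k < n') nth 0 s k * d (n' - k)%N) / d 0%N)
  else [::].

Definition quo (e d : nat -> K) (n : nat) : K := nth 0 (quo_seq e d n.+1) n.

Lemma size_quo_seq e d n : size (quo_seq e d n) = n.
Proof. by elim: n => [|n IH] //=; rewrite size_rcons IH. Qed.

Lemma nth_quo_seq e d n k : (k < n)%N -> nth 0 (quo_seq e d n) k = quo e d k.
Proof.
elim: n => [//|n IH]; rewrite ltnS leq_eqVlt => /orP[/eqP-> //|kn].
by rewrite /= nth_rcons size_quo_seq kn IH.
Qed.

Lemma quoE e d n :
  quo e d n = (e n - \sum_(k < n) quo e d k * d (n - k)%N) / d 0%N.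
Proof.
rewrite {1}/quo /= nth_rcons size_quo_seq ltnn eqxx; congr ((_ - _) / _).
by apply: eq_bigr => k _; rewrite nth_quo_seq.
Qed.

Lemma cauchy_quo e d n : d 0%N != 0 -> cauchy (quo e d) d n = e n.
Proof.
move=> d0; rewrite /cauchy big_ord_recr /= subnn quoE divfK //.
by rewrite addrC subrK.
Qed.

End PowerSeriesDivision.

(** * The Schur algorithm *)

Section SchurAlgorithm.
Variable R : realType.
Local Notation C := R[i].
Local Notation cj := (@conjc R).
Implicit Types (eta psi a b : nat -> C).

(** The classical Schur step for functions bounded by 1 on the disk has [1 - conj psi_0 psi] in the
    denominator. The plus sign is that of the compact group SU(2), and it makes the constant term
    [1 + |psi_0|^2] positive for every sequence. *)
Definition schur psi : nat -> C :=
  quo (fun n => psi n.+1) (fun n => (n == 0%N)%:R + cj (psi 0%N) * psi n).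

Definition lim_AB eta a b := forall n,
  tends0 (fun m => absc ((AB eta m).1`_n - a n)) /\
  tends0 (fun m => absc ((AB eta m).2`_n - b n)).

Let shift_a eta a b n := ba (eta 0%N) * (a n - eta 0%N * b n).
Let shift_b eta a b n := ba (eta 0%N) * (cj (eta 0%N) * a n + b n).

(** One step of the recursion applies a constant unitary matrix to [(P.1, X P.2)]; its inverse is
    its adjoint, by [ba_sqr]. *)
Lemma AB_unshift eta m : let P := AB (shift eta) m in let Q := AB eta m.+1 in
  (forall n, P.1`_n = ba (eta 0%N) * (Q.1`_n - eta 0%N * Q.2`_n)) /\
  (forall n, ('X * P.2)`_n = ba (eta 0%N) * (cj (eta 0%N) * Q.1`_n + Q.2`_n)).
Proof.
move=> P; rewrite [AB eta m.+1]/= -/P /=.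
have h := ba_sqr (eta 0%N); set b := ba (eta 0%N) in h *; set e := eta 0%N in h *.
split=> n; rewrite !coefZ !(coefD, coefN, coefZ) ?coefZ; set x := ('X * P.2)`_n.
  rewrite -[LHS]mul1r -h; ring.
rewrite -[LHS]mul1r -h; ring.
Qed.

Lemma tends0_lin (u v : nat -> C) (x y p q : C) :
  tends0 (fun m => absc (u m - x)) -> tends0 (fun m => absc (v m - y)) ->
  tends0 (fun m => absc ((p * u m + q * v m) - (p * x + q * y))).
Proof.
move=> hu hv.
apply: tends0_le (tends0D (tends0Z (absc_ge0 p) hu) (tends0Z (absc_ge0 q) hv)) => m.
have -> : p * u m + q * v m - (p * x + q * y) = p * (u m - x) + q * (v m - y) by ring.
by apply: le_trans (abscD _ _) _; rewrite !abscM.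
Qed.

(** The second part is the equation that determines [eta 0]: the polynomial [X P.2] has no constant
    term, so in the limit [conj (eta 0) * a 0 + b 0 = 0]. *)
Lemma lim_AB_shift eta a b : lim_AB eta a b ->
  [/\ lim_AB (shift eta) (shift_a eta a b) (fun n => shift_b eta a b n.+1) &
      shift_b eta a b 0%N = 0].
Proof.
move=> H; have H1 n := tends0_shift 1 (H n).1; have H2 n := tends0_shift 1 (H n).2.
set be := ba (eta 0%N); set e := eta 0%N.
have ha n : tends0 (fun m => absc ((AB (shift eta) m).1`_n - shift_a eta a b n)).
  apply: tends0_le (tends0_lin be (- (be * e)) (H1 n) (H2 n)) => m.
  have [h _] := AB_unshift eta m; rewrite h addn1 /shift_a -/be -/e.
  set Q := AB eta m.+1; rewrite le_eqVlt; apply/orP; left; apply/eqP.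
  by congr absc; ring.
have hb n : tends0 (fun m => absc (('X * (AB (shift eta) m).2)`_n - shift_b eta a b n)).
  apply: tends0_le (tends0_lin (be * cj e) be (H1 n) (H2 n)) => m.
  have [_ h] := AB_unshift eta m; rewrite h addn1 /shift_b -/be -/e.
  set Q := AB eta m.+1; rewrite le_eqVlt; apply/orP; left; apply/eqP.
  by congr absc; ring.
split.
  move=> n; split; first exact: ha.
  by apply: tends0_le (hb n.+1) => m; rewrite coefXM.
apply: esym; apply: (@absc_lim_unique _ _ _ (fun=> 0)); first exact: tends0_cst0.
by apply: tends0_le (hb 0%N) => m; rewrite coefXM.
Qed.

Lemma ba_neq0 (t : C) : ba t != 0.
Proof.
by apply/eqP => h; have := ba_sqr t; rewrite h expr0n mul0r => /eqP; rewrite eq_sym oner_eq0.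
Qed.

Lemma one_plus_neq0 (t : C) : 1 + t * cj t != 0.
Proof.
by apply/eqP => h; have := ba_sqr t; rewrite h mulr0 => /eqP; rewrite eq_sym oner_eq0.
Qed.

Lemma schur_step eta a b psi : lim_AB eta a b -> a 0%N != 0 ->
  (forall n, b n = cauchy psi a n) ->
  eta 0%N = - cj (psi 0%N) /\
  exists a' b', [/\ lim_AB (shift eta) a' b', a' 0%N != 0 &
    forall n, b' n = cauchy (schur psi) a' n].
Proof.
move=> H a0 ba_; have [H' sb0] := lim_AB_shift H.
set be := ba (eta 0%N) in sb0; have be0 : be != 0 := ba_neq0 _.
have psi0 : psi 0%N = - cj (eta 0%N).
  apply: (mulIf a0); have := ba_ 0%N; rewrite /cauchy big_ord1 subn0 => <-.
  move: sb0; rewrite /shift_b -/be => /eqP; rewrite mulf_eq0 (negbTE be0) /=.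
  by rewrite addr_eq0 => /eqP h; rewrite mulNr h opprK.
have e0 : eta 0%N = - cj (psi 0%N) by rewrite psi0 conjcN conjcK opprK.
split=> //; exists (shift_a eta a b), (fun n => shift_b eta a b n.+1).
pose d n := (n == 0%N)%:R + cj (psi 0%N) * psi n.
have d0 : d 0%N != 0 by rewrite /d eqxx mulrC one_plus_neq0.
have cauchy1 (f : nat -> C) n : cauchy (fun n => (n == 0%N)%:R) f n = f n.
  rewrite /cauchy big_ord_recl /= mul1r subn0 big1 ?addr0 // => k _.
  by rewrite mul0r.
(* With [b = psi a], the new pair is [be] times [d a] and [be] times [z^-1 (psi - psi_0) a]; the
   common factor [be * a] drops out of the quotient, which is [schur psi]. *)
have ad n : shift_a eta a b n = be * cauchy d a n.
  rewrite /shift_a -/be e0 ba_; congr (_ * _).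
  rewrite mulNr opprK -(cauchy1 a n) /cauchy mulr_sumr -big_split /=.
  by apply: eq_bigr => k _; rewrite /d mulrDl mulrA.
have bd n : shift_b eta a b n.+1 = be * cauchy (fun n => psi n.+1) a n.
  rewrite /shift_b -/be ba_; congr (_ * _).
  rewrite /cauchy big_ord_recl subn0 psi0 mulNr addrA addrN add0r.
  by apply: eq_bigr => k _; rewrite /= subSS.
split => //.
  by rewrite ad /cauchy big_ord1 subnn !mulf_neq0.
move=> n; rewrite bd.
have -> : cauchy (schur psi) (shift_a eta a b) n = be * cauchy (schur psi) (cauchy d a) n.
  rewrite /cauchy mulr_sumr; apply: eq_bigr => k _; rewrite ad mulrCA //.
congr (_ * _); rewrite -cauchyA; apply: eq_cauchy => // k _.
by rewrite cauchy_quo.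
Qed.

Lemma schur_eta eta a b psi : lim_AB eta a b -> a 0%N != 0 ->
  (forall n, b n = cauchy psi a n) ->
  forall i, eta i = - cj (iter i schur psi 0%N).
Proof.
move=> H a0 hb i; elim: i eta a b psi H a0 hb => [|i IH] eta a b psi H a0 hb.
  by case: (schur_step H a0 hb).
have [_ [a' [b' [H' a'0 hb']]]] := schur_step H a0 hb.
by rewrite iterSr -(IH _ _ _ _ H' a'0 hb').
Qed.

(** The constant coefficient is the product of the [ba (eta j)], and
    [sqrt (1 + x) <= 1 + x <= exp x] with [x = |eta j|^2]. Square summability thus keeps it away
    from 0 in the limit. *)
Lemma AB_coef0_ge eta m :
  expR (- \sum_(j < m.+1) absc (eta j) ^+ 2) <= complex.Re (AB eta m).1`_0 /\
  complex.Im (AB eta m).1`_0 = 0.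
Proof.
have ba_ge (t : C) : expR (- absc t ^+ 2) <= (Num.sqrt (1 + absc t ^+ 2))^-1.
  have x1 : 1 <= 1 + absc t ^+ 2 by rewrite lerDl sqr_ge0.
  have x0 : 0 < 1 + absc t ^+ 2 by exact: lt_le_trans x1.
  rewrite expRN lef_pV2 ?posrE ?expR_gt0 ?sqrtr_gt0 //.
  apply: le_trans (expR_ge1Dx _).
  rewrite -[leRHS](ger0_norm (ltW x0)) -sqrtr_sqr ler_wsqrtr // expr2 ler_peMl //.
  exact: ltW.
elim: m eta => [|m IH] eta.
  by rewrite big_ord1 /= coefC eqxx /=; split; first exact: ba_ge.
have [h1 h2] := IH (shift eta).
have -> : (AB eta m.+1).1`_0 = ba (eta 0%N) * (AB (shift eta) m).1`_0.
  by rewrite /= coefZ coefD coefZ coefXM eqxx mulr0 addr0.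
rewrite ReM ImM h2 /= !mulr0 mul0r subr0 addr0; split=> //.
rewrite big_ord_recl opprD expRD; by apply: ler_pM; rewrite ?expR_ge0 //.
Qed.

Lemma lim_AB_coef0 eta a b (S : R) : lim_AB eta a b ->
  (forall m, \sum_(j < m) absc (eta j) ^+ 2 <= S) -> a 0%N != 0.
Proof.
move=> H hS; apply/eqP => a0.
have : tends0 (fun=> expR (- S)).
  apply: tends0_le (H 0%N).1 => m; rewrite a0 subr0.
  have [h _] := AB_coef0_ge eta m.
  apply: le_trans (Re_le_absc _); apply: le_trans (ler_norm _); apply: le_trans h.
  by rewrite ler_expR lerN2.
by move/tends0_ge0; rewrite leNgt expR_gt0.
Qed.

(** The weight [n] is at least 1 except at [n = 0], where it vanishes; hence the shifted index, with
    the term [eta 0] added separately in [eta_schur]. *)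
Lemma decay_sum eta : W12_decay eta -> exists S : R,
  forall m, \sum_(j < m) absc (eta j.+1) ^+ 2 <= S.
Proof.
rewrite /W12_decay; set T := (X in (X < +oo)%E) => fin.
have a0 n : (0 <= (n%:R * absc (eta n) ^+ 2)%:E)%E by rewrite lee_fin mulr_ge0 // sqr_ge0.
have T0 : (0 <= T)%E by apply: nneseries_ge0.
have fT : T \is a fin_num by rewrite ge0_fin_numE.
exists (fine T) => m.
have := @nneseries_lim_ge R (fun n => (n%:R * absc (eta n) ^+ 2)%:E) xpredT 0%N m.+1
  (fun n _ _ => a0 n).
rewrite big_mkord sumEFin -/T -(fineK fT) lee_fin; apply: le_trans.
rewrite big_ord_recl mul0r add0r; apply: ler_sum => j _.
by rewrite ler_peMl ?sqr_ge0 // ler1n.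
Qed.

End SchurAlgorithm.

(** * Polynomial and rational dependence on coefficient sequences *)

Section RationalFunctionals.
Variable R : realType.
Local Notation C := R[i].
Local Notation cj := (@conjc R).
Implicit Types (x y psi : nat -> C).

(** A polynomial is required for every large number of variables, so that two functionals can always
    be written in the same ring. *)
Definition polynomial_in (F : (nat -> C) -> (nat -> C) -> C) : Prop :=
  exists N0, forall N, (N0 <= N)%N -> exists P : mpoly.mpoly (N + N) C,
    forall x y, eval2 P x y = F x y.

Lemma poly_cst (c : C) : polynomial_in (fun _ _ => c).
Proof.
exists 0%N => N _; exists (mpoly.mpolyC _ c) => x y; exact: mpoly.mevalC.
Qed.

Lemma poly_left k : polynomial_in (fun x _ => x k).
Proof.
exists k.+1 => N kN.
exists (mpoly.mpolyX C (mpoly.mnm1 (lshift N (Ordinal kN)))) => x y.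
rewrite /eval2 mpoly.mevalXU; case: splitP => j /= E; first by congr x.
by have := ltn_ord j; lia.
Qed.

Lemma poly_right k : polynomial_in (fun _ y => y k).
Proof.
exists k.+1 => N kN.
exists (mpoly.mpolyX C (mpoly.mnm1 (rshift N (Ordinal kN)))) => x y.
rewrite /eval2 mpoly.mevalXU; case: splitP => j /= E.
  by have := ltn_ord j; lia.
by congr y; lia.
Qed.

Lemma poly_add F G : polynomial_in F -> polynomial_in G ->
  polynomial_in (fun x y => F x y + G x y).
Proof.
move=> [M HM] [N HN]; exists (maxn M N) => k; rewrite geq_max => /andP[Mk Nk].
have [P HP] := HM k Mk; have [Q HQ] := HN k Nk.
by eexists => x y; rewrite -HP -HQ; exact: mpoly.mevalD.
Qed.

Lemma poly_mul F G : polynomial_in F -> polynomial_in G ->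
  polynomial_in (fun x y => F x y * G x y).
Proof.
move=> [M HM] [N HN]; exists (maxn M N) => k; rewrite geq_max => /andP[Mk Nk].
have [P HP] := HM k Mk; have [Q HQ] := HN k Nk.
by eexists => x y; rewrite -HP -HQ; exact: mpoly.mevalM.
Qed.

Lemma poly_opp F : polynomial_in F -> polynomial_in (fun x y => - F x y).
Proof.
move=> [M HM]; exists M => k Mk; have [P HP] := HM k Mk.
by eexists => x y; rewrite -HP; exact: mpoly.mevalN.
Qed.

(* Both [F] and its conjugate are required to be rational, which makes the
   class trivially stable under conjugation. *)
Definition rational_in (F : (nat -> C) -> C) : Prop :=
  exists P Q P' Q', [/\ polynomial_in P, polynomial_in Q, polynomial_in P' & polynomial_in Q'] /\
    forall psi, let c := conj_seq psi in
      [/\ Q psi c != 0, Q' psi c != 0, F psi = P psi c / Q psi c &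
          cj (F psi) = P' psi c / Q' psi c].

Lemma rational_cst (c : C) : rational_in (fun=> c).
Proof.
exists (fun _ _ => c), (fun _ _ => 1), (fun _ _ => cj c), (fun _ _ => 1).
by split; [split; exact: poly_cst | move=> psi /=; rewrite !divr1 oner_neq0].
Qed.

Lemma rational_coef k : rational_in (fun psi => psi k).
Proof.
exists (fun x _ => x k), (fun _ _ => 1), (fun _ y => y k), (fun _ _ => 1).
split; last by move=> psi /=; rewrite !divr1 oner_neq0.
by split; [exact: poly_left | exact: poly_cst | exact: poly_right | exact: poly_cst].
Qed.

Lemma rational_conj F : rational_in F -> rational_in (fun psi => cj (F psi)).
Proof.
move=> [P [Q [P' [Q' [[p1 p2 p3 p4] H]]]]]; exists P', Q', P, Q; split => // psi /=.
by have [h1 h2 h3 h4] := H psi; split; rewrite ?conjcK.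
Qed.

Lemma rational_opp F : rational_in F -> rational_in (fun psi => - F psi).
Proof.
move=> [P [Q [P' [Q' [[p1 p2 p3 p4] H]]]]].
exists (fun x y => - P x y), Q, (fun x y => - P' x y), Q'.
split; first by split=> //; exact: poly_opp.
by move=> psi /=; have [h1 h2 h3 h4] := H psi; rewrite conjcN h4 h3 !mulNr.
Qed.

Lemma rational_mul F G : rational_in F -> rational_in G ->
  rational_in (fun psi => F psi * G psi).
Proof.
move=> [P [Q [P' [Q' [[p1 p2 p3 p4] H]]]]] [S [T [S' [T' [[s1 s2 s3 s4] H']]]]].
exists (fun x y => P x y * S x y), (fun x y => Q x y * T x y),
  (fun x y => P' x y * S' x y), (fun x y => Q' x y * T' x y).
split; first by split; exact: poly_mul.
move=> psi /=; have [h1 h2 h3 h4] := H psi; have [k1 k2 k3 k4] := H' psi.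
by split; rewrite ?mulf_neq0 // ?conjcM ?h4 ?k4 ?h3 ?k3 mulf_div.
Qed.

Lemma rational_add F G : rational_in F -> rational_in G ->
  rational_in (fun psi => F psi + G psi).
Proof.
move=> [P [Q [P' [Q' [[p1 p2 p3 p4] H]]]]] [S [T [S' [T' [[s1 s2 s3 s4] H']]]]].
exists (fun x y => P x y * T x y + S x y * Q x y), (fun x y => Q x y * T x y),
  (fun x y => P' x y * T' x y + S' x y * Q' x y), (fun x y => Q' x y * T' x y).
split; first by split; try (apply: poly_add); exact: poly_mul.
move=> psi /=; have [h1 h2 h3 h4] := H psi; have [k1 k2 k3 k4] := H' psi.
by split; rewrite ?mulf_neq0 // ?conjcD ?h4 ?k4 ?h3 ?k3 addf_div.
Qed.

Lemma rational_inv F : (forall psi, F psi != 0) -> rational_in F ->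
  rational_in (fun psi => (F psi)^-1).
Proof.
move=> F0 [P [Q [P' [Q' [[p1 p2 p3 p4] H]]]]]; exists Q, P, Q', P'; split => // psi /=.
have [h1 h2 h3 h4] := H psi.
have nz (a b : C) : a / b != 0 -> a != 0.
  by apply: contra => /eqP->; rewrite mul0r.
split.
- by have := F0 psi; rewrite h3; exact: nz.
- have F0' : cj (F psi) != 0 by rewrite conjc_eq0.
  by move: F0'; rewrite h4; exact: nz.
- by rewrite h3 invf_div.
- by have := conjc_inv (F psi) => ->; rewrite h4 invf_div.
Qed.

Lemma rational_sum (n : nat) (F : nat -> (nat -> C) -> C) :
  (forall k, (k < n)%N -> rational_in (F k)) ->
  rational_in (fun psi => \sum_(k < n) F k psi).
Proof.
elim: n => [|n IH] H.
  by under eq_fun do rewrite big_ord0; exact: rational_cst.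
under eq_fun do rewrite big_ord_recr /=.
apply: rational_add; last exact: H.
by apply: IH => k kn; apply: H; exact: ltnW.
Qed.

Lemma rational_quo (e d : (nat -> C) -> nat -> C) :
  (forall k, rational_in (fun psi => e psi k)) ->
  (forall k, rational_in (fun psi => d psi k)) -> (forall psi, d psi 0%N != 0) ->
  forall n, rational_in (fun psi => quo (e psi) (d psi) n).
Proof.
move=> re rd d0; elim/ltn_ind => n IH.
under eq_fun do rewrite quoE.
apply: rational_mul; last exact: rational_inv.
apply: rational_add => //; apply: rational_opp.
apply: (@rational_sum n (fun k psi => quo (e psi) (d psi) k * d psi (n - k)%N)).
by move=> k kn; apply: rational_mul => //; exact: IH.
Qed.

Lemma rational_schur i n : rational_in (fun psi => iter i (@schur R) psi n).
Proof.
elim: i n => [|i IH] n; first exact: rational_coef.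
rewrite /= /schur.
apply: rational_quo => [k|k|psi]; first exact: IH.
- apply: rational_add; first exact: rational_cst.
  by apply: rational_mul => //; exact: rational_conj.
- by rewrite eqxx mulrC one_plus_neq0.
Qed.

Lemma rational_eval2 F : rational_in F ->
  exists (N : nat) (P Q : mpoly.mpoly (N + N) C), forall psi,
    eval2 Q psi (conj_seq psi) != 0 /\
    F psi = eval2 P psi (conj_seq psi) / eval2 Q psi (conj_seq psi).
Proof.
move=> [P [Q [P' [Q' [[[M HM] [N HN] _ _] H]]]]].
have [p Hp] := HM (maxn M N) (leq_maxl _ _).
have [q Hq] := HN (maxn M N) (leq_maxr _ _).
exists (maxn M N), p, q => psi; rewrite Hp Hq.
by have [] := H psi.
Qed.

Lemma polynomial_eval2 F : polynomial_in F ->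
  exists (N : nat) (P : mpoly.mpoly (N + N) C), forall x y, eval2 P x y = F x y.
Proof. by move=> [N /(_ N (leqnn N))[P HP]]; exists N, P. Qed.

(** The triangular system is solved by [psi_n = x_n - sum_(k < n) psi_k y_(n-k)], free of division
    because [y_0 = 1]. The functional is chosen before the sequences; the inner induction on [m]
    builds it one summand at a time. *)
Lemma polynomial_quotient n : exists F, polynomial_in F /\
  forall x y psi : nat -> C, y 0%N = 1 -> (forall m, x m = cauchy psi y m) ->
  psi n = F x y.
Proof.
elim/ltn_ind: n => n IH.
have H m : (m <= n)%N -> exists F, polynomial_in F /\
    forall x y psi : nat -> C, y 0%N = 1 -> (forall m, x m = cauchy psi y m) ->
    \sum_(k < m) psi k * y (n - k)%N = F x y.
  elim: m => [|m IHm] mn.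
    exists (fun _ _ => 0); split; first exact: poly_cst.
    by move=> x y psi _ _; rewrite big_ord0.
  have [F [pF HF]] := IHm (ltnW mn); have [G [pG HG]] := IH m mn.
  exists (fun x y => F x y + G x y * y (n - m)%N); split.
    by apply: poly_add => //; apply: poly_mul => //; exact: poly_right.
  by move=> x y psi y0 xy; rewrite big_ord_recr /= (HF x y psi) // (HG x y psi).
have [F [pF HF]] := H n (leqnn n); exists (fun x y => x n - F x y); split.
  by apply: poly_add; [exact: poly_left | exact: poly_opp].
move=> x y psi y0 xy; rewrite -(HF x y psi) // xy /cauchy big_ord_recr /= subnn y0 mulr1.
by rewrite addrAC subrr add0r.
Qed.

End RationalFunctionals.

(** * The root parameters in terms of the Taylor coefficients *)

Section RootParameters.
Variable R : realType.
Local Notation C := R[i].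
Variables (g : C -> 'M[C]_2) (l : sphere R -> 'M[C]_2) (m0 : C) (a0 : R)
  (u : C -> 'M[C]_2).
Hypothesis tri : triangular_factorization g l m0 a0 u.

Lemma eta_schur eta chi zeta psi : root_subgroup_factorization g eta chi zeta ->
  taylor_at0 psi (fun z => star (fun w => l w 1 0) z / star (fun w => l w 0 0) z) ->
  forall i, eta i = - conjc (iter i (@schur R) psi 0%N).
Proof.
move=> [dec_eta _ chiW chi_imag [k1 [k2 [k1_lim k2_lim root_eq]]]] tpsi.
have [pA pB] := k1_poly_limit k1_lim.
pose a (n : nat) := fc (fun t => k1 (cis t) 0 0) n.
pose b (n : nat) := fc (fun t => k1 (cis t) 0 1) n.
have H : lim_AB eta a b.
  by move=> n; split; [exact: (poly_limit_coef n pA) | exact: (poly_limit_coef n pB)].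
have [S hS] := decay_sum dec_eta.
apply: (schur_eta H); last exact: (k1_row_quotient tri chiW chi_imag k1_lim k2_lim root_eq tpsi).
apply: (lim_AB_coef0 (S := absc (eta 0%N) ^+ 2 + S) H) => -[|m].
  rewrite big_ord0 addr_ge0 ?sqr_ge0 //.
  by have := hS 0%N; rewrite big_ord0.
by rewrite big_ord_recl lerD2l; exact: hS.
Qed.

Lemma zeta_schur eta chi zeta xi : root_subgroup_factorization g eta chi zeta ->
  taylor_at0 xi (fun z => u z 1 0 / u z 1 1) ->
  forall k, zeta k.+1 = - conjc (iter k (@schur R) (fun j => xi j.+1) 0%N).
Proof.
move=> [_ dec_zeta chiW chi_imag [k1 [k2 [k1_lim k2_lim root_eq]]]] txi.
have [pA pB] := k2_poly_limit k2_lim.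
pose a (n : nat) := fc (fun t => k2 (cis t) 1 1) n.
pose b (n : nat) := fc (fun t => k2 (cis t) 1 0) n.
have H : lim_AB (shift zeta) a (fun n => b n.+1).
  move=> n; split; first exact: (poly_limit_coef n pA).
  by apply: tends0_le (poly_limit_coef n.+1 pB) => m; rewrite coefXM.
have [S hS] := decay_sum dec_zeta.
have a00 : a 0%N != 0 := lim_AB_coef0 H hS.
have hb : forall n, b n = cauchy xi a n :=
  k2_row_quotient tri chiW chi_imag k1_lim k2_lim root_eq txi.
have b0 : b 0%N = 0.
  apply: (absc_lim_unique (poly_limit_coef 0%N pB)).
  by apply: tends0_cst0 => m; rewrite coefXM.
(* The lower left entry of [k2] has zero constant term, so one factor of [z] can be divided out of
   it and of [xi]; this aligns [k2] with the situation of [k1]. *)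
have xi0 : xi 0%N = 0.
  apply/eqP; have := hb 0%N; rewrite b0 /cauchy big_ord1 => /esym/eqP.
  by rewrite mulf_eq0 (negbTE a00) orbF.
have hb' n : b n.+1 = cauchy (fun j => xi j.+1) a n.
  by rewrite hb /cauchy big_ord_recl xi0 mul0r add0r.
by move=> k; rewrite -(schur_eta H a00 hb').
Qed.

Lemma psi_quotient psi c21 c11 :
  taylor_at0 psi (fun z => star (fun w => l w 1 0) z / star (fun w => l w 0 0) z) ->
  taylor_at_infty c21 (fun w => l w 1 0) -> taylor_at_infty c11 (fun w => l w 0 0) ->
  conj_seq c11 0%N = 1 /\ forall n, conj_seq c21 n = cauchy psi (conj_seq c11) n.
Proof.
move=> tpsi /taylor_star t21 /taylor_star t11.
have E n := hardy_taylor_fc n (hardy_lam tri 0 0) t11; split.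
  by rewrite -E (hardy_fc0 (hardy_lam tri 0 0)) (lam0_00 tri).
move=> n; rewrite -(hardy_taylor_fc n (hardy_lam tri 1 0) t21).
rewrite (taylor_quotient n (hardy_lam tri 1 0) (hardy_lam tri 0 0) (lam0_00 tri) tpsi).
by apply: eq_cauchy => // k _; exact: E.
Qed.

Lemma xi_quotient xi c21 c22 : taylor_at0 xi (fun z => u z 1 0 / u z 1 1) ->
  taylor_at0 c21 (fun z => u z 1 0) -> taylor_at0 c22 (fun z => u z 1 1) ->
  c22 0%N = 1 /\ forall n, c21 n = cauchy xi c22 n.
Proof.
move=> txi t21 t22.
have E n := hardy_taylor_fc n (hardy_u tri 1 1) t22; split.
  by rewrite -E (hardy_fc0 (hardy_u tri 1 1)) (u0_11 tri).
move=> n; rewrite -(hardy_taylor_fc n (hardy_u tri 1 0) t21).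
rewrite (taylor_quotient n (hardy_u tri 1 0) (hardy_u tri 1 1) (u0_11 tri) txi).
by apply: eq_cauchy => // k _; exact: E.
Qed.

End RootParameters.

Lemma rational_root_parameter (R : realType) i :
  rational_in (fun psi => - @conjc R (iter i (@schur R) psi 0%N)).
Proof. exact/rational_opp/rational_conj/rational_schur. Qed.

(** Independence of [g] and finiteness are expressed by choosing [N] and the polynomials before [g]
    and its factorizations. In the first half of (b) the sequence is shifted, so that the variables
    start at [xi_1]. *)
Theorem corollary1 (R : realType) :
  (* (a) *)
  ((forall i : nat,
      exists (N : nat) (P Q : mpoly.mpoly (N + N) R[i]),
        forall (g : R[i] -> 'M[R[i]]_2)
          (l : sphere R -> 'M[R[i]]_2) (m0 : R[i]) (a0 : R)
          (u : R[i] -> 'M[R[i]]_2)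
          (eta : nat -> R[i]) (chi : R[i] -> R[i]) (zeta : nat -> R[i])
          (psi : nat -> R[i]),
        W12_SU2_loop g ->
        triangular_factorization g l m0 a0 u ->
        root_subgroup_factorization g eta chi zeta ->
        taylor_at0 psi (fun z => star (fun w => l w 1 0) z
                                 / star (fun w => l w 0 0) z) ->
        eval2 Q psi (conj_seq psi) != 0 /\
        eta i = eval2 P psi (conj_seq psi) / eval2 Q psi (conj_seq psi))
   /\
   (forall n : nat,
      exists (N : nat) (P : mpoly.mpoly (N + N) R[i]),
        forall (g : R[i] -> 'M[R[i]]_2)
          (l : sphere R -> 'M[R[i]]_2) (m0 : R[i]) (a0 : R)
          (u : R[i] -> 'M[R[i]]_2)
          (psi c21 c11 : nat -> R[i]),
        W12_SU2_loop g ->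
        triangular_factorization g l m0 a0 u ->
        taylor_at0 psi (fun z => star (fun w => l w 1 0) z
                                 / star (fun w => l w 0 0) z) ->
        taylor_at_infty c21 (fun w => l w 1 0) ->
        taylor_at_infty c11 (fun w => l w 0 0) ->
        psi n = eval2 P (conj_seq c21) (conj_seq c11)))
  /\
  (* (b) *)
  ((forall k : nat, (1 <= k)%N ->
      exists (N : nat) (P Q : mpoly.mpoly (N + N) R[i]),
        forall (g : R[i] -> 'M[R[i]]_2)
          (l : sphere R -> 'M[R[i]]_2) (m0 : R[i]) (a0 : R)
          (u : R[i] -> 'M[R[i]]_2)
          (eta : nat -> R[i]) (chi : R[i] -> R[i]) (zeta : nat -> R[i])
          (xi : nat -> R[i]),
        W12_SU2_loop g ->
        triangular_factorization g l m0 a0 u ->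
        root_subgroup_factorization g eta chi zeta ->
        taylor_at0 xi (fun z => u z 1 0 / u z 1 1) ->
        eval2 Q (fun j => xi j.+1) (conj_seq (fun j => xi j.+1)) != 0 /\
        zeta k = eval2 P (fun j => xi j.+1) (conj_seq (fun j => xi j.+1))
                 / eval2 Q (fun j => xi j.+1) (conj_seq (fun j => xi j.+1)))
   /\
   (forall n : nat, (1 <= n)%N ->
      exists (N : nat) (P : mpoly.mpoly (N + N) R[i]),
        forall (g : R[i] -> 'M[R[i]]_2)
          (l : sphere R -> 'M[R[i]]_2) (m0 : R[i]) (a0 : R)
          (u : R[i] -> 'M[R[i]]_2)
          (xi c21 c22 : nat -> R[i]),
        W12_SU2_loop g ->
        triangular_factorization g l m0 a0 u ->
        taylor_at0 xi (fun z => u z 1 0 / u z 1 1) ->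
        taylor_at0 c21 (fun z => u z 1 0) ->
        taylor_at0 c22 (fun z => u z 1 1) ->
        xi n = eval2 P c21 c22)).
Proof.
split; split.
- move=> i; have [N [P [Q H]]] := rational_eval2 (rational_root_parameter R i).
  exists N, P, Q => g l m0 a0 u eta chi zeta psi _ tri root tpsi.
  by rewrite (eta_schur tri root tpsi); exact: H.
- move=> n; have [F [/polynomial_eval2[N [P HP]] HF]] := polynomial_quotient R n.
  exists N, P => g l m0 a0 u psi c21 c11 _ tri tpsi t21 t11.
  have [c0 E] := psi_quotient tri tpsi t21 t11.
  by rewrite HP; exact: HF.
- move=> [//|k] _; have [N [P [Q H]]] := rational_eval2 (rational_root_parameter R k).
  exists N, P, Q => g l m0 a0 u eta chi zeta xi _ tri root txi.
  by rewrite (zeta_schur tri root txi); exact: H.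
- move=> n _; have [F [/polynomial_eval2[N [P HP]] HF]] := polynomial_quotient R n.
  exists N, P => g l m0 a0 u xi c21 c22 _ tri txi t21 t22.
  have [c0 E] := xi_quotient tri txi t21 t22.
  by rewrite HP; exact: HF.
Qed.
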